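(* Let $\Bbbk$ be a field of characteristic zero, let $(\mathfrak g,\mathfrak h_0,\mathfrak h,\mathfrak g_+,\omega)$ be a Lie algebra over $\Bbbk$ with triangular decomposition and non-degenerate pairing (with elements $\mathbf h(\alpha)\in\mathfrak h$, $\alpha\in\Delta$), let $N$ be a positive integer, and let $\hat{\mathfrak g}=\mathfrak g\otimes_{\Bbbk}\Bbbk[t]/t^{N+1}\Bbbk[t]$ be the associated truncated current Lie algebra. Let $\Lambda\in\hat{\mathfrak h}^*$ and $\chi\in\mathcal Q_+$, and let $\Lambda_N\in\mathfrak h^*$ be given by $\langle\Lambda_N,h\rangle=\langle\Lambda,h\otimes t^N\rangle$ for $h\in\mathfrak h$. 1. The Verma module $M(\Lambda)$ for $\hat{\mathfrak g}$ contains a non-zero primitive vector of weight $\Lambda|_{\mathfrak h_0}-\chi$ if and only if $\langle\Lambda_N,\mathbf h(\alpha)\rangle=0$ for some $\alpha\in\Delta_+$ such that $\chi-\alpha\in\mathcal Q_+$. 2. $M(\Lambda)$ is reducible if and only if $\langle\Lambda_N,\mathbf h(\alpha)\rangle=0$ for some $\alpha\in\Delta$.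
   Context: Triangular decomposition. A triangular decomposition of a Lie algebra $\mathfrak g$ over $\Bbbk$ consists of non-zero abelian subalgebras $\mathfrak h_0\subset\mathfrak h$, non-zero subalgebras $\mathfrak g_+,\mathfrak g_-$ and an anti-involution $\omega:\mathfrak g\to\mathfrak g$ (an anti-automorphism of order 2) such that: (1) $\mathfrak g=\mathfrak g_-\oplus\mathfrak h\oplus\mathfrak g_+$; (2) $\mathfrak g_+$ is a weight module (i.e. diagonalizable) for $\mathfrak h_0$ under the adjoint action, with set of weights $\Delta_+\subset\mathfrak h_0^*$ all non-zero; (3) $\omega|_{\mathfrak h}=\mathrm{id}$ and $\omega(\mathfrak g_+)=\mathfrak g_-$; (4) the additive semigroup with identity $\mathcal Q_+$ generated by $\Delta_+$ is freely generated by a finite subset $\{\alpha_j\}_{j\in J}\subset\mathcal Q_+$ of linearly independent elements of $\mathfrak h_0^*$. Write $\mathfrak g_+=\bigoplus_{\alpha\in\Delta_+}\mathfrak g^\alpha$ (root spaces), $\Delta_-=-\Delta_+$, $\mathfrak g^{-\alpha}=\omega(\mathfrak g^\alpha)$, $\Delta=\Delta_+\cup\Delta_-$. All root spaces are assumed finite-dimensional and $\Delta_+$ countable. Non-degenerate pairing: for every $\alpha\in\Delta$ there are given a non-zero $\mathbf h(\alpha)\in\mathfrak h$ and a non-degenerate bilinear form $(\cdot,\cdot)_\alpha:\mathfrak g^\alpha\times\mathfrak g^\alpha\to\Bbbk$ such that $[x_1,\omega(x_2)]=(x_1,x_2)_\alpha\,\mathbf h(\alpha)$ for all $x_1,x_2\in\mathfrak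 g^\alpha$. Truncated current Lie algebra: $\hat{\mathfrak g}$ has bracket $[x\otimes t^i,y\otimes t^j]=[x,y]\otimes t^{i+j}$ (with $t^{N+1}=0$); $\hat{\mathfrak h}$ and $\hat{\mathfrak g}_\pm$ denote $\mathfrak h\otimes\Bbbk[t]/t^{N+1}$, $\mathfrak g_\pm\otimes\Bbbk[t]/t^{N+1}$. Extending $\omega$ by $x\otimes t^i\mapsto\omega(x)\otimes t^i$, $(\hat{\mathfrak g},\mathfrak h_0,\hat{\mathfrak h},\hat{\mathfrak g}_+,\omega)$ is a Lie algebra with triangular decomposition, where $\mathfrak h_0\subset\mathfrak h=\mathfrak h\otimes 1\subset\hat{\mathfrak h}$. Modules: for $\Lambda\in\hat{\mathfrak h}^*$, the Verma module is $M(\Lambda)=U(\hat{\mathfrak g})\otimes_{U(\hat{\mathfrak h}\oplus\hat{\mathfrak g}_+)}\Bbbk v_\Lambda$, where $\hat{\mathfrak g}_+v_\Lambda=0$ and $hv_\Lambda=\Lambda(h)v_\Lambda$ for $h\in\hat{\mathfrak h}$. It is a direct sum of weight spaces $M(\Lambda)^{\eta}=\{v: hv=\eta(h)v\ \forall h\in\mathfrak h_0\}$, $\eta\in\mathfrak h_0^*$. A vector $v\in M(\Lambda)^\eta$ is a primitive vector (of weight $\eta$) if the submodule $U(\hat{\mathfrak g})v\subset M(\Lambda)$ is proper. *)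

(* Defs.v *)
From HB Require Import structures.
From mathcomp Require Import all_boot ssralg generic_quotient ring_quotient.
From mathcomp Require Import boolp classical_sets functions cardinality.
From mathcomp Require Import finmap.
From mathcomp.multinomials Require Import monalg.

Set Implicit Arguments.
Unset Strict Implicit.
Unset Printing Implicit Defensive.

Import GRing.Theory.
Import quotient.

Local Open Scope classical_set_scope.
Local Open Scope ring_scope.
Local Open Scope quotient_scope.

HB.mixin Record Lmodule_isLie (k : fieldType) g of GRing.Lmodule k g := {
  bracket : g -> g -> g;
  bracketPl : forall z, linear (bracket^~ z);
  bracketPr : forall z, linear (bracket z);
  bracketxx : forall x, bracket x x = 0;
  jacobi : forall x y z,
    bracket x (bracket y z) + bracket y (bracket z x)
      + bracket z (bracket x y) = 0
}.

#[short(type="lieAlgType")]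
HB.structure Definition LieAlgebra (k : fieldType) :=
  {g of GRing.Lmodule k g & Lmodule_isLie k g}.

Notation "[ 'Lie' x , y ]" := (bracket x y)
  (at level 0, x, y at level 99, format "[ 'Lie'  x ,  y ]") : ring_scope.

HB.mixin Record isLieClosed (k : fieldType) (g : lieAlgType k) (S : {pred g}) := {
  lie_closed : {in S &, forall x y, [Lie x, y] \in S}
}.

#[short(type="lieClosed")]
HB.structure Definition LieClosed (k : fieldType) (g : lieAlgType k) :=
  {S of GRing.AddClosed g S & GRing.isScaleClosed k g S & isLieClosed k g S}.

Section LieTheory.
Variables (k : fieldType) (g : lieAlgType k).
Implicit Types x y z : g.

Definition bracketr z x := [Lie x, z].

HB.instance Definition _ z :=
  GRing.isLinear.Build k g g *:%R (bracketr z) (bracketPl z).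
HB.instance Definition _ z :=
  GRing.isLinear.Build k g g *:%R (bracket z) (bracketPr z).

Lemma bracketDl x y z : [Lie x + y, z] = [Lie x, z] + [Lie y, z].
Proof. exact: (raddfD (bracketr z)). Qed.
Lemma bracketDr x y z : [Lie z, x + y] = [Lie z, x] + [Lie z, y].
Proof. exact: raddfD. Qed.
Lemma bracket0l z : [Lie 0, z] = 0 :> g.
Proof. exact: (raddf0 (bracketr z)). Qed.
Lemma bracket0r z : [Lie z, 0] = 0 :> g.
Proof. exact: raddf0. Qed.

Lemma bracketZl c x z : [Lie c *: x, z] = c *: [Lie x, z].
Proof. by have := bracketPl z c x 0; rewrite !addr0 bracket0l addr0. Qed.
Lemma bracketZr c x z : [Lie z, c *: x] = c *: [Lie z, x].
Proof. by have := bracketPr z c x 0; rewrite !addr0 bracket0r addr0. Qed.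

Lemma bracketC x y : [Lie x, y] = - [Lie y, x].
Proof.
apply/eqP; rewrite -addr_eq0; apply/eqP.
have := bracketxx (x + y).
by rewrite bracketDl !bracketDr !bracketxx add0r addr0.
Qed.
End LieTheory.

Section SubLie.
Variables (k : fieldType) (g : lieAlgType k) (S : lieClosed g).

Record subLie : Type := SubLie { subLie_val :> g; _ : subLie_val \in S }.

HB.instance Definition _ := [isSub for subLie_val].
HB.instance Definition _ := [Choice of subLie by <:].
HB.instance Definition _ := [SubChoice_isSubLmodule of subLie by <:].

Lemma subLieP (x : subLie) : val x \in S. Proof. exact: valP. Qed.

Definition sub_bracket (x y : subLie) : subLie :=
  SubLie (lie_closed _ _ (subLieP x) (subLieP y)).

Fact sub_bracketPl z : linear (sub_bracket^~ z).
Proof. by move=> c x y; apply: val_inj; rewrite /= bracketPl. Qed.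
Fact sub_bracketPr z : linear (sub_bracket z).
Proof. by move=> c x y; apply: val_inj; rewrite /= bracketPr. Qed.
Fact sub_bracketxx x : sub_bracket x x = 0.
Proof. by apply: val_inj; rewrite /= bracketxx. Qed.
Fact sub_jacobi x y z :
  sub_bracket x (sub_bracket y z) + sub_bracket y (sub_bracket z x)
    + sub_bracket z (sub_bracket x y) = 0.
Proof. by apply: val_inj; rewrite /= jacobi. Qed.

HB.instance Definition _ := Lmodule_isLie.Build k subLie
  sub_bracketPl sub_bracketPr sub_bracketxx sub_jacobi.
End SubLie.

Section Dual.
Variables (k : fieldType) (V : lmodType k).

Definition linear_form : {pred V -> k^o} := [pred f : V -> k^o | `[< linear f >]].

Fact linear_form_submod : submod_closed linear_form.
Proof.
split=> [|a f1 f2 /asboolP f1P /asboolP f2P]; apply/asboolP=> c x y /=.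
  by rewrite scaler0 addr0.
rewrite !fctE /= f1P f2P !scalerDr !scalerA (mulrC a) -!addrA.
by congr (_ + _); rewrite addrCA.
Qed.
HB.instance Definition _ :=
  GRing.isSubmodClosed.Build k (V -> k^o) linear_form linear_form_submod.

Record dual : Type := Dual {
  dual_fun :> V -> k^o;
  _ : dual_fun \in linear_form }.

HB.instance Definition _ := [isSub for dual_fun].
HB.instance Definition _ := [Choice of dual by <:].
HB.instance Definition _ := [SubChoice_isSubLmodule of dual by <:].

Lemma dualP (f : dual) : linear f.
Proof. by case: f => f /= /asboolP. Qed.
Lemma dual0 (f : dual) : f 0 = 0.
Proof.
by have := dualP f (-1) 0 0; rewrite scaler0 addr0 scaleN1r addNr.
Qed.
End Dual.

Section DualComp.
Variables (k : fieldType) (V W : lmodType k) (f : {linear V -> W}) (phi : dual W).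

Fact dual_comp_subproof : (fun v : V => phi (f v)) \in @linear_form k V.
Proof. by apply/asboolP => c x y; rewrite linearP dualP. Qed.

Definition dual_comp : dual V := Dual dual_comp_subproof.
End DualComp.

Section Quotient.
Variables (k : fieldType) (V : lmodType k).

Definition lspan (R : set V) : {pred V} :=
  [pred v | `[< exists s : seq (k * V),
     (forall p, p \in s -> R p.2) /\ v = \sum_(p <- s) p.1 *: p.2 >]].

Variable R : set V.

Lemma lspan_incl v : R v -> v \in lspan R.
Proof.
move=> Rv; apply/asboolP; exists [:: (1, v)]; split.
  by move=> p; rewrite mem_seq1 => /eqP ->.
by rewrite big_seq1 scale1r.
Qed.

Fact lspan_submod : submod_closed (lspan R).
Proof.
split; first by apply/asboolP; exists [::]; split=> //; rewrite big_nil.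
move=> a u v /asboolP[s [sR ->]] /asboolP[t [tR ->]]; apply/asboolP.
exists ([seq (a * p.1, p.2) | p <- s] ++ t); split.
  by move=> p; rewrite mem_cat => /orP[/mapP[q qs ->]|/tR//]; exact: sR qs.
rewrite big_cat big_map scaler_sumr; congr (_ + _).
by apply: eq_bigr => p _; rewrite scalerA.
Qed.
HB.instance Definition _ := GRing.isSubmodClosed.Build k V (lspan R) lspan_submod.

Fact lspan_oppr : oppr_closed (lspan R).
Proof. by move=> x xR; rewrite -scaleN1r rpredZ. Qed.
HB.instance Definition _ := GRing.isOppClosed.Build V (lspan R) lspan_oppr.

(* The quotient of V by the subspace spanned by R. *)
Definition lquot : Type := {ideal_quot (lspan R)}.
HB.instance Definition _ := GRing.Zmodule.on lquot.

Definition lproj (v : V) : lquot := \pi_{ideal_quot (lspan R)} v.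
Definition lrepr (x : lquot) : V := repr (x : {ideal_quot (lspan R)}).

Lemma lreprK : cancel lrepr lproj. Proof. by move=> x; rewrite /lproj reprK. Qed.

Lemma lproj_eq u v : (lproj u == lproj v) = (u - v \in lspan R).
Proof. by rewrite Quotient.idealrBE. Qed.

Lemma lprojB : {morph lproj : u v / u - v}.
Proof. exact: (pi_is_zmod_morphism {ideal_quot (lspan R)}). Qed.

HB.instance Definition _ := GRing.isZmodMorphism.Build V lquot lproj lprojB.

Definition lscale (c : k) (x : lquot) : lquot := lproj (c *: lrepr x).

Lemma lprojZ c v : lproj (c *: v) = lscale c (lproj v).
Proof.
by apply/eqP; rewrite lproj_eq -scalerBr rpredZ // -lproj_eq lreprK.
Qed.

Fact lscaleA a b x : lscale a (lscale b x) = lscale (a * b) x.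
Proof. by rewrite -[x]lreprK -!lprojZ scalerA. Qed.
Fact lscale1 : left_id 1 lscale.
Proof. by move=> x; rewrite -[x]lreprK -lprojZ scale1r. Qed.
Fact lscaleDr : right_distributive lscale +%R.
Proof.
by move=> c x y; rewrite -[x]lreprK -[y]lreprK -raddfD -!lprojZ scalerDr raddfD.
Qed.
Fact lscaleDl x : {morph lscale^~ x : a b / a + b}.
Proof. by move=> a b; rewrite -[x]lreprK -!lprojZ scalerDl raddfD. Qed.

HB.instance Definition _ := GRing.Zmodule_isLmodule.Build k lquot
  lscaleA lscale1 lscaleDr lscaleDl.

Fact lproj_scalable : scalable lproj.
Proof. exact: lprojZ. Qed.
HB.instance Definition _ :=
  GRing.isScalable.Build k V lquot *:%R lproj lproj_scalable.

Lemma lspan_ker (W : lmodType k) (f : {linear V -> W}) v :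
  (forall r, R r -> f r = 0) -> v \in lspan R -> f v = 0.
Proof.
move=> fR /asboolP[s [sR ->]]; rewrite linear_sum big_seq big1 // => p /sR pR.
by rewrite linearZ /= fR // scaler0.
Qed.
End Quotient.

Section Ideal.
Variables (k : fieldType) (A : algType k) (R : set A).

(* lspan two_sided is the two-sided ideal of A generated by R. *)
Definition two_sided : set A :=
  [set u | exists a r b, R r /\ u = a * r * b].

Lemma two_sided_incl r : R r -> r \in lspan two_sided.
Proof. by move=> Rr; apply: lspan_incl; exists 1, r, 1; rewrite mul1r mulr1. Qed.

Lemma two_sided_mul a u b :
  u \in lspan two_sided -> a * u * b \in lspan two_sided.
Proof.
move=> /asboolP[s [sI ->]]; rewrite mulr_sumr mulr_suml big_seq.
apply: rpred_sum => p /sI[a' [r [b' [rR ->]]]].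
rewrite -scalerAr -scalerAl rpredZ //; apply: lspan_incl.
by exists (a * a'), r, (b' * b); split=> //; rewrite !mulrA.
Qed.

Lemma two_sided_mulr u b : u \in lspan two_sided -> u * b \in lspan two_sided.
Proof. by move=> /(two_sided_mul 1 b); rewrite mul1r. Qed.
Lemma two_sided_mull a u : u \in lspan two_sided -> a * u \in lspan two_sided.
Proof. by move=> /(two_sided_mul a 1); rewrite mulr1. Qed.

Lemma two_sided_subM u v u' v' :
  u - u' \in lspan two_sided -> v - v' \in lspan two_sided ->
  u * v - u' * v' \in lspan two_sided.
Proof.
move=> uI vI; have -> : u * v - u' * v' = (u - u') * v + u' * (v - v').
  by rewrite mulrBl mulrBr addrA addrNK.
by apply: rpredD; [apply: two_sided_mulr | apply: two_sided_mull].
Qed.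

Lemma two_sided_ker (B : algType k) (f : {lrmorphism A -> B}) u :
  (forall r, R r -> f r = 0) -> u \in lspan two_sided -> f u = 0.
Proof.
move=> fR; apply: lspan_ker => _ [a [r [b [rR ->]]]].
have fM u' v' : f (u' * v') = f u' * f v' by exact: rmorphM.
by rewrite -[LHS]/(f (a * r * b)) 2!fM (fR r rR) mulr0 mul0r.
Qed.
End Ideal.

Section Enveloping.
Variables (k : fieldType) (L : lieAlgType k).

(* The free associative algebra on the set L. *)
Definition freeAlg : Type := {malg k[{fmonom L}]}.
HB.instance Definition _ := GRing.Lalgebra.on freeAlg.

Fact freeAlg_scalerAr (c : k) (u v : freeAlg) : c *: (u * v) = u * (c *: v).
Proof.
rewrite scalerAl (malgMEw (msuppZ_le _ _) (fsubset_refl (msupp v))).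
rewrite (malgMEw (fsubset_refl (msupp u)) (msuppZ_le _ _)).
apply: eq_bigr => w _; apply: eq_bigr => w' _.
by rewrite !mcoeffZ mulrCA mulrA.
Qed.
HB.instance Definition _ := GRing.Lalgebra_isAlgebra.Build k freeAlg freeAlg_scalerAr.

Definition fgen (x : L) : freeAlg := mkmalgU (fmu x) 1.

(* The value on a word, resp. on an element of the free algebra, of the
   extension of f : L -> A to the free algebra. *)
Definition word_eval (A : lalgType k) (f : L -> A) (w : {fmonom L}) : A :=
  \prod_(x <- (w : seq L)) f x.
Definition free_eval (A : lalgType k) (f : L -> A) (u : freeAlg) : A :=
  mmap (in_alg A) (word_eval f) u.

Section FreeEval.
Variables (A : algType k) (f : L -> A).

Fact word_eval1 : word_eval f mone = 1.
Proof. by rewrite /word_eval fm1 big_nil. Qed.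
Fact word_evalM v w : word_eval f (mmul v w) = word_eval f v * word_eval f w.
Proof. by rewrite /word_eval fmM big_cat. Qed.
Fact word_eval_mmorphism : mmorphism (word_eval f).
Proof. by split; [exact: word_evalM | exact: word_eval1]. Qed.
HB.instance Definition _ :=
  isMultiplicative.Build {fmonom L} A (word_eval f) word_eval_mmorphism.

Fact free_eval_zmod : zmod_morphism (free_eval f).
Proof. exact: mmapB. Qed.
HB.instance Definition _ :=
  GRing.isZmodMorphism.Build freeAlg A (free_eval f) free_eval_zmod.

Fact free_eval_monoid : monoid_morphism (free_eval f).
Proof.
have [] := @commr_mmap_is_multiplicative _ _ _ (in_alg A) (word_eval f).
  by move=> u v w; rewrite /= /GRing.comm mulr_algl mulr_algr.
by split.
Qed.
HB.instance Definition _ :=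
  GRing.isMonoidMorphism.Build freeAlg A (free_eval f) free_eval_monoid.

Fact free_eval_scalable : scalable (free_eval f).
Proof. by move=> c u; rewrite /free_eval mmapZ mulr_algl. Qed.
HB.instance Definition _ :=
  GRing.isScalable.Build k freeAlg A *:%R (free_eval f) free_eval_scalable.

Lemma free_eval_gen x : free_eval f (fgen x) = f x.
Proof. by rewrite /free_eval mmapU /= scale1r mul1r /word_eval fmU big_seq1. Qed.

Lemma free_evalB u v : free_eval f (u - v) = free_eval f u - free_eval f v.
Proof. exact: raddfB. Qed.
Lemma free_evalM u v : free_eval f (u * v) = free_eval f u * free_eval f v.
Proof. exact: (rmorphM (free_eval f)). Qed.
Lemma free_eval_comm u v w :
  free_eval f (u * v - v * u - w) =
  free_eval f u * free_eval f v - free_eval f v * free_eval f u - free_eval f w.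
Proof.
by rewrite free_evalB; congr (_ - _); rewrite free_evalB;
   congr (_ - _); exact: free_evalM.
Qed.
Lemma free_eval1 : free_eval f 1 = 1.
Proof. exact: (rmorph1 (free_eval f)). Qed.
Lemma free_eval_linear : linear (free_eval f).
Proof. by move=> c u v; rewrite linearP. Qed.
End FreeEval.

(* The relations making fgen linear (so that the quotient by these alone is
   the tensor algebra of L), together with x y - y x = [x, y]. *)
Inductive env_rel : set freeAlg :=
| EnvLinear c x y :
    env_rel (fgen (c *: x + y) - (c *: fgen x + fgen y))
| EnvBracket x y :
    env_rel (fgen x * fgen y - fgen y * fgen x - fgen [Lie x, y]).

Definition env_ideal : set freeAlg := two_sided env_rel.

Definition env : Type := lquot env_ideal.
HB.instance Definition _ := GRing.Lmodule.on env.
Definition env_proj : freeAlg -> env := @lproj k freeAlg env_ideal.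
Definition env_repr : env -> freeAlg := @lrepr k freeAlg env_ideal.

Lemma env_reprK : cancel env_repr env_proj. Proof. exact: lreprK. Qed.

Fact env_proj_linear : linear env_proj.
Proof. by move=> c u v; rewrite /env_proj linearP. Qed.

Lemma env_projD u v : env_proj (u + v) = env_proj u + env_proj v.
Proof. exact: raddfD. Qed.
Lemma env_projB u v : env_proj (u - v) = env_proj u - env_proj v.
Proof. exact: raddfB. Qed.
Lemma env_projZ c u : env_proj (c *: u) = c *: env_proj u.
Proof. exact: linearZ. Qed.
Lemma env_proj_eq u v : (env_proj u == env_proj v) = (u - v \in lspan env_ideal).
Proof. exact: lproj_eq. Qed.
Lemma env_proj0 : env_proj 0 = 0. Proof. exact: raddf0. Qed.

Definition env1 : env := env_proj 1.
Definition envM : env -> env -> env :=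
  locked (fun u v => env_proj (env_repr u * env_repr v)).

Lemma env_projM u v : env_proj (u * v) = envM (env_proj u) (env_proj v).
Proof.
apply/eqP; rewrite /envM -lock env_proj_eq.
by apply: two_sided_subM; rewrite -env_proj_eq env_reprK.
Qed.

Definition lie_morphism (A : lalgType k) (f : L -> A) : Prop :=
  linear f /\ forall x y, f [Lie x, y] = f x * f y - f y * f x.

Lemma free_eval_ideal (A : algType k) (f : L -> A) u :
  lie_morphism f -> u \in lspan env_ideal -> free_eval f u = 0.
Proof.
move=> [flin fbr]; apply: (two_sided_ker (f := free_eval f)) => _ [c x y|x y].
  by rewrite -[LHS]/(free_eval f _) free_evalB free_eval_linear !free_eval_gen flin subrr.
rewrite -[LHS]/(free_eval f _) free_eval_comm.
by rewrite !free_eval_gen fbr subrr.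
Qed.

Fact env_mulA : associative envM.
Proof.
move=> u v w; rewrite -[u]env_reprK -[v]env_reprK -[w]env_reprK.
by rewrite -4!env_projM mulrA.
Qed.
Fact env_mul1r : left_id env1 envM.
Proof. by move=> u; rewrite -[u]env_reprK -env_projM mul1r. Qed.
Fact env_mulr1 : right_id env1 envM.
Proof. by move=> u; rewrite -[u]env_reprK -env_projM mulr1. Qed.
Fact env_mulDl : left_distributive envM +%R.
Proof.
move=> u v w; rewrite -[u]env_reprK -[v]env_reprK -[w]env_reprK.
by rewrite -2!env_projM -2!env_projD -env_projM mulrDl.
Qed.
Fact env_mulDr : right_distributive envM +%R.
Proof.
move=> u v w; rewrite -[u]env_reprK -[v]env_reprK -[w]env_reprK.
by rewrite -2!env_projM -2!env_projD -env_projM mulrDr.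
Qed.
Fact env_1neq0 : env1 != 0.
Proof.
rewrite -env_proj0 env_proj_eq subr0.
apply/negP => /(@free_eval_ideal k^o (fun=> 0)) H.
have : (1 : k^o) == 0.
  rewrite -[1](free_eval1 (fun=> 0 : k^o)) H //.
  by split=> [c x y|x y]; rewrite ?scaler0 ?addr0 ?mul0r ?subrr.
by rewrite oner_eq0.
Qed.

HB.instance Definition _ := GRing.Zmodule_isNzRing.Build env
  env_mulA env_mul1r env_mulr1 env_mulDl env_mulDr env_1neq0.

Fact env_scalerAl (c : k) (u v : env) : c *: (u * v) = (c *: u) * v.
Proof.
rewrite -[u]env_reprK -[v]env_reprK -env_projZ -[_ * _]env_projM.
by rewrite -[RHS]env_projM -scalerAl env_projZ.
Qed.
Fact env_scalerAr (c : k) (u v : env) : c *: (u * v) = u * (c *: v).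
Proof.
rewrite -[u]env_reprK -[v]env_reprK -env_projZ -[_ * _]env_projM.
by rewrite -[RHS]env_projM -scalerAr env_projZ.
Qed.
HB.instance Definition _ := GRing.Lmodule_isLalgebra.Build k env env_scalerAl.
HB.instance Definition _ := GRing.Lalgebra_isAlgebra.Build k env env_scalerAr.

Definition env_in (x : L) : env := env_proj (fgen x).

Lemma env_rel0 r : env_rel r -> env_proj r = 0.
Proof.
move=> rR; rewrite -env_proj0; apply/eqP; rewrite env_proj_eq subr0.
exact: two_sided_incl.
Qed.

Lemma env_in_morphism : lie_morphism env_in.
Proof.
split=> [c x y|x y]; apply/eqP; rewrite -subr_eq0; apply/eqP.
  by rewrite -env_projZ -env_projD -env_projB; exact: env_rel0 (EnvLinear c x y).
apply/eqP; rewrite -oppr_eq0 opprB; apply/eqP.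
rewrite -[env_in x * _]env_projM -[env_in y * _]env_projM -2!env_projB.
exact: env_rel0 (EnvBracket x y).
Qed.

(* The universal property: the extension of a Lie algebra morphism f : L -> A
   to an algebra morphism. *)
Definition env_lift (A : algType k) (f : L -> A) (u : env) : A :=
  free_eval f (env_repr u).

Section Lift.
Variables (A : algType k) (f : L -> A).
Hypothesis f_morph : lie_morphism f.

Lemma env_lift_proj u : env_lift f (env_proj u) = free_eval f u.
Proof.
apply/eqP; rewrite -subr_eq0 -raddfB; apply/eqP.
by apply: (free_eval_ideal f_morph); rewrite -env_proj_eq env_reprK.
Qed.

Lemma env_lift_in x : env_lift f (env_in x) = f x.
Proof. by rewrite env_lift_proj free_eval_gen. Qed.

Lemma env_lift_linear : linear (env_lift f).
Proof.
move=> c u v; rewrite -[u]env_reprK -[v]env_reprK -env_projZ -env_projD.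
by rewrite !env_lift_proj free_eval_linear.
Qed.

Lemma env_liftM u v : env_lift f (u * v) = env_lift f u * env_lift f v.
Proof.
rewrite -[u]env_reprK -[v]env_reprK -[_ * _]env_projM !env_lift_proj.
exact: free_evalM.
Qed.

Lemma env_lift1 : env_lift f 1 = 1.
Proof. by rewrite env_lift_proj free_eval1. Qed.
End Lift.
End Enveloping.

Section LinearExtension.
Variables (k : fieldType) (K : choiceType) (V : lmodType k) (f : K -> V).

(* The linear extension of f to the vector space with basis K. *)
Definition mlin (u : {malg k[K]}) : V := \sum_(x <- msupp u) mcoeff x u *: f x.

Lemma mlinEw (d : {fset K}) u :
  (msupp u `<=` d)%fset -> mlin u = \sum_(x <- d) mcoeff x u *: f x.
Proof.
move=> le_d; rewrite /mlin (big_fset_incl _ le_d) // => x _ /mcoeff_outdom ->.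
by rewrite scale0r.
Qed.

Fact mlin_linear : linear mlin.
Proof.
move=> c u v; set d := (msupp (c *: u + v) `|` (msupp u `|` msupp v))%fset.
have d1 : (msupp (c *: u + v) `<=` d)%fset by rewrite fsubsetUl.
have d2 : (msupp u `<=` d)%fset.
  by apply: fsubset_trans (fsubsetUr _ _); rewrite fsubsetUl.
have d3 : (msupp v `<=` d)%fset.
  by apply: fsubset_trans (fsubsetUr _ _); rewrite fsubsetUr.
rewrite (mlinEw d1) (mlinEw d2) (mlinEw d3) scaler_sumr -big_split /=.
by apply: eq_bigr => x _; rewrite mcoeffD mcoeffZ scalerDl scalerA.
Qed.
HB.instance Definition _ :=
  GRing.isLinear.Build k {malg k[K]} V *:%R mlin mlin_linear.

Lemma mlinU x : mlin (mkmalgU x 1) = f x.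
Proof.
by rewrite (mlinEw msuppU_le) big_seq_fset1 mcoeffUU scale1r.
Qed.
End LinearExtension.

Section Induced.
Variables (k : fieldType) (B A : algType k) (iota : B -> A).
Variables (W : lmodType k) (act : B -> W -> W).

Definition freeAW : Type := {malg k[(A * W)%type]}.
HB.instance Definition _ := GRing.Lmodule.on freeAW.

Definition tbasis (a : A) (w : W) : freeAW := mkmalgU (a, w) 1.

Inductive ind_rel : set freeAW :=
| IndLinearl c a a' w :
    ind_rel (tbasis (c *: a + a') w - (c *: tbasis a w + tbasis a' w))
| IndLinearr c a w w' :
    ind_rel (tbasis a (c *: w + w') - (c *: tbasis a w + tbasis a w'))
| IndBalanced a b w :
    ind_rel (tbasis (a * iota b) w - tbasis a (act b w)).

(* The tensor product of A and W over B, for the right action of B on A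
   through iota and the left action act of B on W. *)
Definition induced : Type := lquot ind_rel.
HB.instance Definition _ := GRing.Lmodule.on induced.

Definition ind_proj : freeAW -> induced := @lproj k _ ind_rel.
Definition ind_repr : induced -> freeAW := @lrepr k _ ind_rel.

Definition tensor (a : A) (w : W) : induced := ind_proj (tbasis a w).

Definition tmul (a : A) : freeAW -> freeAW :=
  mlin (fun p : A * W => tbasis (a * p.1) p.2).

(* The left action of A: a sends a' (x) w to (a a') (x) w. *)
Definition ind_act : A -> induced -> induced :=
  locked (fun a x => ind_proj (tmul a (ind_repr x))).

Lemma ind_reprK : cancel ind_repr ind_proj. Proof. exact: lreprK. Qed.

Fact ind_proj_linear : linear ind_proj.
Proof. by move=> c u v; rewrite /ind_proj linearP. Qed.
HB.instance Definition _ :=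
  GRing.isLinear.Build k freeAW induced *:%R ind_proj ind_proj_linear.

Fact tmul_linear a : linear (tmul a).
Proof. exact: mlin_linear. Qed.
HB.instance Definition _ a :=
  GRing.isLinear.Build k freeAW freeAW *:%R (tmul a) (tmul_linear a).

Lemma tmul_basis a b w : tmul a (tbasis b w) = tbasis (a * b) w.
Proof. by rewrite /tmul mlinU. Qed.

Lemma ind_proj_eq u v : (ind_proj u = ind_proj v) <-> (u - v \in lspan ind_rel).
Proof.
split=> [/eqP|]; first by rewrite [_ == _]lproj_eq.
by move=> uv; apply/eqP; rewrite [_ == _]lproj_eq.
Qed.

Lemma ind_rel0 r : ind_rel r -> ind_proj r = 0.
Proof.
move=> rR; rewrite -(raddf0 ind_proj); apply/ind_proj_eq.
by rewrite subr0; apply: lspan_incl.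
Qed.

Lemma tmul_ker a u : u \in lspan ind_rel -> ind_proj (tmul a u) = 0.
Proof.
have tmulB x y : tmul a (x - y) = tmul a x - tmul a y by exact: raddfB.
apply: (lspan_ker (f := ind_proj \o tmul a)) => _ [c b b' w|c b w w'|b b' w];
  rewrite -[LHS]/(ind_proj (tmul a _)) tmulB ?tmul_linear !tmul_basis;
  apply: ind_rel0.
- by rewrite mulrDr -scalerAr; exact: IndLinearl.
- exact: IndLinearr.
- by rewrite mulrA; exact: IndBalanced.
Qed.

Lemma ind_act_proj a u : ind_act a (ind_proj u) = ind_proj (tmul a u).
Proof.
have tmulB x y : tmul a (x - y) = tmul a x - tmul a y by exact: raddfB.
rewrite /ind_act -lock; apply/eqP; rewrite -subr_eq0 -raddfB /= -tmulB.
by rewrite tmul_ker //; apply/ind_proj_eq; rewrite ind_reprK.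
Qed.

Lemma ind_act_tensor a b w : ind_act a (tensor b w) = tensor (a * b) w.
Proof. by rewrite /tensor ind_act_proj tmul_basis. Qed.

Lemma tensor_linearl w : linear (tensor^~ w).
Proof.
move=> c a b; apply/eqP; rewrite -subr_eq0; apply/eqP.
rewrite /tensor -linearZ -raddfD -raddfB /=; exact: ind_rel0 (IndLinearl _ _ _ _).
Qed.
Lemma tensor_linearr a : linear (tensor a).
Proof.
move=> c v w; apply/eqP; rewrite -subr_eq0; apply/eqP.
rewrite /tensor -linearZ -raddfD -raddfB /=; exact: ind_rel0 (IndLinearr _ _ _ _).
Qed.
Lemma tensor_balanced a b w : tensor (a * iota b) w = tensor a (act b w).
Proof.
apply/eqP; rewrite -subr_eq0; apply/eqP.
rewrite /tensor -raddfB /=; exact: ind_rel0 (IndBalanced _ _ _).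
Qed.

Lemma induced_ind (P : induced -> Prop) :
  (forall c a w x, P x -> P (c *: tensor a w + x)) -> P 0 -> forall x, P x.
Proof.
move=> PS P0 x; rewrite -[x]ind_reprK; move: (ind_repr x) => u.
have {1}-> : u = \sum_(p <- msupp u) mcoeff p u *: tbasis p.1 p.2.
  rewrite [LHS]monalgE; apply: eq_bigr => p _.
  by apply/malgP => q; rewrite mcoeffZ !mcoeffU mulr_natr -surjective_pairing.
rewrite linear_sum; elim/big_rec: _ => // p y _ Py.
by rewrite linearZ; apply: PS.
Qed.

Lemma ind_act_linear a : linear (ind_act a).
Proof.
move=> c x y; rewrite -[x]ind_reprK -[y]ind_reprK -linearZ -raddfD !ind_act_proj.
by rewrite tmul_linear linearP.
Qed.

Lemma ind_act0 a : ind_act a 0 = 0.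
Proof.
have tmul0 : tmul a 0 = 0 by exact: raddf0.
by rewrite -(raddf0 ind_proj) ind_act_proj tmul0.
Qed.

Lemma ind_act1 x : ind_act 1 x = x.
Proof.
elim/induced_ind: x => [c a w x IHx|].
  by rewrite ind_act_linear IHx ind_act_tensor mul1r.
exact: ind_act0.
Qed.

Lemma ind_actM a b x : ind_act (a * b) x = ind_act a (ind_act b x).
Proof.
elim/induced_ind: x => [c d w x IHx|]; last by rewrite !ind_act0.
by rewrite !ind_act_linear IHx !ind_act_tensor mulrA.
Qed.

Lemma ind_actDZ c a b x : ind_act (c *: a + b) x = c *: ind_act a x + ind_act b x.
Proof.
elim/induced_ind: x => [d e w x IHx|]; last by rewrite !ind_act0 scaler0 addr0.
rewrite !ind_act_linear IHx !ind_act_tensor mulrDl -scalerAl.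
rewrite [tensor _ _]tensor_linearl !scalerDr !scalerA (mulrC d) -!addrA.
by congr (_ + _); rewrite addrCA.
Qed.
End Induced.

Section Current.
Variables (k : fieldType) (N : nat) (g : lieAlgType k).

(* x : current stands for the sum over i of (x i) t^i, with t^(N+1) = 0. *)
Definition current : Type := {ffun 'I_N.+1 -> g}.
HB.instance Definition _ := GRing.Lmodule.on current.

Definition current_bracket (x y : current) : current :=
  [ffun m : 'I_N.+1 =>
     \sum_(i < N.+1) \sum_(j < N.+1 | (i + j == m)%N) [Lie x i, y j]].

Fact current_bracketPl z : linear (current_bracket^~ z).
Proof.
move=> c x y; apply/ffunP => m; rewrite !ffunE scaler_sumr -big_split /=.
apply: eq_bigr => i _; rewrite scaler_sumr -big_split /=.
by apply: eq_bigr => j _; rewrite !ffunE bracketPl.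
Qed.
Fact current_bracketPr z : linear (current_bracket z).
Proof.
move=> c x y; apply/ffunP => m; rewrite !ffunE scaler_sumr -big_split /=.
apply: eq_bigr => i _; rewrite scaler_sumr -big_split /=.
by apply: eq_bigr => j _; rewrite !ffunE bracketPr.
Qed.
Fact current_bracketxx x : current_bracket x x = 0.
Proof.
apply/ffunP => m; rewrite !ffunE.
pose F (i j : 'I_N.+1) := if (i + j == m)%N then [Lie x i, x j] else 0 : g.
pose G (i j : 'I_N.+1) := if (i < j)%N then F i j else 0.
transitivity (\sum_i \sum_j (G i j - G j i)).
  apply: eq_bigr => i _; rewrite big_mkcond /=; apply: eq_bigr => j _.
  rewrite -[LHS]/(F i j) /G; case: ltngtP => [_|_|/val_inj ->].
  - by rewrite subr0.
  - rewrite sub0r /F addnC; case: ifP => _; last by rewrite oppr0.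
    exact: bracketC.
  - by rewrite subrr /F bracketxx if_same.
under eq_bigr do rewrite sumrB.
by rewrite sumrB [X in _ - X]exchange_big subrr.
Qed.

Fact current_bracket3 u v w (m : 'I_N.+1) :
  current_bracket u (current_bracket v w) m =
  \sum_(i < N.+1) \sum_(p < N.+1) \sum_(q < N.+1)
    (if (i + (p + q) == m)%N then [Lie u i, [Lie v p, w q]] else 0).
Proof.
rewrite ffunE; apply: eq_bigr => i _.
transitivity (\sum_(j < N.+1 | (i + j == m)%N) \sum_(p < N.+1) \sum_(q < N.+1)
    (if (p + q == j)%N then [Lie u i, [Lie v p, w q]] else 0)).
  apply: eq_bigr => j _; rewrite ffunE linear_sum; apply: eq_bigr => p _.
  by rewrite linear_sum big_mkcond.
rewrite exchange_big; apply: eq_bigr => p _.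
rewrite exchange_big; apply: eq_bigr => q _ /=.
have [lt_pq|ge_pq] := ltnP (p + q) N.+1; last first.
  rewrite big1 => [|j _]; last by rewrite gtn_eqF // (leq_trans _ ge_pq).
  by rewrite gtn_eqF // (leq_trans _ (leq_trans ge_pq (leq_addl i _))).
rewrite big_mkcond (bigD1 (Ordinal lt_pq)) //= eqxx big1 ?addr0 // => j ne_j.
have [pq|_] := eqVneq (p + q)%N j; last by rewrite if_same.
by case/eqP: ne_j; apply: val_inj; rewrite /= pq.
Qed.

Fact current_jacobi x y z :
  current_bracket x (current_bracket y z) + current_bracket y (current_bracket z x)
    + current_bracket z (current_bracket x y) = 0.
Proof.
have rot (F : 'I_N.+1 -> 'I_N.+1 -> 'I_N.+1 -> g) :
    \sum_i \sum_p \sum_q F i p q = \sum_i \sum_p \sum_q F p q i.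
  by rewrite [RHS]exchange_big; apply: eq_bigr => i _; rewrite [RHS]exchange_big.
apply/ffunP => m; rewrite 2!ffunE !current_bracket3 ffunE.
rewrite [X in _ + X + _]rot [X in _ + X](rot) [X in _ + X](rot).
rewrite -!big_split big1 // => i _; rewrite -!big_split big1 // => p _.
rewrite -!big_split big1 // => q _ /=.
have -> : (p + (q + i) = i + (p + q))%N by rewrite addnA addnC.
have -> : (q + (i + p) = i + (p + q))%N by rewrite addnC addnA.
case: ifP => _; last by rewrite !addr0.
exact: jacobi.
Qed.

HB.instance Definition _ := Lmodule_isLie.Build k current
  current_bracketPl current_bracketPr current_bracketxx current_jacobi.

(* x (x) t^i *)
Definition tpow (i : 'I_N.+1) (x : g) : current :=
  [ffun j => if j == i then x else 0].

Lemma bracket_tpow (i j m : 'I_N.+1) (x y : g) :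
  [Lie tpow i x, tpow j y] m = if (i + j == m)%N then [Lie x, y] else 0.
Proof.
rewrite ffunE (bigD1 i) //= [X in _ + X]big1 ?addr0 => [|i' ne_i]; last first.
  by rewrite big1 // => j' _; rewrite ffunE (negbTE ne_i) bracket0l.
rewrite big_mkcond (bigD1 j) //= [X in _ + X]big1 ?addr0 => [|j' ne_j].
  by rewrite !ffunE !eqxx.
by case: ifP => // _; rewrite [tpow j y j']ffunE (negbTE ne_j) bracket0r.
Qed.

Section CurrentSub.
Variable S : lieClosed g.

(* S (x) k[t]/t^(N+1) *)
Definition cur : {pred current} := [pred x : current | [forall i, x i \in S]].

Lemma curP (x : current) : reflect (forall i, x i \in S) (x \in cur).
Proof. exact: forallP. Qed.

Fact cur_submod : submod_closed cur.
Proof.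
split=> [|c x y /curP xS /curP yS]; apply/curP => i.
  by rewrite ffunE rpred0.
by rewrite !ffunE rpredD ?rpredZ.
Qed.
HB.instance Definition _ := GRing.isSubmodClosed.Build k current cur cur_submod.

Fact cur_lie : {in cur &, forall x y : current, [Lie x, y] \in cur}.
Proof.
move=> x y /curP xS /curP yS; apply/curP => m; rewrite ffunE.
by apply: rpred_sum => i _; apply: rpred_sum => j _; apply: lie_closed.
Qed.
HB.instance Definition _ := isLieClosed.Build k current cur cur_lie.
End CurrentSub.
End Current.

Arguments cur {k} N {g} S.

Section Inclusion.
Variables (k : fieldType) (g : lieAlgType k).

Definition inclusion (S1 S2 : lieClosed g) (sub : {subset S1 <= S2})
    (x : subLie S1) : subLie S2 := SubLie (sub _ (subLieP x)).

Fact inclusion_linear (S1 S2 : lieClosed g) (sub : {subset S1 <= S2}) :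
  linear (inclusion sub).
Proof. by move=> c x y; apply: val_inj. Qed.
HB.instance Definition _ S1 S2 sub :=
  GRing.isLinear.Build k (subLie S1) (subLie S2) *:%R (@inclusion S1 S2 sub)
    (inclusion_linear sub).

Variables (N : nat) (S : lieClosed g).

Fact tpow_cur (i : 'I_N.+1) (x : subLie S) : tpow i (val x) \in cur N S.
Proof.
apply/curP => j; rewrite ffunE.
by case: ifP => _; [exact: subLieP | exact: rpred0].
Qed.

(* x |-> x (x) t^i, as a map from S to S (x) k[t]/t^(N+1) *)
Definition sub_tpow (i : 'I_N.+1) (x : subLie S) : subLie (cur N S) :=
  SubLie (tpow_cur i x).

Fact sub_tpow_linear i : linear (sub_tpow i).
Proof.
move=> c x y; apply/val_inj/ffunP => j; rewrite !ffunE.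
by case: ifP => _ //; rewrite scaler0 addr0.
Qed.
HB.instance Definition _ i :=
  GRing.isLinear.Build k (subLie S) (subLie (cur N S)) *:%R (sub_tpow i)
    (sub_tpow_linear i).
End Inclusion.

Section Weights.
Variables (k : fieldType) (g : lieAlgType k) (h0 S : lieClosed g).
Implicit Types alpha chi : dual (subLie h0).

Definition weight_space alpha : set g :=
  [set x | x \in S /\ forall h : subLie h0, [Lie val h, x] = (alpha h : k) *: x].

Definition weight alpha : Prop := exists2 x, weight_space alpha x & x != 0.

Definition weight_monoid chi : Prop :=
  exists s : seq (dual (subLie h0)),
    (forall alpha, alpha \in s -> weight alpha) /\ chi = \sum_(alpha <- s) alpha.
End Weights.

Record triangular (k : fieldType) (g : lieAlgType k) : Type := Triangular {
  tri_h0 : lieClosed g;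
  tri_h : lieClosed g;
  tri_gp : lieClosed g;
  tri_gm : lieClosed g;
  tri_omega : {linear g -> g};

  tri_h0_neq0 : exists2 x, x \in tri_h0 & x != 0;
  tri_gp_neq0 : exists2 x, x \in tri_gp & x != 0;
  tri_gm_neq0 : exists2 x, x \in tri_gm & x != 0;
  tri_h0_sub : {subset tri_h0 <= tri_h};
  tri_h_abelian : {in tri_h &, forall x y, [Lie x, y] = 0};

  tri_omega_bracket : forall x y, tri_omega [Lie x, y] = [Lie tri_omega y, tri_omega x];
  tri_omegaK : involutive tri_omega;
  tri_omega_neq_id : ~ tri_omega =1 id;

  tri_sum : forall x, exists a b c,
    [/\ a \in tri_gm, b \in tri_h, c \in tri_gp & x = a + b + c];
  tri_direct : forall a b c, a \in tri_gm -> b \in tri_h -> c \in tri_gp ->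
    a + b + c = 0 -> [/\ a = 0, b = 0 & c = 0];

  tri_gp_weight : forall x, x \in tri_gp -> exists s : seq g,
    (forall y, y \in s -> exists alpha, @weight_space k g tri_h0 tri_gp alpha y)
    /\ x = \sum_(y <- s) y;
  tri_weight_neq0 : forall alpha, @weight k g tri_h0 tri_gp alpha -> alpha != 0;

  tri_omega_h : {in tri_h, forall x, tri_omega x = x};
  tri_omega_gp : forall y, y \in tri_gm <-> exists2 x, x \in tri_gp & y = tri_omega x;

  (* The a i are linearly independent and freely generate the monoid. *)
  tri_Qplus_free : exists (n : nat) (a : 'I_n -> dual (subLie tri_h0)),
    [/\ forall c : 'I_n -> k, \sum_i c i *: a i = 0 -> forall i, c i = 0,
        forall i, @weight_monoid k g tri_h0 tri_gp (a i)
      & forall chi, @weight_monoid k g tri_h0 tri_gp chi ->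
          exists! m : {ffun 'I_n -> nat}, chi = \sum_i a i *+ m i];

  tri_root_finite_dim : forall alpha, @weight k g tri_h0 tri_gp alpha -> exists s : seq g,
    forall x, @weight_space k g tri_h0 tri_gp alpha x ->
      exists c : nat -> k, x = \sum_(i < size s) c i *: s`_i;
  tri_weight_countable : countable [set alpha | @weight k g tri_h0 tri_gp alpha]
}.

Section Roots.
Variables (k : fieldType) (g : lieAlgType k) (T : triangular g).
Implicit Types alpha chi : dual (subLie (tri_h0 T)).

Definition Delta_plus alpha : Prop := weight (tri_gp T) alpha.
Definition Delta alpha : Prop := Delta_plus alpha \/ Delta_plus (- alpha).
Definition Qplus chi : Prop := weight_monoid (tri_gp T) chi.

(* For alpha in Delta_plus this is g^alpha inside g_+, and
   g^(-alpha) = omega (g^alpha); the two cases exclude each other. *)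
Definition root_space alpha : set g :=
  [set x | (Delta_plus alpha /\ weight_space (tri_gp T) alpha x) \/
           (Delta_plus (- alpha) /\
            exists2 y, weight_space (tri_gp T) (- alpha) y & x = tri_omega T y)].
End Roots.

Arguments Delta_plus {k g} T alpha.
Arguments Delta {k g} T alpha.
Arguments Qplus {k g} T chi.
Arguments root_space {k g} T alpha.

(* hvec and form are total functions of which only the values on Delta, resp.
   on root spaces, matter. *)
Record nondegenerate_pairing (k : fieldType) (g : lieAlgType k)
    (T : triangular g) : Type := NondegeneratePairing {
  hvec : dual (subLie (tri_h0 T)) -> subLie (tri_h T);
  form : dual (subLie (tri_h0 T)) -> g -> g -> k;

  hvec_neq0 : forall alpha, Delta T alpha -> hvec alpha != 0;
  form_linearl : forall alpha, Delta T alpha -> forall c x x' y,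
    root_space T alpha x -> root_space T alpha x' -> root_space T alpha y ->
    form alpha (c *: x + x') y = c * form alpha x y + form alpha x' y;
  form_linearr : forall alpha, Delta T alpha -> forall c x y y',
    root_space T alpha x -> root_space T alpha y -> root_space T alpha y' ->
    form alpha x (c *: y + y') = c * form alpha x y + form alpha x y';
  form_nondegl : forall alpha, Delta T alpha -> forall x, root_space T alpha x ->
    (forall y, root_space T alpha y -> form alpha x y = 0) -> x = 0;
  form_nondegr : forall alpha, Delta T alpha -> forall y, root_space T alpha y ->
    (forall x, root_space T alpha x -> form alpha x y = 0) -> y = 0;
  pairing_bracket : forall alpha, Delta T alpha -> forall x1 x2,
    root_space T alpha x1 -> root_space T alpha x2 ->
    [Lie x1, tri_omega T x2] = form alpha x1 x2 *: val (hvec alpha)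
}.

Section Borel.
Variables (k : fieldType) (g : lieAlgType k) (T : triangular g).

Definition borel : {pred g} := [pred x : g |
  `[< exists b c, [/\ b \in tri_h T, c \in tri_gp T & x = b + c] >]].

Lemma tri_hp b c : b \in tri_h T -> c \in tri_gp T -> b + c = 0 -> b = 0 /\ c = 0.
Proof.
move=> bh cp bc0; have := @tri_direct _ _ T 0 b c (rpred0 _) bh cp.
by rewrite add0r => /(_ bc0) [].
Qed.

Lemma Delta_plusN alpha : Delta_plus T alpha -> ~ Delta_plus T (- alpha).
Proof.
move=> aD naD.
have Q1 (x : dual (subLie (tri_h0 T))) : Delta_plus T x -> Qplus T x.
  move=> xD; exists [:: x]; split; last by rewrite big_seq1.
  by move=> y; rewrite mem_seq1 => /eqP ->.
have Q0 : Qplus T 0 by exists [::]; split=> //; rewrite big_nil.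
have [n [a [_ _ fr]]] := tri_Qplus_free T.
have [m [am _]] := fr _ (Q1 _ aD); have [m' [am' _]] := fr _ (Q1 _ naD).
have [m0 [_ m0u]] := fr _ Q0.
have e0 : m0 = [ffun=> 0%N].
  by apply: m0u; rewrite big1 // => i _; rewrite ffunE mulr0n.
have e1 : m0 = [ffun i => (m i + m' i)%N].
  apply: m0u; under eq_bigr do rewrite ffunE mulrnDr.
  by rewrite big_split /= -am -am' subrr.
case/eqP: (tri_weight_neq0 aD); rewrite am big1 // => i _.
have /ffunP/(_ i) := etrans (esym e0) e1; rewrite !ffunE => /esym/eqP.
by rewrite addn_eq0 => /andP[/eqP -> _]; rewrite mulr0n.
Qed.

Lemma tri_omega_inj : injective (tri_omega T).
Proof. exact: inv_inj (tri_omegaK T). Qed.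

Lemma sub_h0 (h : subLie (tri_h0 T)) : val h \in tri_h T.
Proof. exact: tri_h0_sub (subLieP h). Qed.

Lemma bracket_h0_gp (h : subLie (tri_h0 T)) x :
  x \in tri_gp T -> [Lie val h, x] \in tri_gp T.
Proof.
move=> /tri_gp_weight[s [sP ->]]; rewrite linear_sum big_seq.
apply: rpred_sum => y /sP[alpha [yS yw]] /=.
by rewrite yw rpredZ.
Qed.

Lemma bracket_h_gp b x :
  b \in tri_h T -> x \in tri_gp T -> [Lie b, x] \in tri_gp T.
Proof.
move=> bh /tri_gp_weight[s [sP {x}->]]; rewrite linear_sum big_seq.
apply: rpred_sum => y /sP[alpha [yS yw]] /=.
have [->|y0] := eqVneq y 0; first by rewrite bracket0r rpred0.
have aD : Delta_plus T alpha by exists y.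
have zw (h : subLie (tri_h0 T)) :
    [Lie val h, [Lie b, y]] = (alpha h : k) *: [Lie b, y].
  have := jacobi (val h) b y.
  rewrite (tri_h_abelian (sub_h0 h) bh) bracket0r addr0.
  rewrite (bracketC y) yw -scaleNr bracketZr scaleNr => /eqP.
  by rewrite subr_eq0 => /eqP.
move: {yS yw y0} zw; have [u [v [w [um vh wp ->]]]] := tri_sum T [Lie b, y] => zw.
have [x xp ux] := (tri_omega_gp T u).1 um.
have split_h h : [/\ [Lie val h, u] = (alpha h : k) *: u &
                     (alpha h : k) *: v = 0].
  have hu : [Lie val h, u] \in tri_gm T.
    apply/(tri_omega_gp T); exists (- [Lie val h, x]).
      by rewrite -scaleN1r rpredZ // bracket_h0_gp.
    by rewrite -bracketC tri_omega_bracket -ux (tri_omega_h (sub_h0 h)).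
  have hw := bracket_h0_gp h wp.
  have hv : [Lie val h, v] = 0 by apply: (tri_h_abelian (sub_h0 h) vh).
  have := @tri_direct _ _ T ([Lie val h, u] - (alpha h : k) *: u)
    (- ((alpha h : k) *: v)) ([Lie val h, w] - (alpha h : k) *: w).
  case=> [||||/eqP].
  - by rewrite -scaleNr rpredD ?rpredZ.
  - by rewrite -scaleNr rpredZ.
  - by rewrite -scaleNr rpredD ?rpredZ.
  - have := zw h; rewrite !bracketDr hv addr0 => /eqP.
    rewrite -subr_eq0 => /eqP <-; rewrite !scalerDr !opprD.
    by rewrite -[X in X + _ = _]addrA addrACA.
  by rewrite subr_eq0 => /eqP -> /eqP; rewrite oppr_eq0 => /eqP -> _.
have v0 : v = 0.
  have [//|nv] := eqVneq v 0; case/eqP: (tri_weight_neq0 aD).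
  apply/val_inj/funext => h /=; have [_ /eqP] := split_h h.
  by rewrite scaler_eq0 (negbTE nv) orbF => /eqP.
have u0 : u = 0.
  have [//|nu] := eqVneq u 0; case: (Delta_plusN aD); exists x; last first.
    by apply: contra_neq nu => x0; rewrite ux x0 linear0.
  split=> // h; apply: tri_omega_inj; rewrite linearZ /= -ux.
  have [+ _] := split_h h.
  move=> hu; rewrite bracketC linearN /= tri_omega_bracket -ux (tri_omega_h (sub_h0 h)).
  by rewrite hu scaleNr.
by rewrite u0 v0 !add0r.
Qed.
Lemma borelP x :
  x \in borel <-> exists b c, [/\ b \in tri_h T, c \in tri_gp T & x = b + c].
Proof. by split=> [/asboolP|?] //; apply/asboolP. Qed.

Fact borel_submod : submod_closed borel.
Proof.
split; first by apply/borelP; exists 0, 0; rewrite !rpred0 addr0.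
move=> a x y /borelP[b [c [bh cp ->]]] /borelP[b' [c' [bh' cp' ->]]].
apply/borelP; exists (a *: b + b'), (a *: c + c').
by rewrite !rpredD ?rpredZ // scalerDr addrACA.
Qed.
HB.instance Definition _ := GRing.isSubmodClosed.Build k g borel borel_submod.

Lemma bracket_borel : {in borel &, forall x y, [Lie x, y] \in tri_gp T}.
Proof.
move=> x y /borelP[b [c [bh cp ->]]] /borelP[b' [c' [bh' cp' ->]]].
rewrite bracketDl !bracketDr (tri_h_abelian bh bh') add0r.
apply: rpredD; first exact: bracket_h_gp.
apply: rpredD; last exact: lie_closed.
by rewrite bracketC -scaleN1r; apply/rpredZ/bracket_h_gp.
Qed.

Fact borel_lie : {in borel &, forall x y, [Lie x, y] \in borel}.
Proof.
move=> x y xb yb; apply/borelP; exists 0, [Lie x, y].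
by rewrite rpred0 bracket_borel // add0r.
Qed.
HB.instance Definition _ := isLieClosed.Build k g borel borel_lie.
End Borel.

Section Verma.
Variables (k : fieldType) (g : lieAlgType k) (T : triangular g) (N : nat).

Local Notation ghat := (current N g).
Local Notation hhat := (cur N (tri_h T)).
Local Notation gphat := (cur N (tri_gp T)).
(* (h + g_+) (x) k[t]/t^(N+1), that is, the sum of hhat and gphat. *)
Local Notation bhat := (cur N (borel T)).

(* The unique (cartan_part_uniq) component in hhat of an element of bhat. *)
Definition cartan_part (x : subLie bhat) : subLie hhat :=
  xget 0 [set y : subLie hhat | (val x - val y : ghat) \in gphat].

Variable Lambda : dual (subLie hhat).

(* The character of bhat that equals Lambda on hhat and vanishes on gphat;
   env_lift extends it to U(bhat), which acts through it on k v_Lambda. *)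
Definition borel_char (x : subLie bhat) : k^o := Lambda (cartan_part x).

Definition borel_act (u : env (subLie bhat)) (c : k^o) : k^o :=
  env_lift borel_char u * c.

Definition borel_in : env (subLie bhat) -> env ghat :=
  env_lift (fun x : subLie bhat => env_in (val x : ghat)).

Definition verma : Type := induced borel_in borel_act.
HB.instance Definition _ := GRing.Lmodule.on verma.

Definition verma_act : env ghat -> verma -> verma := @ind_act _ _ _ borel_in _ borel_act.

Definition verma_gen : verma := tensor borel_in borel_act 1 1.

(* env_lift is only meaningful on Lie algebra morphisms: borel_char_morphism and
   borel_in_morphism justify borel_act and borel_in. *)

Lemma cartan_partP (x : subLie bhat) :
  (val x - val (cartan_part x) : ghat) \in gphat.
Proof.
rewrite /cartan_part; case: xgetP => [y _ //|noy]; exfalso.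
have xb i : exists y, y \in tri_h T /\ (val x : ghat) i - y \in tri_gp T.
  have /borelP[b [c [bh cp ->]]] := elimT (curP _ _) (subLieP x) i.
  by exists b; rewrite [b + c]addrC addrK.
have [f fP] := choice xb.
have fh : [ffun i => f i] \in hhat.
  by apply/curP => i; rewrite ffunE; case: (fP i).
apply: (noy (SubLie fh)); apply/curP => i /=.
by rewrite !ffunE; case: (fP i).
Qed.

Lemma cartan_part_uniq (x : subLie bhat) (y : subLie hhat) :
  (val x - val y : ghat) \in gphat -> cartan_part x = y.
Proof.
move=> /curP yP; have /curP zP := cartan_partP x; apply/val_inj/ffunP => i.
have zh := elimT (curP _ _) (subLieP (cartan_part x)) i.
have yh := elimT (curP _ _) (subLieP y) i.
have := yP i; have := zP i; rewrite !ffunE => zp yp.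
set z := val (cartan_part x) in zh zp *.
apply/eqP; rewrite -subr_eq0; apply/eqP.
have [] // := @tri_hp _ _ T (z i - val y i) ((val x i - z i) - (val x i - val y i)).
- by rewrite -scaleN1r rpredD ?rpredZ.
- by rewrite -[X in _ + X]scaleN1r rpredD ?rpredZ.
rewrite opprB [X in _ + X = _]addrC [X in _ + X = _]addrA addrNK.
by rewrite addrA addrNK subrr.
Qed.

Lemma borel_char_morphism : lie_morphism borel_char.
Proof.
split=> [c x y|x y].
  rewrite /borel_char -dualP; congr (Lambda _); apply: cartan_part_uniq.
  have -> : (val (c *: x + y) : ghat) - val (c *: cartan_part x + cartan_part y) =
      c *: (val x - val (cartan_part x)) + (val y - val (cartan_part y)).
    by rewrite scalerBr opprD addrACA.
  by rewrite rpredD ?rpredZ ?cartan_partP.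
rewrite [X in _ = _ - X]mulrC subrr /borel_char.
rewrite (@cartan_part_uniq _ 0); last first.
  rewrite subr0; apply/curP => m; rewrite ffunE.
  apply: rpred_sum => i _; apply: rpred_sum => j _.
  by apply: bracket_borel; [have /curP := subLieP x | have /curP := subLieP y].
exact: dual0.
Qed.

Lemma borel_in_morphism :
  lie_morphism (fun x : subLie bhat => env_in (val x : ghat)).
Proof.
have [lin br] := env_in_morphism ghat.
by split=> [c x y|x y] /=; [exact: lin | exact: br].
Qed.

Lemma verma_gen_weight (x : subLie bhat) :
  verma_act (env_in (val x : ghat)) verma_gen = borel_char x *: verma_gen.
Proof.
rewrite /verma_act /verma_gen ind_act_tensor mulr1.
rewrite -(env_lift_in borel_in_morphism) -[env_lift _ _]mul1r.
rewrite [LHS]tensor_balanced /borel_act (env_lift_in borel_char_morphism).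
have := tensor_linearr borel_in borel_act 1 (borel_char x) 1 0.
have t0 : tensor borel_in borel_act 1 0 = 0.
  have := tensor_linearr borel_in borel_act 1 (-1) 0 0.
  by rewrite scaler0 addr0 scaleN1r addNr.
by rewrite t0 !addr0.
Qed.

End Verma.

Section Modules.
Variables (k : fieldType) (g : lieAlgType k) (T : triangular g) (N : nat).
Variable Lambda : dual (subLie (cur N (tri_h T))).
Implicit Types (eta : dual (subLie (tri_h0 T))) (v : verma Lambda).

(* The restriction of Lambda to h0, included in hhat as h0 (x) 1. *)
Definition restrict_h0 : dual (subLie (tri_h0 T)) :=
  dual_comp (inclusion (@tri_h0_sub _ _ T)) (dual_comp (sub_tpow ord0) Lambda).

(* <Lambda_N, h> = <Lambda, h (x) t^N> *)
Definition top_part : dual (subLie (tri_h T)) :=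
  dual_comp (sub_tpow ord_max) Lambda.

Definition verma_weight_space eta : set (verma Lambda) :=
  [set v | forall h : subLie (tri_h0 T),
     verma_act (env_in (tpow (ord0 : 'I_N.+1) (val h))) v = (eta h : k) *: v].

Definition submodule_gen v : set (verma Lambda) :=
  [set w | exists u, w = verma_act u v].

Definition primitive eta v : Prop :=
  verma_weight_space eta v /\ exists w, ~ submodule_gen v w.

Definition is_submodule (S : set (verma Lambda)) : Prop :=
  [/\ S 0, forall v w, S v -> S w -> S (v + w)
    & forall u v, S v -> S (verma_act u v)].

Definition reducible : Prop :=
  exists S, [/\ is_submodule S, exists v, S v /\ v != 0 & exists v, ~ S v].
End Modules.

(* Main.v *)
(** The letters are the basis vectors y_i = omega(x'_i) t^j of the negative part
    and their partners z_i = x_i t^(N-j), where (x_i), (x'_i) are dual bases of a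
    root space for the given form, so that [z_i, y_i] = h(alpha) t^N.
    By the Poincare-Birkhoff-Witt theorem the sorted words in the y_i, applied to
    the highest weight vector, form a basis of M(Lambda).

    Give y_i the degree psi_i = N - 2 j and filter M(Lambda) by the total degree
    of words. Since N > 0, every commutator other than [z_i, y_i] has strictly
    smaller degree than expected, so that in the associated graded space, a
    polynomial ring in the y_i, the element z_i acts as
    <Lambda_N, h(alpha)> d/dy_i. Hence the pairing of z-words and y-words of a
    given weight is triangular for the total degree, with diagonal entries
    positive integers times products of the numbers <Lambda_N, h(alpha)>.

    If these numbers do not vanish, a z-word of maximal degree in the support of
    v maps v to a non-zero multiple of the highest weight vector (characteristic
    zero). If one of them vanishes, a square submatrix of the pairing has a zero
    column, and a vector of its kernel lies in the maximal proper submodule. *)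

From HB Require Import structures.
Require Import Defs.
From mathcomp Require Import all_boot order ssrAC ssralg ssrnum ssrint matrix mxalgebra.
From mathcomp Require Import boolp classical_sets functions cardinality.
From mathcomp Require Import finmap.
From mathcomp.multinomials Require Import monalg.
From mathcomp Require Import zify.

Set Implicit Arguments.
Unset Strict Implicit.
Unset Printing Implicit Defensive.

Import Order.TTheory GRing.Theory Num.Theory.
Local Open Scope ring_scope.

(** * Linear algebra *)

(** The degree N - 2j treats both signs alike: elements of g_- t^d and of g_+ t^d shift the
    filtration by at most N - 2d, so z_i, whose exponent is N - j, shifts it by at most -psi_i. For
    exponents a and b a commutator is expected at 2N - 2(a+b). Its components in g_- and g_+ only
    reach N - 2(a+b), a loss of N. A Cartan component has exponent d = a + b and does not raise the
    degree, against the expected 2N - 2d: it is lower for d < N, absent for d > N, and for d = N its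
    scalar part is the leading term. Hence only Lambda_N is seen. The obstacle on the algebraic side
    is that M(Lambda) is a quotient by relations, in which nothing is visibly non-zero. Independence
    of the sorted words is therefore proved by building the induced module on the free space on
    these words and mapping M(Lambda) to it. The construction is relative to the subalgebra (h +
    g_+)[t]/t^(N+1) and its character, so it involves no basis of that subalgebra. *)

Section Lspan.
Variable k : fieldType.

Lemma lspan_ind (V : lmodType k) (R : set V) (S : submodClosed V) v :
  (forall r, R r -> r \in S) -> v \in lspan R -> v \in S.
Proof.
move=> RS /asboolP[s [sR ->]]; rewrite big_seq.
by apply: rpred_sum => p /sR/RS pS; rewrite rpredZ.
Qed.

Lemma lspan_map (V W : lmodType k) (f : {linear V -> W}) (R : set V)
    (S : submodClosed W) v :
  (forall r, R r -> f r \in S) -> v \in lspan R -> f v \in S.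
Proof.
move=> RS /asboolP[s [sR ->]]; rewrite linear_sum big_seq.
by apply: rpred_sum => p /sR/RS pS; rewrite linearZ rpredZ.
Qed.
End Lspan.

(* The algebra of endomorphisms; restricting to spaces of this form makes it
   unconditionally non-trivial, as the structure algType requires. *)
Section Endo.
Variables (k : fieldType) (K : choiceType).
Local Notation V := {malg k[seq K]}.

Definition endo_pred : {pred V -> V} := [pred f | `[< linear f >]].

Fact endo_submod : submod_closed endo_pred.
Proof.
split=> [|a f1 f2 /asboolP f1P /asboolP f2P]; apply/asboolP=> c x y /=.
  by rewrite scaler0 addr0.
rewrite !fctE /= f1P f2P !scalerDr !scalerA (mulrC a) -!addrA.
by congr (_ + _); rewrite addrCA.
Qed.
HB.instance Definition _ :=
  GRing.isSubmodClosed.Build k (V -> V) endo_pred endo_submod.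

Record endo : Type := Endo { endo_fun :> V -> V; _ : endo_fun \in endo_pred }.

HB.instance Definition _ := [isSub for endo_fun].
HB.instance Definition _ := [Choice of endo by <:].
HB.instance Definition _ := [SubChoice_isSubLmodule of endo by <:].

Lemma endoP (f : endo) : linear f. Proof. by case: f => f /= /asboolP. Qed.
HB.instance Definition _ (f : endo) :=
  GRing.isLinear.Build k V V *:%R (endo_fun f) (endoP f).

Lemma endo_of_subproof (f : V -> V) : linear f -> f \in endo_pred.
Proof. by move=> fl; apply/asboolP. Qed.
Definition endo_of f (fl : linear f) : endo := Endo (endo_of_subproof fl).

Definition endo1 : endo := @endo_of id (fun _ _ _ => erefl).
Fact endo_mul_subproof (f h : endo) : linear (f \o h).
Proof. by move=> c x y; rewrite /= !endoP. Qed.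
Definition endo_mul (f h : endo) : endo := endo_of (endo_mul_subproof f h).

Lemma endo_ext (f h : endo) : f =1 h -> f = h.
Proof. by move=> fh; apply/val_inj/funext. Qed.

Fact endo_mulA : associative endo_mul.
Proof. by move=> f1 f2 f3; apply: endo_ext. Qed.
Fact endo_mul1r : left_id endo1 endo_mul.
Proof. by move=> f; apply: endo_ext. Qed.
Fact endo_mulr1 : right_id endo1 endo_mul.
Proof. by move=> f; apply: endo_ext. Qed.
Fact endo_mulDl : left_distributive endo_mul +%R.
Proof. by move=> f1 f2 f3; apply: endo_ext. Qed.
Fact endo_mulDr : right_distributive endo_mul +%R.
Proof.
move=> f1 f2 f3; apply: endo_ext => x /=.
by have := endoP f1 1 (f2 x) (f3 x); rewrite !scale1r.
Qed.
Fact endo_1neq0 : endo1 != 0.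
Proof.
apply/eqP => /(congr1 (fun f : endo => f (mkmalgU [::] 1))) /= /eqP.
by rewrite monalgU_eq0 oner_eq0.
Qed.

HB.instance Definition _ := GRing.Zmodule_isNzRing.Build endo
  endo_mulA endo_mul1r endo_mulr1 endo_mulDl endo_mulDr endo_1neq0.

Fact endo_scalerAl (c : k) (u v : endo) : c *: (u * v) = (c *: u) * v.
Proof. exact: endo_ext. Qed.
Fact endo_scalerAr (c : k) (u v : endo) : c *: (u * v) = u * (c *: v).
Proof.
apply: endo_ext => x /=; have e0 : u 0 = 0.
  by have := endoP u (-1) 0 0; rewrite scaler0 addr0 scaleN1r addNr.
by have := endoP u c (v x) 0; rewrite e0 !addr0 => /esym.
Qed.
HB.instance Definition _ := GRing.Lmodule_isLalgebra.Build k endo endo_scalerAl.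
HB.instance Definition _ := GRing.Lalgebra_isAlgebra.Build k endo endo_scalerAr.
End Endo.

(** * Induction over the enveloping algebra *)

Section EnvInd.
Variables (k : fieldType) (L : lieAlgType k).

Lemma fgen_word (s : seq L) :
  mkmalgU (FMonom s) 1 = \prod_(x <- s) fgen x :> freeAlg L.
Proof.
elim: s => [|x s IHs].
  by rewrite big_nil; congr mkmalgU; apply: val_inj; rewrite /= fm1.
rewrite big_cons -IHs.
transitivity (fgmul (mkmalgU (fmu x) 1) (mkmalgU (FMonom s) 1) : {malg k[{fmonom L}]}).
  by rewrite fgmulUU mul1r; congr mkmalgU; apply: val_inj; rewrite /= fmM fmU.
by rewrite -malgM_def.
Qed.

Lemma env_ind (P : env L -> Prop) :
  P 1 -> (forall c u v, P u -> P v -> P (c *: u + v)) ->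
  (forall x u, P u -> P (env_in x * u)) -> forall u, P u.
Proof.
move=> P1 PD PM u; rewrite -[u]env_reprK; move: (env_repr u) => {}u.
have P0 : P 0 by have := PD (-1) 1 1 P1 P1; rewrite scaleN1r addNr.
have -> : u = \sum_(w <- msupp u) mcoeff w u *: (mkmalgU w 1 : freeAlg L).
  rewrite [LHS]monalgE; apply: eq_bigr => w _.
  by apply/malgP => q; rewrite mcoeffZ !mcoeffU mulr_natr.
elim: (enum_fset (msupp u)) => [|w ws IH].
  by rewrite big_nil env_proj0.
rewrite big_cons env_projD env_projZ; apply: PD => //.
case: w => w; rewrite fgen_word; elim: w => [|x w IHw].
  by rewrite big_nil.
by rewrite big_cons env_projM; apply: PM.
Qed.
End EnvInd.

Section MalgLinear.
Variables (k : fieldType) (K : choiceType).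
Local Notation bas i := (mkmalgU i 1 : {malg k[K]}).

Lemma malg_sum (u : {malg k[K]}) : u = \sum_(i <- msupp u) mcoeff i u *: bas i.
Proof.
rewrite [LHS]monalgE; apply: eq_bigr => w _.
by apply/malgP => q; rewrite mcoeffZ !mcoeffU mulr_natr.
Qed.

Lemma malg_linear_ext (V : lmodType k) (f h : {linear {malg k[K]} -> V}) :
  (forall i, f (bas i) = h (bas i)) -> f =1 h.
Proof.
move=> fh u; rewrite [u]malg_sum !linear_sum.
by apply: eq_bigr => i _; rewrite !linearZ fh.
Qed.

Lemma malg_mem (V : lmodType k) (f : {linear {malg k[K]} -> V}) (S : submodClosed V) u :
  (forall i, i \in msupp u -> f (bas i) \in S) -> f u \in S.
Proof.
move=> fS; rewrite [u]malg_sum linear_sum big_seq.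
by apply: rpred_sum => i /fS iS; rewrite linearZ rpredZ.
Qed.

Lemma mlin_mem (V : lmodType k) (f : K -> V) (S : submodClosed V) u :
  (forall i, i \in msupp u -> f i \in S) -> mlin f u \in S.
Proof. by move=> fS; apply: malg_mem => i /fS /=; rewrite mlinU. Qed.

Lemma eq_mlin (V : lmodType k) (f h : K -> V) (u : {malg k[K]}) :
  (forall i, i \in msupp u -> f i = h i) -> mlin f u = mlin h u.
Proof. by move=> fh; rewrite /mlin !big_seq; apply: eq_bigr => i /fh ->. Qed.

Lemma linear_mlin (V W : lmodType k) (h : {linear V -> W}) (f : K -> V) u :
  h (mlin f u) = mlin (h \o f) u.
Proof. by rewrite /mlin linear_sum; apply: eq_bigr => i _; rewrite linearZ. Qed.

Lemma mlin_mlin (K' : choiceType) (V : lmodType k) (f : K' -> V) (h : K -> {malg k[K']}) u :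
  mlin f (mlin h u) = mlin (fun i => mlin f (h i)) u.
Proof. exact: (linear_mlin (mlin f)). Qed.

Lemma mlin_linear_param (U V : lmodType k) (F : U -> K -> V) (u : {malg k[K]}) :
  (forall i, linear (F^~ i)) -> linear (fun x => mlin (F x) u).
Proof.
move=> Fl c x y; rewrite /mlin scaler_sumr -big_split; apply: eq_bigr => i _ /=.
by rewrite Fl scalerDr !scalerA mulrC.
Qed.

Lemma mlin_bas (u : {malg k[K]}) : mlin (fun i => bas i) u = u.
Proof. by rewrite [RHS]malg_sum. Qed.

Lemma mlinB (V : lmodType k) (f h : K -> V) (u : {malg k[K]}) :
  mlin (fun i => f i - h i) u = mlin f u - mlin h u.
Proof. by rewrite /mlin -sumrB; apply: eq_bigr => i _; rewrite scalerBr. Qed.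

Lemma lspan_ext (V W : lmodType k) (R : set V) (f h : {linear V -> W}) v :
  (forall r, R r -> f r = h r) -> v \in lspan R -> f v = h v.
Proof.
move=> fh /asboolP[s [sR ->]]; rewrite !linear_sum big_seq [RHS]big_seq.
by apply: eq_bigr => p /sR/fh ph; rewrite !linearZ ph.
Qed.
End MalgLinear.

(** * The Poincare-Birkhoff-Witt theorem *)

(* L is the direct sum of the span of the e i and of the subalgebra ker coord, of
   which lam is a character. The free vector space on the sorted words in I is
   made into the L-module induced from this character; all letters are smaller
   than the elements of ker coord. *)
Section PBW.
Variables (k : fieldType) (L : lieAlgType k) (I : choiceType) (leI : rel I).
Hypotheses (leI_total : total leI) (leI_trans : transitive leI).
Hypothesis leI_anti : antisymmetric leI.
Variables (e : I -> L) (coord : {linear L -> {malg k[I]}}) (lam : {linear L -> k^o}).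
Hypothesis coord_e : forall i, coord (e i) = mkmalgU i 1.
Hypothesis lam_e : forall i, lam (e i) = 0.
Hypothesis coord_bracket :
  forall x y, coord x = 0 -> coord y = 0 -> coord [Lie x, y] = 0.
Hypothesis lam_bracket :
  forall x y, coord x = 0 -> coord y = 0 -> lam [Lie x, y] = 0.

Local Notation V := {malg k[seq I]}.
Local Notation bas s := (mkmalgU s 1 : V).

Fixpoint ins (i : I) (s : seq I) : seq I :=
  if s is j :: s' then if leI i j then i :: s else j :: ins i s' else [:: i].

Lemma perm_ins i s : perm_eq (ins i s) (i :: s).
Proof.
elim: s => //= j s IHs; case: ifP => _ //.
by rewrite perm_sym -[i :: j :: s]/([:: i] ++ j :: s) perm_catC /= perm_cons perm_catC perm_sym.
Qed.

Lemma sorted_ins i s : sorted leI s -> sorted leI (ins i s).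
Proof.
elim: s => //= j s IHs js; case: ifP => ij /=; first by rewrite ij.
rewrite path_sortedE // IHs ?(path_sorted js) // andbT.
rewrite (perm_all _ (perm_ins i s)) /=.
have := leI_total i j; rewrite ij /= => ->.
by move: js; rewrite path_sortedE // => /andP[].
Qed.

Lemma sorted_cons_ins l i s :
  leI l i -> sorted leI (l :: s) -> sorted leI (l :: ins i s).
Proof.
move=> li; rewrite /= !path_sortedE // => /andP[ls ss].
by rewrite sorted_ins // (perm_all _ (perm_ins i s)) /= li ls.
Qed.

(* The action of x on a word s is lead x s, the commutative multiplication by the
   letters of x, plus rest x s, of length at most that of s. Only the part cut j x
   of x made of the letters > j and of ker coord contributes to rest x (j :: s):
   it is moved past e j, at the price of a bracket. The fuel n must be at least
   the length of the word. *)
Definition lead (x : L) (s : seq I) : V := mlin (fun i => bas (ins i s)) (coord x).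
Definition cut (j : I) (x : L) : L :=
  x - mlin (fun i => if leI i j then e i else 0) (coord x).

Fixpoint rest_fuel (n : nat) (x : L) (s : seq I) {struct n} : V :=
  match s with
  | [::] => lam x *: bas [::]
  | j :: s' =>
    match n with
    | 0 => 0
    | n'.+1 => mlin (fun t => lead (e j) t + rest_fuel n' (e j) t)
                 (rest_fuel n' (cut j x) s')
               + (lead [Lie cut j x, e j] s' + rest_fuel n' [Lie cut j x, e j] s')
    end
  end.
Definition rest x s := rest_fuel (size s) x s.
Definition nact (x : L) : V -> V := mlin (fun s => lead x s + rest x s).

HB.instance Definition _ x := GRing.Linear.copy (nact x) (mlin (fun s => lead x s + rest x s)).

Lemma lead_linear s : linear (lead^~ s).
Proof. by move=> c x y; rewrite /lead !linearP. Qed.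
Lemma cut_linear j : linear (cut j).
Proof.
by move=> c x y; rewrite /cut linearP mlin_linear scalerBr opprD addrACA.
Qed.

Lemma rest_fuel_linear n s : linear (rest_fuel n ^~ s).
Proof.
elim: n s => [|n IHn] [|j s] c x y /=.
- by rewrite linearP scalerDl scalerA.
- by rewrite scaler0 addr0.
- by rewrite linearP scalerDl scalerA.
rewrite cut_linear bracketDl bracketZl !IHn lead_linear linearP /=.
by rewrite !scalerDr [X in _ + X = _]addrACA [LHS]addrACA.
Qed.

Lemma nact_linear v : linear (nact^~ v).
Proof.
apply: mlin_linear_param => s c x y.
by rewrite lead_linear [rest _ _]rest_fuel_linear scalerDr addrACA.
Qed.

HB.instance Definition _ j := GRing.isLinear.Build k L L *:%R (cut j) (cut_linear j).
Definition nactr v x := nact x v.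
HB.instance Definition _ v := GRing.isLinear.Build k L V *:%R (nactr v) (nact_linear v).

Lemma nactB x y v : nact (x - y) v = nact x v - nact y v.
Proof. exact: (raddfB (nactr v)). Qed.
Lemma nactN x v : nact (- x) v = - nact x v.
Proof. exact: (raddfN (nactr v)). Qed.

Lemma nact0l v : nact 0 v = 0.
Proof. exact: (raddf0 (nactr v)). Qed.
Lemma rest0 s : rest 0 s = 0.
Proof.
have := rest_fuel_linear (size s) s (-1) 0 0.
by rewrite scaler0 addr0 scaleN1r addNr.
Qed.

Definition words_le n : set V :=
  [set v | exists t, [/\ sorted leI t, (size t <= n)%N & v = bas t]].

Lemma words_le_bas t n :
  sorted leI t -> (size t <= n)%N -> bas t \in lspan (words_le n).
Proof. by move=> ts tn; apply: lspan_incl; exists t. Qed.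

Lemma words_leW m n v :
  (m <= n)%N -> v \in lspan (words_le m) -> v \in lspan (words_le n).
Proof.
move=> mn; apply: lspan_ind => _ [t [ts tm ->]].
by apply: words_le_bas => //; exact: leq_trans mn.
Qed.

Lemma lead_words x s : sorted leI s -> lead x s \in lspan (words_le (size s).+1).
Proof.
move=> ss; apply: mlin_mem => i _; apply: words_le_bas; first exact: sorted_ins.
by rewrite (perm_size (perm_ins i s)).
Qed.

(** The two claims need each other: the recursion applies e_j to the words of an earlier rest, and
    only the length bound on these shows that the remaining fuel suffices for them. *)
Lemma rest_fuelP n s : sorted leI s -> (size s <= n)%N -> forall x,
  (forall m, (size s <= m)%N -> rest_fuel m x s = rest x s) /\
  rest x s \in lspan (words_le (size s)).
Proof.
elim: n s => [|n IHn] [|j s] ss //.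
- move=> _ x; split; first by case.
  by rewrite /rest /= rpredZ // words_le_bas.
- move=> _ x; split; first by case.
  by rewrite /rest /= rpredZ // words_le_bas.
have ss' := path_sorted ss; move=> /= sn x.
have [E M] := IHn s ss' sn (cut j x).
have Et m v : (size s <= m)%N -> v \in lspan (words_le (size s)) ->
    mlin (fun t => lead (e j) t + rest_fuel m (e j) t) v = nact (e j) v.
  move=> sm; apply: lspan_ext => _ [t [ts tl ->]].
  rewrite /= /nact !mlinU; have [-> //] := IHn t ts (leq_trans tl sn) (e j).
  exact: leq_trans sm.
split.
  case=> // m; rewrite ltnS => sm; rewrite /rest /= !E ?Et //.
  have [-> // _] := IHn s ss' sn [Lie cut j x, e j].
rewrite /rest /= E // Et // rpredD //.
  apply: lspan_map M => _ [t [ts tl ->]]; rewrite /= /nact mlinU rpredD //.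
    by apply: words_leW (lead_words _ ts).
  have [_] := IHn t ts (leq_trans tl sn) (e j).
  by apply: words_leW; rewrite (leq_trans tl).
rewrite rpredD ?lead_words //.
have [-> // M'] := IHn s ss' sn [Lie cut j x, e j].
exact: words_leW M'.
Qed.

Lemma rest_words x s : sorted leI s -> rest x s \in lspan (words_le (size s)).
Proof. by move=> ss; have [] := rest_fuelP ss (leqnn _) x. Qed.

Lemma nact_bas x s : nact x (bas s) = lead x s + rest x s.
Proof. by rewrite /nact mlinU. Qed.

Lemma nact_words x s :
  sorted leI s -> nact x (bas s) \in lspan (words_le (size s).+1).
Proof.
move=> ss; rewrite nact_bas rpredD ?lead_words //.
exact: words_leW (rest_words x ss).
Qed.

Lemma rest_cons x j s : sorted leI (j :: s) ->
  rest x (j :: s) = nact (e j) (rest (cut j x) s) + nact [Lie cut j x, e j] (bas s).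
Proof.
move=> js; have ss := path_sorted js; rewrite nact_bas /rest /=; congr (_ + _).
apply: lspan_ext (rest_words _ ss) => _ [t [ts tl ->]]; rewrite /= /nact !mlinU.
by have [-> //] := rest_fuelP ts tl (e j).
Qed.

Lemma cut_e i j : cut j (e i) = if leI i j then 0 else e i.
Proof. by rewrite /cut coord_e mlinU; case: ifP => _; rewrite ?subrr ?subr0. Qed.

Lemma coord_cut j x :
  coord (cut j x) = mlin (fun i => if leI i j then 0 else mkmalgU i 1) (coord x).
Proof.
rewrite /cut linearB linear_mlin -{1}[coord x]mlin_bas -mlinB.
by apply: eq_mlin => i _ /=; case: ifP => _; rewrite ?coord_e ?subrr ?linear0 ?addr0.
Qed.

Lemma cut_cut j x : cut j (cut j x) = cut j x.
Proof.
rewrite -[LHS]/(cut j x - mlin _ (coord (cut j x))) coord_cut mlin_mlin.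
apply: (etrans _ (subr0 _)); congr (_ - _).
rewrite /mlin big1 // => i _.
case: (boolP (leI i j)) => ij; first by rewrite msupp0 big_nil scaler0.
by rewrite -[\sum_(_ <- _) _]/(mlin _ _) mlinU (negPf ij) scaler0.
Qed.

Lemma lead_cut j x s :
  lead (cut j x) s = mlin (fun i => if leI i j then 0 else bas (ins i s)) (coord x).
Proof.
rewrite /lead coord_cut mlin_mlin; apply: eq_mlin => i _ /=.
by case: ifP => _; [rewrite (raddf0 (mlin _)) | rewrite mlinU].
Qed.

(** A letter not above the head is killed by [cut], so no rest remains; on the empty word the rest
    is the character, which vanishes on letters. *)
Lemma nact_e i s : sorted leI (i :: s) -> nact (e i) (bas s) = bas (i :: s).
Proof.
move=> is_; have -> : bas (i :: s) = lead (e i) s.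
  rewrite /lead coord_e mlinU; case: s is_ => //= j s /andP[-> _] //.
rewrite nact_bas -[RHS]addr0; congr (_ + _).
case: s is_ => [|j s] /=; first by rewrite /rest /= lam_e scale0r.
move=> /andP[ij js]; rewrite rest_cons // cut_e ij bracket0l.
by rewrite nact0l addr0 rest0 raddf0.
Qed.

Lemma lead_cut_cons j x s :
  sorted leI (j :: s) -> lead (cut j x) (j :: s) = nact (e j) (lead (cut j x) s).
Proof.
move=> js; rewrite !lead_cut linear_mlin; apply: eq_mlin => i _ /=.
case: (boolP (leI i j)) => ij; first by rewrite raddf0.
rewrite nact_e //; apply: sorted_cons_ins => //.
by have := leI_total i j; rewrite (negPf ij).
Qed.

Definition defect x y v := nact x (nact y v) - nact y (nact x v) - nact [Lie x, y] v.

Lemma defect_linear y v : linear (fun x => defect x y v).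
Proof.
move=> c x x'; rewrite /defect bracketPl !nact_linear !linearP /=.
by rewrite !scalerDr [X in X + _ = _]addrACA [LHS]addrACA.
Qed.
Lemma defectN x y v : defect x y v = - defect y x v.
Proof. by rewrite /defect bracketC nactN !opprB opprK addrC. Qed.

Definition defectl y v x := defect x y v.
HB.instance Definition _ y v :=
  GRing.isLinear.Build k L V *:%R (defectl y v) (defect_linear y v).

Lemma defect_linear_vec x y : linear (defect x y).
Proof.
move=> c v v'; rewrite /defect !linearP /=.
by rewrite !scalerDr [X in X + _ = _]addrACA [LHS]addrACA.
Qed.
HB.instance Definition _ x y :=
  GRing.isLinear.Build k V V *:%R (defect x y) (defect_linear_vec x y).

(** True by construction: the letters of [cut j x] are inserted behind j, and [rest_cons] defines
    the remainder by the wanted relation. *)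
Lemma defect_cut j s (x : L) :
  sorted leI (j :: s) -> defect (cut j x) (e j) (bas s) = 0.
Proof.
move=> js; rewrite /defect nact_e // nact_bas rest_cons // lead_cut_cons //.
rewrite cut_cut addrA -raddfD -nact_bas /=.
by rewrite [_ - nact (e j) _]addrAC subrr add0r subrr.
Qed.

Lemma split_cut j x :
  x = cut j x + mlin (fun i => if leI i j then e i else 0) (coord x).
Proof. by rewrite /cut subrK. Qed.

Lemma defect_low (Q : pred I) y v u : (forall i, Q i -> defect (e i) y v = 0) ->
  defect (mlin (fun i => if Q i then e i else 0) u) y v = 0.
Proof.
move=> Q0; rewrite -[LHS]/(defectl y v _) linear_mlin.
rewrite /mlin big1 // => i _ /=; rewrite /defectl.
case: ifP => [/Q0 ->|_]; first by rewrite scaler0.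
by rewrite -[defect _ _ _]/(defectl y v 0) raddf0 scaler0.
Qed.

Lemma defectD x x' y v : defect (x + x') y v = defect x y v + defect x' y v.
Proof. exact: (raddfD (defectl y v)). Qed.

(** The letters i <= j of x are split off. For i = j the relation is trivial; for i < j antisymmetry
    exchanges the roles, as e_j is its own cut at i and i :: s is sorted. *)
Lemma defect_head j s (x : L) :
  sorted leI (j :: s) -> defect x (e j) (bas s) = 0.
Proof.
move=> js; rewrite [x](split_cut j) defectD defect_cut // add0r.
apply: defect_low => i ij; have [->|ne_ij] := eqVneq i j.
  by rewrite /defect subrr bracketxx nact0l subr0.
have ji : leI j i = false.
  by apply: contra_neqF ne_ij => ji; apply: leI_anti; rewrite ij.
rewrite defectN; have := @defect_cut i s (e j); rewrite cut_e ji => -> //.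
  by rewrite oppr0.
move: js; rewrite /= !path_sortedE // => /andP[js ->]; rewrite andbT.
by apply: sub_all js => t; exact: leI_trans.
Qed.

(** For a letter i <= j the word i :: j :: s is sorted, so [defect_head] removes the contribution of
    e_i, whether it comes from x or from y. *)
Lemma defect_both_cut j s x y : sorted leI (j :: s) ->
  defect (cut j x) (cut j y) (bas (j :: s)) = 0 -> defect x y (bas (j :: s)) = 0.
Proof.
move=> js D0.
have Dl i z : leI i j -> defect z (e i) (bas (j :: s)) = 0.
  by move=> ij; apply: defect_head; rewrite /= ij; exact: js.
rewrite [x](split_cut j) defectD [X in _ + X]defect_low ?addr0; last first.
  by move=> i ij; rewrite defectN Dl ?oppr0.
rewrite defectN [y](split_cut j) defectD [X in _ + X]defect_low ?addr0; last first.
  by move=> i ij; rewrite defectN Dl ?oppr0.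
by rewrite -defectN.
Qed.

Lemma nact_coord0 x : coord x = 0 -> nact x (bas [::]) = lam x *: bas [::].
Proof.
move=> x0; rewrite nact_bas /lead x0 /rest /=.
by rewrite [X in X + _](raddf0 (mlin _)) add0r.
Qed.

(** Every letter can head the empty word, so all letters are removed from x and y. The kernel of
    [coord] then acts by the scalars [lam], which commute and vanish on brackets. *)
Lemma defect_nil x y : defect x y (bas [::]) = 0.
Proof.
pose low z := mlin (fun i => if xpredT i then e i else 0) (coord z).
have D0 w z : defect (low w) z (bas [::]) = 0.
  by apply: (@defect_low xpredT) => i _; rewrite defectN (@defect_head i [::]) ?oppr0.
have c0 z : coord (z - low z) = 0.
  rewrite linearB linear_mlin -{1}[coord z]mlin_bas -mlinB /mlin big1 // => i _ /=.
  by rewrite coord_e subrr scaler0.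
rewrite -(subrK (low x) x) defectD D0 addr0 defectN -(subrK (low y) y) defectD D0 addr0.
rewrite -defectN; move: (x - _) (c0 x) (y - _) (c0 y) => x' x0 y' y0.
rewrite /defect (nact_coord0 x0) (nact_coord0 y0) !linearZ /=.
rewrite (nact_coord0 x0) (nact_coord0 y0) (nact_coord0 (coord_bracket x0 y0)).
by rewrite lam_bracket // scalerN !scalerA mulrC subrr scale0r subrr.
Qed.

Lemma bracket_jacobi (x y z : L) :
  [Lie x, [Lie y, z]] - [Lie y, [Lie x, z]] = [Lie [Lie x, y], z].
Proof.
have := jacobi x y z; rewrite [[Lie z, [Lie x, y]]]bracketC.
rewrite [[Lie z, x]]bracketC -scaleN1r bracketZr scaleN1r => /eqP.
by rewrite subr_eq0 => /eqP.
Qed.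

(* Induction on length: with l the head of s and x, y free of letters <= l, moving
   l to the left past x and y uses only the relations on shorter words and the
   relations in which l is a smallest letter. *)
Lemma defect_sorted s x y : sorted leI s -> defect x y (bas s) = 0.
Proof.
have [n] := ubnP (size s); elim: n s x y => // n IHn [|l s] x y.
  by move=> *; exact: defect_nil.
rewrite ltnS => sn ls; apply: defect_both_cut => //.
move: {x}(cut l x) (cut_cut l x) {y}(cut l y) (cut_cut l y) => x xc y yc.
have ss := path_sorted ls.
have relE x' y' v : defect x' y' v = 0 ->
    nact x' (nact y' v) = nact y' (nact x' v) + nact [Lie x', y'] v.
  by move=> /eqP; rewrite subr_eq add0r subr_eq addrC => /eqP.
have IH x' y' v : v \in lspan (words_le (size s)) -> defect x' y' v = 0.
  by apply: lspan_ker => _ [t [ts tl ->]]; apply: IHn => //; exact: leq_ltn_trans sn.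
have Rl z : nact z (bas (l :: s)) =
    nact (e l) (nact z (bas s)) + nact [Lie z, e l] (bas s).
  by rewrite -nact_e //; apply/relE/defect_head.
(* The leading part of y' only inserts letters above l into s, so l can still be put in front and
   [defect_head] applies; the rest is no longer than s and falls under the induction. *)
have Dl x' y' : cut l y' = y' -> defect x' (e l) (nact y' (bas s)) = 0.
  move=> y'c; rewrite nact_bas raddfD /= [X in _ + X]IH ?rest_words // addr0.
  rewrite -y'c lead_cut linear_mlin /mlin big1 // => i _ /=.
  case: (boolP (leI i l)) => il; first by rewrite raddf0 scaler0.
  rewrite defect_head ?scaler0 //; apply: sorted_cons_ins => //.
  by have := leI_total i l; rewrite (negPf il).
have step x' y' : cut l y' = y' -> nact x' (nact y' (bas (l :: s))) =
    nact (e l) (nact x' (nact y' (bas s))) + nact [Lie x', e l] (nact y' (bas s)) +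
    (nact [Lie y', e l] (nact x' (bas s)) + nact [Lie x', [Lie y', e l]] (bas s)).
  move=> y'c; rewrite Rl raddfD; congr (_ + _); first exact/relE/Dl.
  exact/relE/IH/words_le_bas.
(* The two expansions share the mixed terms [x, l] y and [y, l] x, which cancel. The double brackets
   combine by the Jacobi identity. *)
rewrite /defect !step // Rl -bracket_jacobi nactB (relE x y) ?IH ?words_le_bas //.
rewrite raddfD /=; apply/eqP; rewrite subr_eq add0r subr_eq; apply/eqP.
rewrite -[in LHS](subrK (nact [Lie y, [Lie x, e l]] (bas s)) (nact [Lie x, [Lie y, e l]] (bas s))).
by rewrite [LHS](AC (3*(1*2)) ((2*5)*((1*4)*(3*6)))).
Qed.

(* Unsorted words act through their sorted version. *)
Definition wsort : V -> V := mlin (fun s => bas (sort leI s)).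
HB.instance Definition _ := GRing.Linear.copy wsort (mlin (fun s => bas (sort leI s))).

Lemma wsort_words n v : v \in lspan (words_le n) -> wsort v = v.
Proof.
apply: (lspan_ext (h := idfun)) => _ [t [ts _ ->]] /=.
by rewrite /wsort mlinU sorted_sort.
Qed.

Fact pbw_act_subproof x : linear (nact x \o wsort).
Proof. by move=> c u v; rewrite linearP. Qed.
Definition pbw_act x : endo k I := endo_of (pbw_act_subproof x).

Lemma pbw_act_morphism : lie_morphism pbw_act.
Proof.
split=> [c x y|x y]; apply: endo_ext => v; first by rewrite /= nact_linear.
apply: (malg_linear_ext (f := nact [Lie x, y] \o wsort)
  (h := ((nact x \o wsort) \o (nact y \o wsort)) \- ((nact y \o wsort) \o (nact x \o wsort)))).
move=> s /=; rewrite [wsort (bas s)]mlinU; have ss := sort_sorted leI_total s.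
rewrite !(wsort_words (nact_words _ ss)).
by apply/eqP; rewrite eq_sym -subr_eq0; apply/eqP/defect_sorted.
Qed.

Lemma pbw_act_letter i s :
  sorted leI (i :: s) -> pbw_act (e i) (bas s) = bas (i :: s).
Proof.
move=> si; rewrite /= [wsort (bas s)]mlinU sorted_sort ?nact_e //.
exact: path_sorted si.
Qed.

Lemma pbw_act_nil x : coord x = 0 -> pbw_act x (bas [::]) = lam x *: bas [::].
Proof. by move=> x0; rewrite /= [wsort (bas [::])]mlinU /= nact_coord0. Qed.

End PBW.

(** * Verma modules *)

Section VermaUniversal.
Variables (k : fieldType) (g : lieAlgType k) (T : triangular g) (N : nat).
Variable Lambda : dual (subLie (cur N (tri_h T))).
Variables (I : choiceType) (phi : current N g -> endo k I) (v0 : {malg k[seq I]}).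
Hypothesis phi_morph : lie_morphism phi.
Hypothesis phi_borel : forall x : subLie (cur N (borel T)),
  phi (val x : current N g) v0 = borel_char Lambda x *: v0.

Local Notation V := {malg k[seq I]}.
Local Notation ghat := (current N g).

Definition verma_to_free (p : (env ghat * k^o)%type) : V :=
  (p.2 : k) *: env_lift phi p.1 v0.

(** This is what the balancing relation of the tensor product demands: the enveloping algebra of the
    Borel part acts on v0 as on k v_Lambda. It propagates from generators to words. *)
Lemma lift_borel_in (b : env (subLie (cur N (borel T)))) :
  env_lift phi (borel_in b) v0 = (env_lift (borel_char Lambda) b : k) *: v0.
Proof.
have bm := borel_in_morphism T N; have cm := borel_char_morphism Lambda.
have addE (A B C : endo k I) (a b' c' c : k) : C = c *: A + B -> c' = c * a + b' ->
    A v0 = a *: v0 -> B v0 = b' *: v0 -> C v0 = c' *: v0.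
  by move=> -> -> Aa Bb; rewrite scalerDl -scalerA -Aa -Bb.
have mulE (A B C : endo k I) (a b' c' : k) : C = A * B -> c' = a * b' ->
    A v0 = a *: v0 -> B v0 = b' *: v0 -> C v0 = c' *: v0.
  by move=> -> -> Aa Bb; rewrite mulrC -scalerA -Aa /= Bb linearZ_LR.
elim/env_ind: b => [|c u v IHu IHv|x u IHu].
- by rewrite /borel_in (env_lift1 bm) (env_lift1 phi_morph) (env_lift1 cm) scale1r.
- pose F (w : env (subLie (cur N (borel T)))) := env_lift phi (borel_in w).
  have E : F (c *: u + v) = c *: F u + F v.
    rewrite /F; have -> : borel_in (c *: u + v) = c *: borel_in u + borel_in v.
      exact: (env_lift_linear bm).
    exact: (env_lift_linear phi_morph).
  exact: (addE _ _ _ _ _ _ _ E (env_lift_linear cm c u v) IHu IHv).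
- pose F (w : env (subLie (cur N (borel T)))) := env_lift phi (borel_in w).
  have E : F (env_in x * u) = phi (val x) * F u.
    rewrite /F; have -> : borel_in (env_in x * u) = env_in (val x : ghat) * borel_in u.
      by rewrite -(env_lift_in bm x); exact: (env_liftM bm).
    by rewrite -(env_lift_in phi_morph); exact: (env_liftM phi_morph).
  have E' : env_lift (borel_char Lambda) (env_in x * u) =
      borel_char Lambda x * env_lift (borel_char Lambda) u.
    by rewrite -[in RHS](env_lift_in cm x); exact: (env_liftM cm).
  exact: (mulE _ _ _ _ _ _ E E' (phi_borel x) IHu).
Qed.

Local Notation irel := (ind_rel (@borel_in _ _ T N) (borel_act Lambda)).
Local Notation frel := (mlin verma_to_free).

Lemma frel_tbasis a w : frel (tbasis a w) = (w : k) *: env_lift phi a v0.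
Proof. exact: (mlinU verma_to_free). Qed.

Lemma frel_rel r : irel r -> frel r = 0.
Proof.
have fB u v : frel (u - v) = frel u - frel v by exact: (raddfB frel).
have fL c u v : frel (c *: u + v) = c *: frel u + frel v by exact: (mlin_linear verma_to_free).
have sub0 (x y : V) : x = y -> x - y = 0 by move=> ->; rewrite subrr.
case=> [c a a' w|c a w w'|a b w]; apply: (etrans (fB _ _)); apply: sub0;
  apply: (etrans (frel_tbasis _ _)).
- apply: (etrans _ (esym (fL _ _ _))).
  apply: (etrans _ (f_equal2 (fun x y => c *: x + y) (esym (frel_tbasis a w))
    (esym (frel_tbasis a' w)))).
  have -> := env_lift_linear phi_morph c a a'.
  move: (env_lift phi a) (env_lift phi a') => A A'.
  rewrite -[LHS]/((w : k) *: (c *: A v0 + A' v0)).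
  by rewrite scalerDr !scalerA [in LHS]mulrC.
- apply: (etrans _ (esym (fL _ _ _))).
  apply: (etrans _ (f_equal2 (fun x y => c *: x + y) (esym (frel_tbasis a w))
    (esym (frel_tbasis a w')))).
  by move: (env_lift phi a v0) => x; rewrite -[LHS]/((c * w + w' : k) *: x) scalerDl scalerA.
- apply: (etrans _ (esym (frel_tbasis _ _))).
  have -> := env_liftM phi_morph a (borel_in b).
  rewrite -[LHS]/((w : k) *: env_lift phi a (env_lift phi (borel_in b) v0)).
  have -> := lift_borel_in b.
  rewrite linearZ_LR scalerA; congr (_ *: _); exact: mulrC.
Qed.

Definition verma_to (v : verma Lambda) : V := frel (lrepr v).

Lemma verma_to_proj u : verma_to (ind_proj _ _ u) = frel u.
Proof.
apply/eqP; rewrite -subr_eq0 -raddfB; apply/eqP.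
apply: (lspan_ker (R := irel) (f := mlin verma_to_free) frel_rel).
by have [+ _] := ind_proj_eq (@borel_in _ _ T N) (borel_act Lambda)
  (lrepr (ind_proj (@borel_in _ _ T N) (borel_act Lambda) u)) u; apply; exact: ind_reprK.
Qed.

Lemma verma_to_linear : linear verma_to.
Proof.
move=> c u v; rewrite -[u]ind_reprK -[v]ind_reprK -linearP !verma_to_proj.
exact: mlin_linear.
Qed.
HB.instance Definition _ :=
  GRing.isLinear.Build k (verma Lambda) V *:%R verma_to verma_to_linear.

Lemma verma_to_tensor a w : verma_to (tensor _ _ a w) = (w : k) *: env_lift phi a v0.
Proof. by rewrite /tensor verma_to_proj mlinU. Qed.

Lemma verma_to_gen : verma_to (verma_gen Lambda) = v0.
Proof. by rewrite verma_to_tensor env_lift1 // scale1r. Qed.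

Lemma verma_to_act x v : verma_to (verma_act (env_in x) v) = phi x (verma_to v).
Proof.
rewrite /verma_act; elim/induced_ind: v => [c a w v IHv|].
  have -> := ind_act_linear (env_in x) c (tensor _ _ a w) v.
  have -> := verma_to_linear c (ind_act (env_in x) (tensor _ _ a w)) (ind_act (env_in x) v).
  have -> := verma_to_linear c (tensor _ _ a w) v.
  have -> := IHv; have -> : verma_to (ind_act (env_in x) (tensor _ _ a w)) =
      phi x (verma_to (tensor _ _ a w)).
    apply: (etrans (congr1 verma_to (ind_act_tensor _ _ _ _ _))).
    apply: (etrans (verma_to_tensor _ _)).
    apply: (etrans _ (congr1 (phi x) (esym (verma_to_tensor _ _)))).
    apply: (etrans _ (esym (linearZ_LR _ _ _))); congr (_ *: _).
    apply: (etrans (f_equal (fun f : endo k I => f v0) (env_liftM phi_morph _ _))).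
    have -> := env_lift_in phi_morph x.
    by [].
  by rewrite endoP.
have -> := ind_act0 (@borel_in _ _ T N) (borel_act Lambda) (env_in x).
by rewrite !raddf0.
Qed.

End VermaUniversal.

(** * The Lie algebra action on the Verma module *)

Section VermaAct.
Variables (k : fieldType) (g : lieAlgType k) (T : triangular g) (N : nat).
Variable Lambda : dual (subLie (cur N (tri_h T))).
Local Notation ghat := (current N g).
Local Notation M := (verma Lambda).
Implicit Types (x y : ghat) (v : M).

Definition lact x v : M := verma_act (env_in x) v.

Lemma lact_linear x : linear (lact x).
Proof. exact: ind_act_linear. Qed.
HB.instance Definition _ x := GRing.isLinear.Build k M M *:%R (lact x) (lact_linear x).

Definition lactr v x := lact x v.
Lemma lactr_linear v : linear (lactr v).
Proof. by move=> c x y; rewrite /lactr /lact (env_in_morphism _).1; exact: ind_actDZ. Qed.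
HB.instance Definition _ v := GRing.isLinear.Build k ghat M *:%R (lactr v) (lactr_linear v).

Lemma lactDl x y v : lact (x + y) v = lact x v + lact y v.
Proof. exact: (raddfD (lactr v)). Qed.
Lemma lactZl c x v : lact (c *: x) v = c *: lact x v.
Proof. by have := lactr_linear v c x 0; rewrite (raddf0 (lactr v)) !addr0. Qed.

Lemma verma_actD c a b v : verma_act (c *: a + b) v = c *: verma_act a v + verma_act b v.
Proof. exact: ind_actDZ. Qed.
Lemma verma_actM a b v : verma_act (a * b) v = verma_act a (verma_act b v).
Proof. exact: ind_actM. Qed.
Lemma verma_act1 v : verma_act 1 v = v.
Proof. exact: ind_act1. Qed.

Lemma lact_comm x y v : lact x (lact y v) = lact y (lact x v) + lact [Lie x, y] v.
Proof.
apply/eqP; rewrite addrC -subr_eq; apply/eqP.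
have subE a b : verma_act (a - b) v = verma_act a v - verma_act b v.
  by have := verma_actD (-1) b a v; rewrite !scaleN1r addrC => ->; rewrite addrC.
apply: (etrans _ (congr1 (fun u => verma_act u v) (esym ((env_in_morphism ghat).2 x y)))).
apply: (etrans _ (esym (subE _ _))).
by congr (_ - _); apply: esym; exact: verma_actM.
Qed.

Lemma is_submodule_act (S : set M) :
  S 0 -> (forall c v w, S v -> S w -> S (c *: v + w)) ->
  (forall x v, S v -> S (lact x v)) -> is_submodule S.
Proof.
move=> S0 SD SA; split=> // [v w Sv Sw|u v Sv].
  by rewrite -[v]scale1r; exact: SD.
elim/env_ind: u => [|c u u' IHu IHu'|x u IHu].
- by have -> := verma_act1 v.
- by have -> := verma_actD c u u' v; exact: SD.
- by have -> := verma_actM (env_in x) u v; exact: SA.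
Qed.

Lemma verma_cyclic v : exists u, v = verma_act u (verma_gen Lambda).
Proof.
elim/induced_ind: v => [c a w v [u ->]|]; last first.
  exists (-1 *: 1 + 1); have -> := verma_actD (-1) 1 1 (verma_gen Lambda).
  by rewrite scaleN1r addNr.
exists ((c * w) *: a + u); have -> := verma_actD (c * w) a u (verma_gen Lambda).
apply: (congr1 (fun z => z + verma_act u (verma_gen Lambda))).
apply: (etrans _ (scalerA _ _ _)); apply: (congr1 (fun z => c *: z)).
have gE : verma_act a (verma_gen Lambda) = tensor (@borel_in _ _ T N) (borel_act Lambda) a 1.
  apply: (etrans (ind_act_tensor _ _ _ _ _)).
  by apply: (congr1 (fun z => tensor _ _ z 1)); exact: mulr1.
rewrite gE.
have t0 : tensor (@borel_in _ _ T N) (borel_act Lambda) a 0 = 0.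
  have := tensor_linearr (@borel_in _ _ T N) (borel_act Lambda) a (-1) 0 0.
  by rewrite scaler0 addr0 scaleN1r addNr.
have := tensor_linearr (@borel_in _ _ T N) (borel_act Lambda) a w 1 0.
rewrite t0 !addr0 => <-; congr tensor; exact: (esym (mulr1 w)).
Qed.

Lemma verma_span (S : submodClosed M) :
  verma_gen Lambda \in S -> (forall x v, v \in S -> lact x v \in S) ->
  forall v, v \in S.
Proof.
move=> Sg SA v; have [u ->] := verma_cyclic v.
suff [_ _ SU] : is_submodule [set v | v \in S] by exact: SU.
apply: is_submodule_act => [|c w w' wS w'S|x w wS] /=; first exact: rpred0.
  by rewrite rpredD ?rpredZ.
exact: SA.
Qed.
End VermaAct.

(** * Root spaces *)

(** A total relation compatible with linear combinations and trivial over 0 is the graph of a linear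
    map. It turns decompositions known only by existence into linear projections. *)
Lemma linear_choice (k : fieldType) (U V : lmodType k) (Rl : U -> V -> Prop) :
  (forall x, exists y, Rl x y) ->
  (forall c x y x' y', Rl x y -> Rl x' y' -> Rl (c *: x + x') (c *: y + y')) ->
  (forall y, Rl 0 y -> y = 0) ->
  exists f : {linear U -> V}, forall x, Rl x (f x).
Proof.
move=> /choice[f fR] RD R0.
have fl : linear f.
  move=> c x y; apply/eqP; rewrite -subr_eq0; apply/eqP/R0.
  have := RD (-1) _ _ _ _ (RD c _ _ _ _ (fR x) (fR y)) (fR (c *: x + y)).
  by rewrite !scaleN1r addNr [X in Rl _ X -> _]addrC.
by exists (HB.pack_for {linear U -> V} f (GRing.isLinear.Build k U V *:%R f fl)).
Qed.

(** A stable subspace contains the weight components of its elements. With a zero subspace this is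
    the independence of vectors of distinct weights. *)
Lemma weight_component (k : fieldType) (V : lmodType k) (H : Type)
    (op : H -> {linear V -> V}) (E : eqType) (ev : E -> H -> k) (S : submodClosed V) :
  (forall a b, ev a =1 ev b -> a = b) ->
  (forall h x, x \in S -> op h x \in S) ->
  forall (s : seq E) (v : E -> V), uniq s ->
    (forall a h, a \in s -> op h (v a) = ev a h *: v a) ->
    \sum_(a <- s) v a \in S -> forall a, a \in s -> v a \in S.
Proof.
move=> ev_inj Sop; elim=> // a s IHs v /= /andP[a_s us] vw; rewrite big_cons => vS.
have sS b : b \in s -> v b \in S.
  move=> bs; have ne_ba : b <> a by move=> ba; rewrite -ba bs in a_s.
  have [h hne] : exists h, ev b h != ev a h.
    by apply: contrapT => /forallNP noh; apply/ne_ba/ev_inj => h; apply/eqP/negPn/negP/noh.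
  (* Applying op h - ev a h kills the component at a and rescales the others, the one at b by a
     non-zero factor, which leaves a shorter sum in S. *)
  have wS : \sum_(b <- s) (ev b h - ev a h) *: v b \in S.
    have -> : \sum_(b <- s) (ev b h - ev a h) *: v b =
        op h (v a + \sum_(b <- s) v b) + (- ev a h) *: (v a + \sum_(b <- s) v b).
      rewrite linearD vw ?mem_head // scalerDr addrACA scaleNr subrr add0r.
      rewrite linear_sum scaler_sumr -big_split /= !big_seq; apply: eq_bigr => b' b's.
      by rewrite vw ?inE ?b's ?orbT // scalerBl scaleNr.
    by rewrite rpredD ?rpredZ // Sop.
  have vw' b' h' : b' \in s ->
      op h' ((ev b' h - ev a h) *: v b') = ev b' h' *: ((ev b' h - ev a h) *: v b').
    by move=> b's; rewrite linearZ_LR vw ?inE ?b's ?orbT // !scalerA mulrC.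
  have := rpredZ (ev b h - ev a h)^-1 (IHs (fun b => (ev b h - ev a h) *: v b) us vw' wS b bs).
  by rewrite scalerA mulVf ?scale1r // subr_eq0.
move=> b; rewrite inE => /predU1P[->|]; last exact: sS.
have -> : v a = (v a + \sum_(b <- s) v b) + (-1) *: \sum_(b <- s) v b.
  by rewrite scaleN1r addrK.
by rewrite rpredD ?rpredZ // big_seq rpred_sum.
Qed.

Section Tpow.
Variables (k : fieldType) (N : nat) (g : lieAlgType k).

(* x t^d for every natural number d, so that it vanishes for d > N. *)
Definition tp (d : nat) (x : g) : current N g :=
  [ffun j : 'I_N.+1 => if j == d :> nat then x else 0].

Lemma tp_linear d : linear (tp d).
Proof. by move=> c x y; apply/ffunP => j; rewrite !ffunE; case: ifP; rewrite ?scaler0 ?addr0. Qed.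
HB.instance Definition _ d :=
  GRing.isLinear.Build k g (current N g) *:%R (tp d) (tp_linear d).

Lemma tp_gt d x : (N < d)%N -> tp d x = 0.
Proof.
move=> Nd; apply/ffunP => j; rewrite !ffunE ltn_eqF //.
exact: leq_ltn_trans (leq_ord j) Nd.
Qed.

Lemma bracket_tp a b x y : [Lie tp a x, tp b y] = tp (a + b) [Lie x, y].
Proof.
have [Na|aN] := ltnP N a; first by rewrite (tp_gt _ Na) bracket0l tp_gt // ltn_addr.
have [Nb|bN] := ltnP N b; first by rewrite (tp_gt _ Nb) bracket0r tp_gt // ltn_addl.
have tpE c z (cN : (c < N.+1)%N) : tp c z = tpow (Ordinal cN) z.
  by apply/ffunP => j; rewrite !ffunE.
rewrite (tpE a x aN) (tpE b y bN); apply/ffunP => m.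
by rewrite bracket_tpow ffunE eq_sym.
Qed.

Lemma tp_sum (x : current N g) : x = \sum_(i < N.+1) tp i (x i).
Proof.
apply/ffunP => j; rewrite sum_ffunE (bigD1 j) //= big1 => [|i ne_ij].
  by rewrite ffunE eqxx addr0.
by rewrite ffunE; case: eqP => // /val_inj ji; rewrite ji eqxx in ne_ij.
Qed.

End Tpow.

(** * Weights and the triangular decomposition *)

Section Structure.
Variables (k : fieldType) (g : lieAlgType k) (T : triangular g).
Local Notation H0 := (subLie (tri_h0 T)).
Local Notation wt := (dual H0).
Local Notation gp := (tri_gp T).
Local Notation gm := (tri_gm T).
Local Notation h := (tri_h T).
Local Notation omega := (tri_omega T).

Lemma tri_uniq a b c a' b' c' : a \in gm -> b \in h -> c \in gp ->
  a' \in gm -> b' \in h -> c' \in gp -> a + b + c = a' + b' + c' ->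
  [/\ a = a', b = b' & c = c'].
Proof.
move=> am bh cp am' bh' cp' E.
have [] := @tri_direct _ _ T (a - a') (b - b') (c - c').
- by rewrite -scaleN1r rpredD ?rpredZ.
- by rewrite -scaleN1r rpredD ?rpredZ.
- by rewrite -scaleN1r rpredD ?rpredZ.
- by rewrite [X in X + _]addrACA -opprD addrACA -opprD E subrr.
by move=> /eqP + /eqP + /eqP; rewrite !subr_eq0 => /eqP -> /eqP -> /eqP ->.
Qed.

Definition is_weight (a : wt) (x : g) := forall t : H0, [Lie val t, x] = (a t : k) *: x.

Lemma omega_weight a x : is_weight a x -> is_weight (- a) (omega x).
Proof.
move=> xw t; apply: (tri_omega_inj (T := T)).
rewrite linearZ_LR tri_omega_bracket !tri_omegaK (tri_omega_h (sub_h0 t)).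
by rewrite bracketC xw scaleNr.
Qed.

Lemma bracket_weight a b x y : is_weight a x -> is_weight b y -> is_weight (a + b) [Lie x, y].
Proof.
move=> xw yw t; have /eqP := bracket_jacobi (val t) x y.
rewrite subr_eq => /eqP ->; rewrite xw yw bracketZl bracketZr.
by rewrite -scalerDl.
Qed.

Lemma weight_inj (a b : wt) : a =1 b -> a = b.
Proof. by move=> ab; apply/val_inj/funext. Qed.

Lemma omega_gp x : x \in gp -> omega x \in gm.
Proof. by move=> xp; apply/(tri_omega_gp T); exists x. Qed.

Lemma gp_weights x : x \in gp -> exists (s : seq wt) (v : wt -> g),
  [/\ uniq s, forall a, v a \in gp, forall a, is_weight a (v a)
    & x = \sum_(a <- s) v a].
Proof.
move=> /tri_gp_weight[l [lw ->]]; elim: l lw => [|y l IHl] lw.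
  exists [::], (fun=> 0); split=> // [a|a t|]; first exact: rpred0.
    by rewrite bracket0r scaler0.
  by rewrite !big_nil.
have [|s [v [us vp vw E]]] := IHl; first by move=> z zl; apply: lw; rewrite inE zl orbT.
have [b [yp yw]] := lw _ (mem_head _ _).
pose v' a := if a == b then v a + y else v a.
have vp' a : v' a \in gp by rewrite /v'; case: ifP => _ //; rewrite rpredD.
have vw' a : is_weight a (v' a).
  by rewrite /v'; case: eqP => [->|_] // t; rewrite bracketDr vw yw scalerDr.
have [bs|bs] := boolP (b \in s).
  exists s, v'; split=> //; rewrite big_cons E (bigD1_seq b) //= [RHS](bigD1_seq b) //=.
  rewrite addrA [v' b]/v' eqxx [y + _]addrC; congr (_ + _).
  by apply: eq_bigr => a /negPf ab; rewrite /v' ab.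
pose v'' a := if a == b then y else v a.
exists (b :: s), v''; split; first by rewrite /= bs.
- by move=> a; rewrite /v''; case: ifP.
- by move=> a; rewrite /v''; case: eqP => [->|].
rewrite !big_cons E /v'' eqxx; congr (_ + _); rewrite !big_seq; apply: eq_bigr => a as_.
by case: eqP as_ bs => // -> ->.
Qed.

(** The algebra h_0 commutes with h and preserves each summand, so a Cartan component would have
    weight 0. *)
Lemma weight_split a x : a != 0 -> is_weight a x -> exists u c,
  [/\ u \in gm, c \in gp, is_weight a u, is_weight a c & x = u + c].
Proof.
move=> a0 xw; have [u [b [c [um bh cp E]]]] := tri_sum T x.
have [u' u'p uu'] := (tri_omega_gp T u).1 um.
have key t : [/\ [Lie val t, u] = (a t : k) *: u, 0 = (a t : k) *: b
    & [Lie val t, c] = (a t : k) *: c].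
  apply: tri_uniq; rewrite ?rpredZ ?rpred0 ?bracket_h0_gp //.
    apply/(tri_omega_gp T); exists (- [Lie val t, u']).
      by rewrite -scaleN1r rpredZ // bracket_h0_gp.
    by rewrite -bracketC tri_omega_bracket -uu' (tri_omega_h (sub_h0 t)).
  rewrite -(tri_h_abelian (sub_h0 t) bh) -!bracketDr -E xw E.
  by rewrite !scalerDr.
have b0 : b = 0.
  apply/eqP; apply: contraNT a0 => nb; apply/eqP/weight_inj => t.
  by have [_ /esym/eqP + _] := key t; rewrite scaler_eq0 (negPf nb) orbF => /eqP.
exists u, c; split=> // [t|t|]; [by have [] := key t|by have [] := key t|].
by rewrite E b0 addr0.
Qed.
End Structure.

(** * Dual bases of a root space *)

Section DualBasis.
Variables (k : fieldType) (g : lieAlgType k) (T : triangular g).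
Variable P : nondegenerate_pairing T.
Local Notation gp := (tri_gp T).
Variable alpha : dual (subLie (tri_h0 T)).
Hypothesis aD : Delta_plus T alpha.
Local Notation ws := (weight_space gp alpha).
Local Notation B := (form P alpha).

Let aDelta : Delta T alpha. Proof. by left. Qed.

Lemma root_spaceP x : root_space T alpha x <-> ws x.
Proof.
by split=> [[[]//|[/(Delta_plusN aD)]//]|xw]; left.
Qed.

Lemma weight_spaceD c x y : ws x -> ws y -> ws (c *: x + y).
Proof.
move=> [xp xw] [yp yw]; split=> [|t]; first by rewrite rpredD ?rpredZ.
by rewrite bracketDr bracketZr xw yw scalerDr !scalerA mulrC.
Qed.

Lemma weight_space0 : ws 0.
Proof. by split=> [|t]; rewrite ?rpred0 // bracket0r scaler0. Qed.

Lemma weight_space_sum n (c : nat -> k) (x : nat -> g) :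
  (forall i, (i < n)%N -> ws (x i)) -> ws (\sum_(i < n) c i *: x i).
Proof.
elim: n => [|n IHn] xw; first by rewrite big_ord0; exact: weight_space0.
rewrite big_ord_recr /= [X in ws X]addrC; apply: weight_spaceD; first exact: xw.
by apply: IHn => i ?; apply: xw; rewrite ltnW.
Qed.

Lemma form_suml n (c : nat -> k) (x : nat -> g) y :
  (forall i, (i < n)%N -> ws (x i)) -> ws y ->
  B (\sum_(i < n) c i *: x i) y = \sum_(i < n) c i * B (x i) y.
Proof.
move=> + yw; have Yr := (root_spaceP _).2 yw.
elim: n => [|n IHn] xw.
  rewrite !big_ord0; have Zr := (root_spaceP _).2 weight_space0.
  have := form_linearl P aDelta (-1) Zr Zr Yr.
  by rewrite scaler0 addr0 mulN1r addNr.
rewrite !big_ord_recr /= addrC form_linearl //; first 1 last.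
- by apply/root_spaceP/xw.
- by apply/root_spaceP/weight_space_sum => i ?; apply: xw; rewrite ltnW.
by rewrite IHn 1?addrC // => i ?; apply: xw; rewrite ltnW.
Qed.

Lemma form_sumr n (c : nat -> k) (x : nat -> g) y :
  (forall i, (i < n)%N -> ws (x i)) -> ws y ->
  B y (\sum_(i < n) c i *: x i) = \sum_(i < n) c i * B y (x i).
Proof.
move=> + yw; have Yr := (root_spaceP _).2 yw.
elim: n => [|n IHn] xw.
  rewrite !big_ord0; have Zr := (root_spaceP _).2 weight_space0.
  have := form_linearr P aDelta (-1) Yr Zr Zr.
  by rewrite scaler0 addr0 mulN1r addNr.
rewrite !big_ord_recr /= addrC form_linearr //; first 1 last.
- by apply/root_spaceP/xw.
- by apply/root_spaceP/weight_space_sum => i ?; apply: xw; rewrite ltnW.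
by rewrite IHn 1?addrC // => i ?; apply: xw; rewrite ltnW.
Qed.

Definition dual_family n (x y : nat -> g) : Prop :=
  [/\ forall i, (i < n)%N -> ws (x i), forall i, (i < n)%N -> ws (y i)
    & forall i j, (i < n)%N -> (j < n)%N -> B (x i) (y j) = (i == j)%:R].

(** Pairing a linear relation among the x_i with y_j isolates its j-th coefficient, so a dual family
    cannot be longer than a spanning list of the root space. *)
Lemma dual_family_bound : exists m, forall n x y, dual_family n x y -> (n <= m)%N.
Proof.
have [s sP] := tri_root_finite_dim aD; exists (size s) => n x y [xw yw xy].
rewrite leqNgt; apply/negP => lt_sn.
have /choice[c cE] i : exists c : nat -> k,
    (i < n)%N -> x i = \sum_(l < size s) c l *: s`_l.
  have [lin|_] := boolP (i < n)%N; last by exists (fun=> 0).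
  by have [c cE] := sP _ (xw i lin); exists c.
pose C := \matrix_(i < n, l < size s) c i l.
have : kermx C != 0.
  rewrite -mxrank_eq0 mxrank_ker -lt0n subn_gt0.
  exact: leq_ltn_trans (rank_leq_col C) lt_sn.
case/rowV0Pn => u /sub_kermxP uC /eqP; apply; apply/rowP => j.
(* Families are indexed by natural numbers, so the row is extended by zero. *)
pose d (i : nat) : k := if insub i is Some i' then u ord0 (i' : 'I_n) else 0.
have dE (i : 'I_n) : d i = u ord0 i by rewrite /d valK.
have := @form_suml n d x (y j) xw (yw _ (ltn_ord j)).
have -> : \sum_(i < n) d i *: x i = \sum_(i < 0) d i *: x i.
  rewrite big_ord0; transitivity (\sum_(l < size s) (u *m C) ord0 l *: s`_l).
    under [RHS]eq_bigr do rewrite mxE scaler_suml.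
    rewrite exchange_big; apply: eq_bigr => i _ /=.
    rewrite cE // scaler_sumr; apply: eq_bigr => l _.
    by rewrite dE !mxE scalerA.
  by rewrite uC big1 // => l _; rewrite mxE scale0r.
rewrite form_suml // ?big_ord0; last exact: yw.
rewrite (bigD1 j) //= big1 => [|i ij]; last first.
  by rewrite xy // (negPf ij : (val i == j) = false) mulr0.
by rewrite xy // eqxx mulr1 addr0 dE mxE => <-.
Qed.

Lemma formBl x x' y : ws x -> ws x' -> ws y -> B (x - x') y = B x y - B x' y.
Proof.
move=> /root_spaceP xr /root_spaceP xr' /root_spaceP yr.
by rewrite -[x - x']addrC -scaleN1r form_linearl // mulN1r addrC.
Qed.
Lemma formBr x y y' : ws x -> ws y -> ws y' -> B x (y - y') = B x y - B x y'.
Proof.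
move=> /root_spaceP xr /root_spaceP yr /root_spaceP yr'.
by rewrite -[y - y']addrC -scaleN1r form_linearr // mulN1r addrC.
Qed.
Lemma weight_spaceB x y : ws x -> ws y -> ws (x - y).
Proof. by move=> xw yw; rewrite addrC -scaleN1r; apply: weight_spaceD. Qed.
Lemma formZr c x y : ws x -> ws y -> B x (c *: y) = c * B x y.
Proof.
move=> xw yw; have := @form_sumr 1 (fun=> c) (fun=> y) x (fun _ _ => yw) xw.
by rewrite !big_ord1.
Qed.

Lemma delta_sumr n (c : nat -> k) i :
  (i < n)%N -> \sum_(j < n) c j * (j == i :> nat)%:R = c i.
Proof.
move=> lin; rewrite (bigD1 (Ordinal lin)) //= eqxx mulr1 big1 ?addr0 // => j ne_ji.
by rewrite (negPf ne_ji : (val j == i) = false) mulr0.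
Qed.

(* A dual family of maximal length spans: a vector orthogonal to it could be used
   to extend it. *)
Lemma dual_basis_exists : exists n x y, [/\ dual_family n x y,
  forall v, ws v -> v = \sum_(j < n) B v (y j) *: x j
  & forall v, ws v -> v = \sum_(j < n) B (x j) v *: y j].
Proof.
have [m mP] := dual_family_bound.
pose Q n := `[< exists x y, dual_family n x y >].
have Q0 : exists n, Q n by exists 0%N; apply/asboolP; exists (fun=> 0), (fun=> 0).
have Qm n : Q n -> (n <= m)%N by move=> /asboolP[x [y]]; exact: mP.
case: (ex_maxnP Q0 Qm) => n /asboolP[x [y [xw yw xy]]] nmax.
have xr w : ws w -> forall i, (i < n)%N -> B (x i) (w - \sum_(j < n) B (x j) w *: y j) = 0.
  move=> ww i lin; rewrite formBr //;
    [|exact: xw|exact: (weight_space_sum (fun j => B (x j) w) yw)].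
  rewrite (form_sumr (fun j => B (x j) w)) //; last exact: xw.
  under eq_bigr => j _ do rewrite xy // eq_sym.
  by rewrite (delta_sumr (fun j => B (x j) w)) ?subrr.
have yr v : ws v -> forall i, (i < n)%N -> B (v - \sum_(j < n) B v (y j) *: x j) (y i) = 0.
  move=> vw i lin; rewrite formBl //;
    [|exact: (weight_space_sum (fun j => B v (y j)) xw)|exact: yw].
  rewrite (form_suml (fun j => B v (y j))) //; last exact: yw.
  under eq_bigr => j _ do rewrite xy //.
  by rewrite (delta_sumr (fun j => B v (y j))) ?subrr.
have spanx v : ws v -> v = \sum_(j < n) B v (y j) *: x j.
  move=> vw; apply/eqP; rewrite -subr_eq0; apply/eqP; set v' := v - _.
  have v'w : ws v' by apply: weight_spaceB => //; exact: (weight_space_sum (fun j => B v (y j)) xw).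
  apply: (form_nondegl (n := P) aDelta); first exact/root_spaceP.
  move=> w /root_spaceP ww; apply/eqP/negPn/negP => nw.
  (* The correction makes w' orthogonal to the x_j and does not change its value against v', which
     is orthogonal to the y_j. After scaling, v' and w' prolong the family. *)
  pose w' := w - \sum_(j < n) B (x j) w *: y j.
  have w'w : ws w' by apply: weight_spaceB => //; exact: (weight_space_sum (fun j => B (x j) w) yw).
  have v'w' : B v' w' = B v' w.
    rewrite formBr //; last exact: (weight_space_sum (fun j => B (x j) w) yw).
    rewrite (form_sumr (fun j => B (x j) w)) // big1 ?subr0 // => j _.
    by rewrite yr // mulr0.
  suff : Q n.+1 by move=> /nmax; rewrite ltnn.
  pose c := (B v' w)^-1.
  apply/asboolP; exists (fun i => if (i < n)%N then x i else v').
  exists (fun i => if (i < n)%N then y i else c *: w').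
  have cw : ws (c *: w') by rewrite -[_ *: _]addr0; exact: weight_spaceD weight_space0.
  split=> [i _|i _|i j].
  - by case: ifP => // /xw.
  - by case: ifP => // /yw.
  have [lin|in_] := boolP (i < n)%N => i_n; have [ljn|jn] := boolP (j < n)%N => j_n.
  - by rewrite xy.
  - rewrite formZr ?xr ?mulr0 ?(ltn_eqF (leq_trans lin _)) //; first by rewrite leqNgt.
    exact: xw.
  - by rewrite yr // gtn_eqF // (leq_trans ljn) // leqNgt.
  - have -> : i = j by lia.
    by rewrite eqxx formZr // v'w' mulVf.
exists n, x, y; split=> // v vw.
apply/eqP; rewrite -subr_eq0; apply/eqP; set v' := v - _.
have v'w : ws v' by apply: weight_spaceB => //; exact: (weight_space_sum (fun j => B (x j) v) yw).
apply: (form_nondegr (n := P) aDelta); first exact/root_spaceP.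
move=> w /root_spaceP ww; rewrite [w]spanx //.
rewrite (form_suml (fun j => B w (y j))) // big1 // => j _.
by rewrite xr // mulr0.
Qed.

End DualBasis.

(** * Letters *)

Section Letters.
Variables (k : fieldType) (g : lieAlgType k) (T : triangular g).
Variables (P : nondegenerate_pairing T) (N : nat).
Local Notation wt := (dual (subLie (tri_h0 T))).
Local Notation gp := (tri_gp T).
Local Notation gm := (tri_gm T).
Local Notation ws := (weight_space gp).
Local Notation omega := (tri_omega T).
Local Notation ghat := (current N g).

Fact root_basis_exists (a : wt) : exists b : nat * (nat -> g) * (nat -> g),
  Delta_plus T a -> [/\ dual_family P a b.1.1 b.1.2 b.2,
    forall v, ws a v -> v = \sum_(j < b.1.1) form P a v (b.2 j) *: b.1.2 j
    & forall v, ws a v -> v = \sum_(j < b.1.1) form P a (b.1.2 j) v *: b.2 j].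
Proof.
have [aD|naD] := pselect (Delta_plus T a); last by exists (0%N, fun=> 0, fun=> 0).
by have [n [x [y H]]] := dual_basis_exists P aD; exists (n, x, y).
Qed.
(* Dual bases (rX a j), (rY a j), for j < rdim a, of the root space of a, if a is a
   positive root. *)
Definition root_basis a := sval (cid (root_basis_exists a)).
Definition rdim a := (root_basis a).1.1.
Definition rX a := (root_basis a).1.2.
Definition rY a := (root_basis a).2.

Lemma root_basisP a : Delta_plus T a -> [/\ dual_family P a (rdim a) (rX a) (rY a),
    forall v, ws a v -> v = \sum_(j < rdim a) form P a v (rY a j) *: rX a j
    & forall v, ws a v -> v = \sum_(j < rdim a) form P a (rX a j) v *: rY a j].
Proof. exact: (svalP (cid (root_basis_exists a))). Qed.

Fact root_key_exists : exists f : wt -> nat, {in [set a | Delta_plus T a]%classic &, injective f}.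
Proof. exact/countable_injP/tri_weight_countable. Qed.
Definition root_key := sval (cid root_key_exists).
Lemma root_key_inj a b :
  Delta_plus T a -> Delta_plus T b -> root_key a = root_key b -> a = b.
Proof. by move=> aD bD; apply: (svalP (cid root_key_exists)); exact: mem_set. Qed.

Definition is_letter (i : wt * nat * 'I_N.+1) : bool :=
  `[< Delta_plus T i.1.1 >] && (i.1.2 < rdim i.1.1)%N.
Definition letter : Type := {i | is_letter i}.
HB.instance Definition _ := Choice.on letter.

Definition lroot (i : letter) : wt := (val i).1.1.
Definition lnum (i : letter) : nat := (val i).1.2.
Definition ldeg (i : letter) : 'I_N.+1 := (val i).2.

Lemma lrootP i : Delta_plus T (lroot i).
Proof. by case: i => i ip; case/andP: (ip) => /asboolP. Qed.
Lemma lnumP i : (lnum i < rdim (lroot i))%N.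
Proof. by case: i => i ip; case/andP: (ip). Qed.
Lemma letter_exists a j (d : 'I_N.+1) : Delta_plus T a -> (j < rdim a)%N ->
  exists i, [/\ lroot i = a, lnum i = j & ldeg i = d].
Proof.
move=> aD ja; have ip : is_letter (a, j, d) by apply/andP; split=> //; apply/asboolP.
by exists (exist is_letter _ ip).
Qed.
Lemma letter_inj i j : lroot i = lroot j -> lnum i = lnum j -> ldeg i = ldeg j -> i = j.
Proof.
move=> rij nij dij; apply: val_inj; move: rij nij dij; rewrite /lroot /lnum /ldeg.
by case: (val i) (val j) => [[? ?] ?] [[? ?] ?] /= -> -> ->.
Qed.

(** Countability of the set of roots makes the letters countable. The resulting total order is
    arbitrary: it is related neither to degrees nor to roots. *)
Definition lkey (i : letter) : nat :=
  choice.pickle (root_key (lroot i), lnum i, nat_of_ord (ldeg i)).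
Lemma lkey_inj : injective lkey.
Proof.
move=> i j /(pcan_inj choice.pickleK)[rij nij /val_inj dij].
by apply: letter_inj => //; apply: root_key_inj => //; exact: lrootP.
Qed.
Definition leL : rel letter := fun i j => (lkey i <= lkey j)%N.
Lemma leL_total : total leL. Proof. by move=> i j; exact: leq_total. Qed.
Lemma leL_trans : transitive leL. Proof. by move=> i j l; exact: leq_trans. Qed.
Lemma leL_anti : antisymmetric leL.
Proof. by move=> i j ij; apply/lkey_inj/anti_leq. Qed.

Definition gY (i : letter) : g := rY (lroot i) (lnum i).
Definition gX (i : letter) : g := rX (lroot i) (lnum i).
Definition ly (i : letter) : ghat := tp N (ldeg i) (omega (gY i)).
Definition lz (i : letter) : ghat := tp N (N - ldeg i) (gX i).

Lemma gX_ws i : ws (lroot i) (gX i).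
Proof. by have [[xw _ _] _ _] := root_basisP (lrootP i); apply/xw/lnumP. Qed.
Lemma gY_ws i : ws (lroot i) (gY i).
Proof. by have [[_ yw _] _ _] := root_basisP (lrootP i); apply/yw/lnumP. Qed.

Lemma ly_span a d u : ws a u ->
  tp N d (omega u) \in
    lspan [set v | exists i, [/\ lroot i = a, ldeg i = d :> nat & v = ly i]]%classic.
Proof.
move=> uw; have [->|u0] := eqVneq u 0; first by rewrite !linear0 rpred0.
have aD : Delta_plus T a by exists u.
have [_ _ /(_ u uw) ->] := root_basisP aD; rewrite !linear_sum rpred_sum // => j _.
rewrite linearZ_LR linearZ_LR rpredZ //=.
have [Nd|dN] := ltnP N d; first by rewrite tp_gt // rpred0.
have [i [ri ni di]] := letter_exists (Ordinal (dN : (d < N.+1)%N)) aD (ltn_ord j).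
by apply: lspan_incl; exists i; split=> //; rewrite ?di // /ly /gY ri ni di.
Qed.

Lemma lz_span a d u : ws a u ->
  tp N d u \in lspan [set v | exists i, [/\ lroot i = a, (N - ldeg i = d)%N & v = lz i]]%classic.
Proof.
move=> uw; have [->|u0] := eqVneq u 0; first by rewrite !linear0 rpred0.
have aD : Delta_plus T a by exists u.
have [_ /(_ u uw) -> _] := root_basisP aD; rewrite !linear_sum rpred_sum // => j _.
rewrite linearZ_LR rpredZ //=; have [Nd|dN] := ltnP N d; first by rewrite tp_gt // rpred0.
have Nd : (N - d < N.+1)%N by rewrite ltnS leq_subr.
have [i [ri ni di]] := letter_exists (Ordinal Nd) aD (ltn_ord j).
apply: lspan_incl; exists i; split=> //; rewrite ?di /= ?subKn //.
by rewrite /lz /gX ri ni di /= subKn.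
Qed.

Lemma gm_span d a : a \in gm ->
  tp N d a \in lspan [set v | exists2 i, ldeg i = d :> nat & v = ly i]%classic.
Proof.
move=> /(tri_omega_gp T)[c cp ->]; have [s [v [_ vp vw ->]]] := gp_weights cp.
rewrite !linear_sum rpred_sum // => b _; have vb : ws b (v b) := conj (vp b) (vw b).
apply: lspan_ind (ly_span d vb) => _ [i [_ di ->]].
by apply: lspan_incl; exists i.
Qed.

Lemma gp_span d c : c \in gp ->
  tp N d c \in lspan [set v | exists2 i, (N - ldeg i = d)%N & v = lz i]%classic.
Proof.
move=> cp; have [s [v [_ vp vw ->]]] := gp_weights cp.
rewrite !linear_sum rpred_sum // => b _; have vb : ws b (v b) := conj (vp b) (vw b).
apply: lspan_ind (lz_span d vb) => _ [i [_ di ->]].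
by apply: lspan_incl; exists i.
Qed.

(** For equal roots the pairing and the duality of the bases give h(alpha) or 0. For distinct roots
    the bracket has non-zero weight, hence no Cartan component. *)
Lemma bracket_XY i j : exists a c, [/\ a \in gm, c \in gp &
  [Lie gX i, omega (gY j)] =
    a + (if (lroot i == lroot j) && (lnum i == lnum j) then val (hvec P (lroot i)) else 0) + c].
Proof.
have [Xp Xw] := gX_ws i; have [Yp Yw] := gY_ws j.
have [rij|ne_r] := eqVneq (lroot i) (lroot j) => /=.
  exists 0, 0; split; rewrite ?rpred0 // add0r addr0.
  have aD := lrootP i; have [[_ _ XY] _ _] := root_basisP aD.
  have aDelta : Delta T (lroot i) by left.
  rewrite (pairing_bracket P aDelta); first last.
  - by rewrite rij; apply/root_spaceP; [exact: lrootP | exact: gY_ws].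
  - by apply/root_spaceP; [exact: lrootP | exact: gX_ws].
  rewrite /gX /gY -rij XY ?lnumP //; last by rewrite rij lnumP.
  by case: eqP => _; rewrite ?scale1r ?scale0r.
have [||a [c [am cp _ _ E]]] := @weight_split _ _ T (lroot i - lroot j) [Lie gX i, omega (gY j)].
- by rewrite subr_eq0.
- by apply: bracket_weight => //; apply: omega_weight.
by exists a, c; split=> //; rewrite addr0.
Qed.

Local Notation bhat := (cur N (borel T)).

Lemma gp_borel c : c \in gp -> c \in borel T.
Proof. by move=> cp; apply/borelP; exists 0, c; rewrite rpred0 add0r. Qed.
Lemma h_borel b : b \in tri_h T -> b \in borel T.
Proof. by move=> bh; apply/borelP; exists b, 0; rewrite rpred0 addr0. Qed.

Lemma gm_borel0 a : a \in gm -> a \in borel T -> a = 0.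
Proof.
move=> am /borelP[b [c [bh cp E]]].
have [] // := @tri_uniq _ _ T a 0 0 0 b c; rewrite ?rpred0 //.
by rewrite !addr0 add0r.
Qed.

Lemma ly_cur i : ly i \in cur N gm.
Proof.
apply/curP => j; rewrite ffunE; case: ifP => _; last exact: rpred0.
by have [Yp _] := gY_ws i; exact: omega_gp.
Qed.

Lemma mlin_ly_at (u : {malg k[letter]}) (d : 'I_N.+1) :
  mlin ly u d = omega (\sum_(i <- msupp u | ldeg i == d) mcoeff i u *: gY i).
Proof.
rewrite /mlin sum_ffunE linear_sum [RHS]big_mkcond; apply: eq_bigr => i _.
rewrite !ffunE (_ : (nat_of_ord d == ldeg i) = (ldeg i == d)); last by rewrite eq_sym.
by case: ifP => _; rewrite ?scaler0 // linearZ_LR.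
Qed.

(** Each coefficient of t^d lies both in g_- and in the Borel subalgebra, so it vanishes. Its image
    under omega splits into root components, and pairing the one of i0 with [gX i0] isolates the
    coefficient of i0. *)
Lemma ly_free (u : {malg k[letter]}) : mlin ly u \in bhat -> u = 0.
Proof.
move=> /curP ub; apply/malgP => i0; rewrite mcoeff0.
pose d := ldeg i0.
have : mlin ly u d = 0.
  apply: gm_borel0; last exact: ub.
  rewrite mlin_ly_at; apply: omega_gp; rewrite rpred_sum // => i _.
  by rewrite rpredZ //; have [] := gY_ws i.
rewrite mlin_ly_at => /(congr1 omega); rewrite tri_omegaK linear0.
set F := (fun i => mcoeff i u *: gY i).
pose s := undup [seq lroot i | i <- msupp u].
pose v a := \sum_(i <- msupp u | (ldeg i == d) && (lroot i == a)) F i.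
have -> : \sum_(i <- msupp u | ldeg i == d) F i = \sum_(a <- s) v a.
  rewrite /v (exchange_big_dep (fun i => ldeg i == d)) /=; last by move=> a i _ /andP[].
  rewrite big_seq_cond [RHS]big_seq_cond; apply: eq_bigr => i /andP[iu di].
  rewrite [RHS]big_mkcond (bigD1_seq (lroot i)) ?undup_uniq ?mem_undup ?map_f //=.
  rewrite di eqxx [X in _ + X]big1 ?addr0 // => a; rewrite eq_sym.
  by case: eqP => //; rewrite andbF.
move=> v0; have vw a : is_weight a (v a).
  rewrite /v; elim/big_ind: _ => [t|x y xw yw t|i /andP[_ /eqP <-] t].
  - by rewrite bracket0r scaler0.
  - by rewrite bracketDr xw yw scalerDr.
  - by rewrite bracketZr (gY_ws i).2 !scalerA mulrC.
have [i0u|/mcoeff_outdom //] := boolP (i0 \in msupp u).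
have va0 : v (lroot i0) = 0.
  (* The zero subspace, in the form that [weight_component] expects. *)
  pose S0 := lspan (V := g) set0.
  have S0P x : x \in S0 -> x = 0.
    by move=> /asboolP[[|p l] [lP ->]]; rewrite ?big_nil //; case: (lP p); rewrite mem_head.
  apply: (S0P).
  apply: (@weight_component k g (subLie (tri_h0 T)) (fun t => bracket (val t) : {linear g -> g})
     wt (fun a t => a t : k) S0 _ _ s v _ _ _ (lroot i0)).
  - by move=> a b ab; exact: weight_inj.
  - by move=> t x /S0P ->; rewrite linear0 rpred0.
  - exact: undup_uniq.
  - by move=> a t _; exact: vw.
  - by rewrite v0 rpred0.
  - by rewrite mem_undup map_f.
have aD := lrootP i0; have [[Xw Yw XY] _ _] := root_basisP aD.
have Xi := gX_ws i0; pose C i := (ldeg i == d) && (lroot i == lroot i0).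
have [_] : ws (lroot i0) (v (lroot i0)) /\ form P (lroot i0) (gX i0) (v (lroot i0)) =
    \sum_(i <- msupp u | C i) mcoeff i u * (lnum i == lnum i0)%:R.
  rewrite /v; elim/big_rec2: _ => [|i c x /andP[_ /eqP ri] [xw xE]].
    split; first exact: weight_space0.
    by have := formBr P aD Xi (weight_space0 _) (weight_space0 _); rewrite !subr0 subrr.
  have Yi : ws (lroot i0) (gY i) by rewrite -ri; exact: gY_ws.
  split; first exact: weight_spaceD.
  rewrite form_linearr; [|by left|exact/root_spaceP|exact/root_spaceP|exact/root_spaceP].
  rewrite xE /gX /gY ri XY ?lnumP // ?[_ == lnum i]eq_sym //.
  by rewrite -ri lnumP.
rewrite va0 big_mkcond (bigD1_seq i0) ?fset_uniq //= /C !eqxx /= mulr1.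
rewrite big1 ?addr0 => [|i ne_i]; last first.
  case: eqP => //= di; case: eqP => //= ri; case: eqP => [ni|_]; last by rewrite mulr0.
  by case/eqP: ne_i; apply: letter_inj.
by have := formBr P aD Xi (weight_space0 _) (weight_space0 _); rewrite !subr0 subrr => ->.
Qed.

Lemma ghat_split (x : ghat) : exists a b c : ghat,
  [/\ a \in cur N gm, b \in cur N (tri_h T), c \in cur N gp & x = a + b + c].
Proof.
have /choice[f fE] (i : 'I_N.+1) : exists p : g * g * g,
    [/\ p.1.1 \in gm, p.1.2 \in tri_h T, p.2 \in gp & x i = p.1.1 + p.1.2 + p.2].
  by have [a [b [c H]]] := tri_sum T (x i); exists (a, b, c).
exists [ffun i => (f i).1.1], [ffun i => (f i).1.2], [ffun i => (f i).2].
split; try by apply/curP => i; rewrite ffunE; case: (fE i).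
by apply/ffunP => i; rewrite !ffunE; case: (fE i).
Qed.

Lemma cur_gm_lspan a : a \in cur N gm -> a \in lspan (range ly).
Proof.
move=> /curP am; rewrite [a]tp_sum rpred_sum // => d _.
apply: lspan_ind (gm_span d (am d)) => _ [i _ ->].
by apply: lspan_incl; exists i.
Qed.

Lemma lspan_mlin (K : choiceType) (V : lmodType k) (f : K -> V) v :
  v \in lspan (range f) -> exists u : {malg k[K]}, v = mlin f u.
Proof.
move=> /asboolP[s [sR ->]]; elim: s sR => [|p s IHs] sR.
  by exists 0; rewrite big_nil (raddf0 (mlin f)).
have [|u uE] := IHs; first by move=> q qs; apply: sR; rewrite inE qs orbT.
have [i _ iE] := sR p (mem_head _ _); exists (p.1 *: mkmalgU i 1 + u).
by rewrite big_cons uE mlin_linear mlinU iE.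
Qed.

Lemma coord_exists : exists f : {linear ghat -> {malg k[letter]}},
  forall x, exists2 b, b \in bhat & x = mlin ly (f x) + b.
Proof.
apply: (@linear_choice _ _ _ (fun x u => exists2 b, b \in bhat & x = mlin ly u + b)).
- move=> x; have [a [b [c [am bh cp ->]]]] := ghat_split x.
  have [u ->] := lspan_mlin (cur_gm_lspan am); exists u, (b + c); rewrite ?addrA //.
  rewrite rpredD //; apply/curP => i.
    by apply: h_borel; move/curP: bh.
  by apply: gp_borel; move/curP: cp.
- move=> c x u x' u' [b bB ->] [b' bB' ->]; exists (c *: b + b').
    by rewrite rpredD ?rpredZ.
  by rewrite mlin_linear scalerDr addrACA.
- move=> u [b bB /eqP E]; apply: ly_free.
  by move: E; rewrite eq_sym addr_eq0 => /eqP ->; rewrite -scaleN1r rpredZ.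
Qed.
Definition lcoord := sval (cid coord_exists).
Lemma lcoordP x : exists2 b, b \in bhat & x = mlin ly (lcoord x) + b.
Proof. exact: (svalP (cid coord_exists)). Qed.

Lemma lcoord_uniq u b : b \in bhat -> lcoord (mlin ly u + b) = u.
Proof.
move=> bB; have [b' bB' E] := lcoordP (mlin ly u + b).
set u' := lcoord _ in E *; apply/eqP; rewrite -subr_eq0; apply/eqP/ly_free.
rewrite (raddfB (mlin ly)) /= (_ : mlin ly u' - mlin ly u = b + (-1) *: b').
  by rewrite rpredD ?rpredZ.
apply/eqP; rewrite scaleN1r subr_eq addrAC [b + _]addrC E.
by rewrite addrK.
Qed.

End Letters.

Section Mcoef.
Variables (k : fieldType) (K : choiceType) (s : K).

Definition mcoef (u : {malg k[K]}) : k^o := mcoeff s u.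
Lemma mcoef_linear : linear mcoef.
Proof. by move=> c u v; rewrite /mcoef mcoeffD mcoeffZ. Qed.
HB.instance Definition _ :=
  GRing.isLinear.Build k {malg k[K]} k^o *:%R mcoef mcoef_linear.

Lemma lspan_msupp (p : K -> Prop) (u : {malg k[K]}) :
  u \in lspan [set v | exists2 t, p t & v = mkmalgU t 1]%classic -> s \in msupp u -> p s.
Proof.
move=> uS; rewrite -mcoeff_neq0; apply: contraPP => ps.
have -> // : mcoeff s u = 0; last by rewrite eqxx.
apply: (lspan_ker (f := mcoef)) uS => _ [t pt ->].
rewrite /= /mcoef mcoeffU; case: eqP => // ts; by rewrite ts in pt.
Qed.
End Mcoef.

(** * Coordinates and height on Q_+ *)

Section QplusFree.
Variables (k : fieldType) (g : lieAlgType k) (T : triangular g).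
Local Notation wt := (dual (subLie (tri_h0 T))).

Lemma Qplus0 : Qplus T 0.
Proof. by exists [::]; split=> //; rewrite big_nil. Qed.
Lemma QplusD a b : Qplus T a -> Qplus T b -> Qplus T (a + b).
Proof.
move=> [s [sP ->]] [t [tP ->]]; exists (s ++ t); split; last by rewrite big_cat.
by move=> c; rewrite mem_cat => /orP[/sP|/tP].
Qed.
Lemma Qplus_root a : Delta_plus T a -> Qplus T a.
Proof.
move=> aD; exists [:: a]; split; last by rewrite big_seq1.
by move=> b; rewrite mem_seq1 => /eqP ->.
Qed.

(** The sum of the coordinates is a height, additive on Q_+ and positive on roots. All finiteness
    statements about words of a given weight rest on it. *)
Lemma Qplus_coords : exists (n : nat) (a : 'I_n -> wt) (mu : wt -> {ffun 'I_n -> nat}),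
  [/\ forall chi, Qplus T chi -> chi = \sum_i a i *+ mu chi i,
      forall chi chi', Qplus T chi -> Qplus T chi' ->
        forall i, mu (chi + chi') i = (mu chi i + mu chi' i)%N
    & forall b, Delta_plus T b -> (0 < \sum_i mu b i)%N].
Proof.
have [n [a [_ _ free]]] := tri_Qplus_free T.
have /choice[mu muP] chi : exists m : {ffun 'I_n -> nat}, Qplus T chi ->
    chi = \sum_i a i *+ m i /\ forall m' : {ffun 'I_n -> nat}, chi = \sum_i a i *+ m' i -> m = m'.
  have [/free[m [mE mu]]|nQ] := pselect (Qplus T chi); first by exists m.
  by exists [ffun=> 0%N].
exists n, a, mu; split=> [chi /muP[]//|chi chi' cQ cQ' i|b bD].
  have [_ /(_ [ffun i => (mu chi i + mu chi' i)%N]) ->] := muP _ (QplusD cQ cQ').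
    by rewrite ffunE.
  rewrite {1}(muP _ cQ).1 {1}(muP _ cQ').1 -big_split; apply: eq_bigr => j _.
  by rewrite ffunE mulrnDr.
rewrite lt0n sum_nat_eq0; apply/negP => /forallP b0.
have := tri_weight_neq0 bD; rewrite (muP _ (Qplus_root bD)).1 big1 ?eqxx // => i _.
by have /eqP -> := b0 i.
Qed.

Lemma Qplus_sum_roots (I : Type) (s : seq I) (r : I -> wt) :
  (forall i, Delta_plus T (r i)) -> Qplus T (\sum_(i <- s) r i).
Proof.
by move=> rD; elim/big_ind: _ => [||i _]; [exact: Qplus0|exact: QplusD|exact: Qplus_root].
Qed.

(** Heights add up and each root has a positive one. Consequently the empty word is the only word of
    weight 0. *)
Lemma roots_sum0 (I : Type) (s : seq I) (r : I -> wt) :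
  (forall i, Delta_plus T (r i)) -> \sum_(i <- s) r i = 0 -> size s = 0%N.
Proof.
move=> rD; have [n [a [mu [_ muD mu0]]]] := Qplus_coords.
case: s => // i s; rewrite big_cons => E.
have sQ := Qplus_sum_roots s rD; have iQ := Qplus_root (rD i).
have z j : mu 0 j = 0%N by have := muD _ _ Qplus0 Qplus0 j; rewrite addr0; lia.
have := mu0 _ (rD i); rewrite lt0n sum_nat_eq0 => /negP[]; apply/forallP => j.
by have := muD _ _ iQ sQ j; rewrite E z => /esym/eqP; rewrite addn_eq0 => /andP[->].
Qed.

Lemma bracket_h_gm b x : b \in tri_h T -> x \in tri_gm T -> [Lie b, x] \in tri_gm T.
Proof.
move=> bh /(tri_omega_gp T)[c cp ->]; apply/(tri_omega_gp T).
exists (- [Lie b, c]); first by rewrite -scaleN1r rpredZ // bracket_h_gp.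
by rewrite -bracketC tri_omega_bracket (tri_omega_h bh).
Qed.
End QplusFree.

(** * The basis of sorted words *)

Section VermaBasis.
Variables (k : fieldType) (g : lieAlgType k) (T : triangular g).
Variables (P : nondegenerate_pairing T) (N : nat).
Variable Lambda : dual (subLie (cur N (tri_h T))).
Local Notation wt := (dual (subLie (tri_h0 T))).
Local Notation gp := (tri_gp T).
Local Notation gm := (tri_gm T).
Local Notation ghat := (current N g).
Local Notation bhat := (cur N (borel T)).
Local Notation letter := (letter P N).
Local Notation M := (verma Lambda).
Local Notation bas s := (mkmalgU (s : seq letter) 1 : {malg k[seq letter]}).
Local Notation gen := (verma_gen Lambda).

(* The extension of Lambda by zero to the positive and negative parts. *)
Lemma lam_exists : exists f : {linear ghat -> k^o}, forall x, exists a b c,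
  [/\ a \in cur N gm, c \in cur N gp, x = a + val b + c & f x = Lambda b].
Proof.
apply: (@linear_choice _ _ _ (fun (x : ghat) (r : k^o) => exists a (b : subLie (cur N (tri_h T))) c,
  [/\ a \in cur N gm, c \in cur N gp, x = a + val b + c & r = Lambda b])).
- move=> x; have [a [b [c [am bh cp ->]]]] := ghat_split T x.
  by exists (Lambda (SubLie bh)), a, (SubLie bh), c.
- move=> r x s x' s' [a [b [c [am cp -> ->]]]] [a' [b' [c' [am' cp' -> ->]]]].
  exists (r *: a + a'), (r *: b + b'), (r *: c + c'); split; rewrite ?rpredD ?rpredZ //.
    by rewrite !scalerDr [LHS]addrACA [X in X + _ = _]addrACA.
  by rewrite dualP.
- move=> _ [a [b [c [/curP am /curP cp E ->]]]].
  rewrite (_ : b = 0) ?dual0 //; apply/val_inj/ffunP => i.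
  have /ffunP/(_ i) := E; rewrite !ffunE => /esym E'.
  by have [] := tri_direct (am i) (elimT (curP _ _) (subLieP b) i) (cp i) E'.
Qed.
Definition lam := sval (cid lam_exists).

Lemma lamE a b c : a \in cur N gm -> c \in cur N gp -> lam (a + val b + c) = Lambda b.
Proof.
move=> /curP am /curP cp; have [a' [b' [c' [/curP am' /curP cp' E ->]]]] :=
  svalP (cid lam_exists) (a + val b + c).
congr (Lambda _); apply/val_inj/ffunP => i.
have /ffunP/(_ i) := E; rewrite !ffunE => E'.
by have [] := tri_uniq (am i) (elimT (curP _ _) (subLieP b) i) (cp i)
  (am' i) (elimT (curP _ _) (subLieP b') i) (cp' i) E'.
Qed.

Lemma lam_gm a : a \in cur N gm -> lam a = 0.
Proof.
by move=> am; have := lamE 0 am (rpred0 (cur N gp)); rewrite !addr0 dual0.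
Qed.
Lemma lam_gp c : c \in cur N gp -> lam c = 0.
Proof.
by move=> cp; have := lamE 0 (rpred0 (cur N gm)) cp; rewrite addr0 add0r dual0.
Qed.
Lemma lam_h b : lam (val b) = Lambda b.
Proof.
by have := lamE b (rpred0 (cur N gm)) (rpred0 (cur N gp)); rewrite addr0 add0r.
Qed.

Lemma lam_borel (x : subLie bhat) : lam (val x) = borel_char Lambda x.
Proof.
have := lamE (cartan_part x) (rpred0 (cur N gm)) (cartan_partP x).
by rewrite add0r subrKC.
Qed.

Local Notation coord := (lcoord P N).

Lemma coord_ly i : coord (ly i) = mkmalgU i 1.
Proof. by have := lcoord_uniq (mkmalgU i 1) (rpred0 bhat); rewrite mlinU addr0. Qed.

Lemma coord0_borel x : coord x = 0 -> x \in bhat.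
Proof.
move=> x0; have [b bB ->] := lcoordP P x.
by rewrite x0 (raddf0 (mlin _)) add0r.
Qed.
Lemma borel_coord0 x : x \in bhat -> coord x = 0.
Proof.
by move=> xb; have := lcoord_uniq (P := P) 0 xb; rewrite (raddf0 (mlin _)) add0r.
Qed.

Lemma bracket_bhat x y : x \in bhat -> y \in bhat -> [Lie x, y] \in cur N gp.
Proof.
move=> /curP xb /curP yb; apply/curP => m; rewrite ffunE.
by apply: rpred_sum => i _; apply: rpred_sum => j _; exact: bracket_borel.
Qed.

Lemma coord_bracket0 x y : coord x = 0 -> coord y = 0 -> coord [Lie x, y] = 0.
Proof.
move=> /coord0_borel xb /coord0_borel yb; apply: borel_coord0.
exact: lie_closed.
Qed.
Lemma lam_bracket0 x y : coord x = 0 -> coord y = 0 -> lam [Lie x, y] = 0.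
Proof. by move=> /coord0_borel xb /coord0_borel yb; apply/lam_gp/bracket_bhat. Qed.

Lemma lam_ly i : lam (ly (P := P) i) = 0.
Proof. exact/lam_gm/ly_cur. Qed.

Definition vphi : ghat -> endo k letter := pbw_act (@leL _ _ _ P N) (@ly _ _ _ P N) coord lam.

Lemma vphi_morphism : lie_morphism vphi.
Proof.
apply: pbw_act_morphism; [exact: leL_total|exact: leL_trans|exact: leL_anti|..].
- exact: coord_ly.
- exact: lam_ly.
- exact: coord_bracket0.
- exact: lam_bracket0.
Qed.

Lemma vphi_borel (x : subLie bhat) : vphi (val x) (bas [::]) = borel_char Lambda x *: bas [::].
Proof. by rewrite /vphi pbw_act_nil ?lam_borel // borel_coord0 //; exact: subLieP. Qed.

Definition vpi : M -> {malg k[seq letter]} := verma_to vphi (bas [::]).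
HB.instance Definition _ := GRing.isLinear.Build k M {malg k[seq letter]} *:%R vpi
  (verma_to_linear vphi_morphism vphi_borel).

Lemma vpi_gen : vpi gen = bas [::].
Proof. exact: verma_to_gen vphi_morphism vphi_borel. Qed.
Lemma vpi_lact x v : vpi (lact x v) = vphi x (vpi v).
Proof. exact: verma_to_act vphi_morphism vphi_borel x v. Qed.

Definition wact (E : letter -> ghat) (w : seq letter) (v : M) : M :=
  foldr (fun i => lact (E i)) v w.
Local Notation Yw w := (wact (@ly _ _ _ P N) w gen).

Lemma vpi_Yw s : sorted (@leL _ _ _ P N) s -> vpi (Yw s) = bas s.
Proof.
elim: s => [|i s IHs] ss; first exact: vpi_gen.
rewrite /= vpi_lact IHs ?(path_sorted ss) //.
exact: (pbw_act_letter (@leL_total _ _ _ P N) (@leL_trans _ _ _ P N) coord_ly lam_ly ss).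
Qed.

Definition wwt (w : seq letter) : wt := \sum_(i <- w) lroot i.

Definition sorted_acts (E : letter -> ghat) (v : M) (n : nat) (a : wt) : set M :=
  [set x | exists t,
    [/\ sorted (@leL _ _ _ P N) t, (size t <= n)%N, wwt t = a & x = wact E t v]]%classic.

Lemma sorted_actsW E v m n a x : (m <= n)%N ->
  x \in lspan (sorted_acts E v m a) -> x \in lspan (sorted_acts E v n a).
Proof.
move=> mn; apply: lspan_ind => _ [t [ts tm ta ->]].
by apply: lspan_incl; exists t; split=> //; exact: leq_trans mn.
Qed.

Section Straighten.
Variables (E : letter -> ghat) (v : M).
Hypothesis E_bracket : forall i j,
  [Lie E i, E j] \in lspan [set x | exists2 l, lroot l = lroot i + lroot j & x = E l]%classic.

Lemma wwt_cons l t : wwt (l :: t) = lroot l + wwt t.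
Proof. by rewrite /wwt big_cons. Qed.

(** Exchanging two neighbours costs words in which one letter replaces both; they are shorter and
    have the same weight. Leaving E and v general serves the letters y on the highest weight vector
    and the letters z on any vector. *)
Lemma straighten w : wact E w v \in lspan (sorted_acts E v (size w) (wwt w)).
Proof.
have [n] := ubnP (size w); elim: n w => // n IHn [|i w] wn.
  by apply: lspan_incl; exists [::].
have cons_in l m a x : (m.+1 < n)%N -> x \in lspan (sorted_acts E v m a) ->
    lact (E l) x \in lspan (sorted_acts E v m.+1 (lroot l + a)).
  move=> mn; apply: lspan_map => _ [t [ts tm <- ->]]; rewrite -wwt_cons.
  apply: sorted_actsW (IHn (l :: t) _) => //=; exact: leq_ltn_trans mn.
have ins_in s : sorted (@leL _ _ _ P N) s -> (size s < n)%N ->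
    wact E (i :: s) v - wact E (ins (@leL _ _ _ P N) i s) v
      \in lspan (sorted_acts E v (size s) (lroot i + wwt s)).
  elim: s => [|j s IHs] ss sn; first by rewrite subrr rpred0.
  rewrite [ins _ _ _]/=; case: ifP => _; first by rewrite subrr rpred0.
  rewrite [wact E (i :: _) v]/= lact_comm addrAC -raddfB rpredD //.
    rewrite wwt_cons addrCA; apply: cons_in => //; apply: IHs; first exact: path_sorted ss.
    exact: ltnW.
  rewrite -[lact _ _]/(lactr (wact E s v) _).
  apply: lspan_map (E_bracket i j) => _ [l lE ->]; rewrite wwt_cons addrA -lE -wwt_cons.
  exact: (IHn (l :: s)).
have wn' : (size w < n)%N by [].
rewrite wwt_cons; apply: lspan_map (IHn w wn') => _ [t [ts tw <- ->]].
have tn := leq_ltn_trans tw wn'.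
rewrite -[X in X \in _]/(wact E (i :: t) v).
rewrite -(subrK (wact E (ins (@leL _ _ _ P N) i t) v) (wact E (i :: t) v)).
rewrite rpredD //; first exact: sorted_actsW (leqW tw) (ins_in t ts tn).
have pt := perm_ins (@leL _ _ _ P N) i t.
apply: lspan_incl; exists (ins (@leL _ _ _ P N) i t); split=> //.
- by apply: sorted_ins => //; [exact: leL_total|exact: leL_trans].
- by rewrite (perm_size pt).
- by rewrite -wwt_cons /wwt (perm_big _ pt).
Qed.
End Straighten.

Lemma ly_bracket (i j : letter) : [Lie @ly _ _ _ P N i, ly j] \in
  lspan [set x | exists2 l : letter, lroot l = lroot i + lroot j & x = @ly _ _ _ P N l]%classic.
Proof.
have [Yi wi] := gY_ws i; have [Yj wj] := gY_ws j.
rewrite bracket_tp -tri_omega_bracket.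
have w : weight_space gp (lroot i + lroot j) [Lie gY j, gY i].
  by split; [exact: lie_closed | rewrite addrC; exact: bracket_weight].
apply: lspan_ind (ly_span P N (ldeg i + ldeg j) w) => _ [l [rl _ ->]].
by apply: lspan_incl; exists l.
Qed.

Lemma lz_bracket (i j : letter) : [Lie @lz _ _ _ P N i, lz j] \in
  lspan [set x | exists2 l : letter, lroot l = lroot i + lroot j & x = @lz _ _ _ P N l]%classic.
Proof.
have [Xi wi] := gX_ws i; have [Xj wj] := gX_ws j; rewrite bracket_tp.
have w : weight_space gp (lroot i + lroot j) [Lie gX i, gX j].
  by split; [exact: lie_closed | exact: bracket_weight].
apply: lspan_ind (lz_span P N _ w) => _ [l [rl _ ->]].
by apply: lspan_incl; exists l.
Qed.

Lemma borel_gen x : x \in bhat -> lact x gen = (lam x : k) *: gen.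
Proof. by move=> xb; have := verma_gen_weight Lambda (SubLie xb); rewrite -lam_borel. Qed.
Lemma gp_bhat c : c \in cur N gp -> c \in bhat.
Proof. by move=> /curP cp; apply/curP => i; exact: gp_borel. Qed.
Lemma h_bhat b : b \in cur N (tri_h T) -> b \in bhat.
Proof. by move=> /curP bh; apply/curP => i; exact: h_borel. Qed.

Definition all_words : set M := range (fun w => Yw w).

Lemma lact_ly_words (i : letter) v : v \in lspan all_words -> lact (ly i) v \in lspan all_words.
Proof. by apply: lspan_map => _ [w _ <-]; apply: lspan_incl; exists (i :: w). Qed.

Lemma lact_gm_words a v :
  a \in cur N gm -> v \in lspan all_words -> lact a v \in lspan all_words.
Proof.
move=> /(cur_gm_lspan P) + vW; rewrite -[lact a v]/(lactr v a).
by apply: lspan_map => _ [i _ <-]; exact: lact_ly_words.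
Qed.

(** Moving x past y_i produces a bracket about which nothing is known, so the induction on w must
    cover all x at once. *)
Lemma lact_words x w : lact x (Yw w) \in lspan all_words.
Proof.
elim: w x => [|i w IHw] x /=.
  have genW : gen \in lspan all_words by apply: lspan_incl; exists [::].
  have [a [b [c [am bh cp ->]]]] := ghat_split T x.
  rewrite -addrA lactDl rpredD //; first exact: lact_gm_words.
  have bcB : b + c \in bhat by apply: rpredD; [exact: h_bhat | exact: gp_bhat].
  by rewrite borel_gen // rpredZ.
by rewrite lact_comm rpredD // lact_ly_words.
Qed.

Lemma verma_words v : v \in lspan all_words.
Proof.
apply: verma_span => [|x {}v].
  by apply: lspan_incl; exists [::].
by apply: lspan_map => _ [w _ <-]; exact: lact_words.
Qed.

Definition sorted_words : set M :=
  [set x | exists2 t, sorted (@leL _ _ _ P N) t & x = Yw t]%classic.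

Lemma verma_sorted_words v : v \in lspan sorted_words.
Proof.
apply: lspan_ind (verma_words v) => _ [w _ <-].
apply: lspan_ind (straighten _ ly_bracket w) => _ [t [ts _ _ ->]].
by apply: lspan_incl; exists t.
Qed.

(** Sorted words span by straightening and [vpi] sends them to basis vectors, so [vpi] reads
    coordinates in the basis of sorted words. *)
Lemma vpiK v : v = mlin (fun w => Yw w) (vpi v).
Proof.
apply: (lspan_ext (f := idfun) (h := mlin (fun w => Yw w) \o vpi)) (verma_sorted_words v).
by move=> _ [t ts ->] /=; rewrite vpi_Yw // mlinU.
Qed.

Lemma vpi_inj v : vpi v = 0 -> v = 0.
Proof. by move=> v0; rewrite [v]vpiK v0 (raddf0 (mlin _)). Qed.

Lemma vpi_sorted v t : t \in msupp (vpi v) -> sorted (@leL _ _ _ P N) t.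
Proof.
apply: (@lspan_msupp _ _ _ (fun t => sorted (@leL _ _ _ P N) t)).
apply: lspan_map (verma_sorted_words v) => _ [s ss ->].
by rewrite /= vpi_Yw //; apply: lspan_incl; exists s.
Qed.

(** The projection to the highest weight line. Composed with z-words it gives the pairing of words,
    a form of the Shapovalov form. *)
Definition top (v : M) : k^o := mcoef [::] (vpi v).
Lemma top_linear : linear top.
Proof. by move=> c u v; rewrite /top !linearP. Qed.
HB.instance Definition _ := GRing.isLinear.Build k M k^o *:%R top top_linear.

Lemma top_gen : top gen = 1.
Proof. by rewrite /top vpi_gen /mcoef mcoeffUU. Qed.

Lemma top_Yw_sorted t : sorted (@leL _ _ _ P N) t -> t != [::] -> top (Yw t) = 0.
Proof. by move=> ts /negPf t0; rewrite /top vpi_Yw // /mcoef mcoeffU t0. Qed.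

Lemma wwt_eq0 w : wwt w = 0 -> w = [::].
Proof. by move/(roots_sum0 (@lrootP _ _ _ P N)) => /size0nil. Qed.

(** Straightening preserves the weight, and a non-empty word has non-zero weight, so the empty word
    never appears. *)
Lemma top_Yw w : w != [::] -> top (Yw w) = 0.
Proof.
move=> w0; apply: (lspan_ker (f := top)) (straighten _ ly_bracket w).
move=> _ [t [ts _ tw ->]]; apply: top_Yw_sorted => //.
by apply: contra_neq w0 => t0; apply: wwt_eq0; rewrite -tw t0 /wwt big_nil.
Qed.

Lemma top_gm a v : a \in cur N gm -> top (lact a v) = 0.
Proof.
move=> am; apply: (lspan_ker (f := top \o lact a)) (verma_words v) => _ [w _ <-] /=.
rewrite -[lact _ _]/(lactr (Yw w) a).
apply: (lspan_ker (f := top \o lactr (Yw w))) (cur_gm_lspan P am) => _ [i _ <-].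
exact: (top_Yw (w := i :: w)).
Qed.

Lemma cur_bracket_h_gm b a : b \in cur N (tri_h T) -> a \in cur N gm -> [Lie b, a] \in cur N gm.
Proof.
move=> /curP bh /curP am; apply/curP => m; rewrite ffunE.
by apply: rpred_sum => i _; apply: rpred_sum => j _; exact: bracket_h_gm.
Qed.

Lemma top_h b v : b \in cur N (tri_h T) -> top (lact b v) = lam b * top v.
Proof.
move=> bh.
apply: (lspan_ext (f := top \o lact b) (h := lam b \*: top)) (verma_words v) => _ [w _ <-] /=.
case: w => [|i w] /=; first by rewrite borel_gen ?h_bhat // linearZ_LR.
rewrite lact_comm raddfD /= !top_gm ?ly_cur ?cur_bracket_h_gm ?ly_cur //.
by rewrite scaler0 addr0.
Qed.

End VermaBasis.

(** * The filtration by degree *)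

Section Filtration.
Variables (k : fieldType) (g : lieAlgType k) (T : triangular g).
Variables (P : nondegenerate_pairing T) (N : nat).
Variable Lambda : dual (subLie (cur N (tri_h T))).
Local Notation gp := (tri_gp T).
Local Notation gm := (tri_gm T).
Local Notation omega := (tri_omega T).
Local Notation ghat := (current N g).
Local Notation letter := (letter P N).
Local Notation M := (verma Lambda).
Local Notation gen := (verma_gen Lambda).
Local Notation lam := (lam Lambda).
Local Notation leL := (@leL _ _ _ P N).
Local Notation Yw w := (wact (@ly _ _ _ P N) w gen).

Definition psi (i : letter) : int := N%:Z - 2 * (ldeg i : nat)%:Z.
Definition Psi (w : seq letter) : int := \sum_(i <- w) psi i.

Lemma Psi_cons i w : Psi (i :: w) = psi i + Psi w.
Proof. by rewrite /Psi big_cons. Qed.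

Lemma ldeg_le (i : letter) : (ldeg i <= N)%N.
Proof. exact: leq_ord. Qed.

Definition filt (f : int) : set M := [set v | exists2 w, Psi w <= f & v = Yw w]%classic.
Local Notation F f := (lspan (filt f)).

Lemma filt_Yw w f : Psi w <= f -> Yw w \in F f.
Proof. by move=> wf; apply: lspan_incl; exists w. Qed.

Lemma filtW f f' v : f <= f' -> v \in F f -> v \in F f'.
Proof. by move=> ff'; apply: lspan_ind => _ [w wf ->]; apply: filt_Yw; lia. Qed.

Lemma filt_map (x : ghat) (e : int) : (forall w, lact x (Yw w) \in F (Psi w + e)) ->
  forall f v, v \in F f -> lact x v \in F (f + e).
Proof.
move=> xw f v; apply: lspan_map => _ [w wf ->].
by apply: filtW (xw w); lia.
Qed.

Lemma filt_ly i f v : v \in F f -> lact (ly i) v \in F (f + psi i).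
Proof.
by apply: filt_map => w; apply: (@filt_Yw (i :: w)); rewrite Psi_cons addrC.
Qed.

Lemma filt_gm d a f v : a \in gm -> v \in F f ->
  lact (tp N d a) v \in F (f + (N%:Z - 2 * d%:Z)).
Proof.
move=> am; apply: filt_map => w; rewrite -[lact _ _]/(lactr (Yw w) _).
apply: lspan_map (gm_span P N d am) => _ [i di ->]; rewrite -di.
by apply: filt_ly; exact: filt_Yw.
Qed.

Lemma tp_cur (S : lieClosed g) d x : x \in S -> tp N d x \in cur N S.
Proof. by move=> xS; apply/curP => i; rewrite ffunE; case: ifP => _ //; exact: rpred0. Qed.

(** Each commutator with a letter of w raises an exponent by d and so lowers the degree by 2d; what
    is left is the scalar by which b t^d acts on the highest weight vector. *)
Lemma filt_h_sub d b w : b \in tri_h T ->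
  lact (tp N d b) (Yw w) - (lam (tp N d b) : k) *: Yw w \in F (Psi w - 2 * d%:Z).
Proof.
move=> bh; elim: w => [|i w IHw] /=.
  by rewrite borel_gen ?subrr ?rpred0 //; apply/h_bhat/tp_cur.
rewrite lact_comm -linearZ_LR addrAC -raddfB /= rpredD //.
  by apply: filtW (filt_ly i IHw); rewrite Psi_cons; lia.
rewrite /ly bracket_tp; have [Yp _] := gY_ws i.
apply: filtW (filt_gm _ (bracket_h_gm bh (omega_gp Yp)) (filt_Yw (lexx (Psi w)))).
by rewrite Psi_cons /psi; lia.
Qed.

Lemma filt_h d b f v : b \in tri_h T -> v \in F f -> lact (tp N d b) v \in F f.
Proof.
move=> bh vF; rewrite -[f]addr0; apply: filt_map vF => w; rewrite addr0.
rewrite -(subrK ((lam (tp N d b) : k) *: Yw w) (lact _ _)) rpredD ?rpredZ ?filt_Yw //.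
by apply: filtW (filt_h_sub d w bh); lia.
Qed.

(** In the commutator with y_i the components in g_- and g_+ are below the bound by N. The Cartan
    component preserves the degree, while the bound allows an increase by twice N - d - ldeg i; if
    this is negative, the component is 0. *)
Lemma filt_gp d c f v : c \in gp -> v \in F f ->
  lact (tp N d c) v \in F (f + (N%:Z - 2 * d%:Z)).
Proof.
move=> cp; apply: filt_map => w; elim: w d c cp => [|i w IHw] d c cp /=.
  rewrite borel_gen; last exact/gp_bhat/tp_cur.
  by rewrite lam_gp ?scale0r ?rpred0 //; exact: tp_cur.
rewrite lact_comm rpredD //.
  by apply: filtW (filt_ly i (IHw d c cp)); rewrite Psi_cons; lia.
have [a [b [c' [am bh cp' E]]]] := tri_sum T [Lie c, omega (gY i)].
rewrite /ly bracket_tp E !raddfD /= !lactDl rpredD ?rpredD //.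
- apply: filtW (filt_gm _ am (filt_Yw (lexx (Psi w)))).
  by rewrite Psi_cons /psi; lia.
- have [Nd|dN] := ltnP N (d + ldeg i).
    by rewrite tp_gt // -[lact _ _]/(lactr (Yw w) 0) raddf0 rpred0.
  apply: filtW (filt_h (d + ldeg i) bh (filt_Yw (lexx (Psi w)))).
  by rewrite Psi_cons /psi; lia.
- apply: filtW (IHw _ _ cp').
  by rewrite Psi_cons /psi; lia.
Qed.

Lemma filt_lz i f v : v \in F f -> lact (lz i) v \in F (f - psi i).
Proof.
move=> vF; have [Xp _] := gX_ws i; apply: filtW (filt_gp (N - ldeg i) Xp vF).
by have := ldeg_le i; rewrite /psi; lia.
Qed.

Definition cval (i : letter) : k := top_part Lambda (hvec P (lroot i)).

Lemma lam_top (b : subLie (tri_h T)) : lam (tp N N (val b)) = top_part Lambda b.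
Proof.
apply: (etrans _ (lam_h Lambda (sub_tpow ord_max b))); congr (lam _).
Qed.

Hypothesis N_gt0 : (0 < N)%N.

Lemma lz_lead i w : sorted leL w ->
  lact (lz i) (Yw w) - (cval i * (count_mem i w)%:R) *: Yw (rem i w)
    \in F (Psi w - psi i - 1).
Proof.
have [Xp _] := gX_ws i; elim: w => [|j w IHw] js.
  rewrite /= mulr0 scale0r subr0 borel_gen; last exact/gp_bhat/tp_cur.
  by rewrite lam_gp ?scale0r ?rpred0 //; exact: tp_cur.
have ws := path_sorted js.
have br : lact [Lie lz i, ly j] (Yw w) - (if i == j then cval i else 0) *: Yw w
    \in F (Psi (j :: w) - psi i - 1).
  have [a [c [am cp E]]] := bracket_XY i j; rewrite bracket_tp E !raddfD /= !lactDl.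
  rewrite [X in X \in _](ACl ((1*3)*(2*4))) /= rpredD //.
    rewrite rpredD //.
      (* The components outside the Cartan part lose N against the expected degree, which is a
         strict loss because N > 0. *)
      apply: filtW (filt_gm _ am (filt_Yw (lexx (Psi w)))).
      by have := ldeg_le i; rewrite Psi_cons /psi; lia.
    apply: filtW (filt_gp _ cp (filt_Yw (lexx (Psi w)))).
    by have := ldeg_le i; rewrite Psi_cons /psi; lia.
  (* The expected shift psi j - psi i is 2 (ldeg i - ldeg j). If it is positive, a Cartan element
     stays below it; if negative, the exponent exceeds N; if zero, the exponent is N and
     [filt_h_sub] gives the scalar. *)
  have [di|di|di] := ltngtP (ldeg j) (ldeg i).
  - have -> : (i == j) = false by apply/eqP => ij; move: di; rewrite ij ltnn.
    rewrite scale0r subr0; case: ifP => _; last first.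
      by rewrite raddf0 -[lact _ _]/(lactr (Yw w) 0) raddf0 rpred0.
    apply: filtW (filt_h _ (subLieP _) (filt_Yw (lexx (Psi w)))).
    by have := ldeg_le i; rewrite Psi_cons /psi; lia.
  - have -> : (i == j) = false by apply/eqP => ij; move: di; rewrite ij ltnn.
    rewrite scale0r subr0 tp_gt; last by have := ldeg_le i; lia.
    by rewrite -[lact _ _]/(lactr (Yw w) 0) raddf0 rpred0.
  have -> : (i == j) = (lroot i == lroot j) && (lnum i == lnum j).
    apply/eqP/andP => [-> //|[/eqP ri /eqP ni]]; apply: letter_inj => //.
    exact/esym/val_inj.
  have -> : (N - ldeg i + ldeg j = N)%N by have := ldeg_le i; lia.
  case: ifP => _; last first.
    by rewrite raddf0 -[lact _ _]/(lactr (Yw w) 0) raddf0 scale0r subr0 rpred0.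
  rewrite /cval -lam_top.
  apply: filtW (filt_h_sub N w (subLieP _)).
  by have := ldeg_le i; rewrite Psi_cons /psi; lia.
have lead : lact (ly j) (lact (lz i) (Yw w)) -
    lact (ly j) ((cval i * (count_mem i w)%:R) *: Yw (rem i w)) \in F (Psi (j :: w) - psi i - 1).
  by rewrite -raddfB; apply: filtW (filt_ly j (IHw ws)); rewrite Psi_cons; lia.
rewrite [Yw (j :: w)]/= lact_comm.
have -> : (cval i * (count_mem i (j :: w))%:R) *: Yw (rem i (j :: w)) =
    lact (ly j) ((cval i * (count_mem i w)%:R) *: Yw (rem i w)) +
      (if i == j then cval i else 0) *: Yw w.
  rewrite linearZ_LR /=; have [ij|ne_ij] := eqVneq i j; last first.
    by rewrite /= add0n scale0r addr0.
  rewrite -ij /=; have -> : ((true : nat) + count_mem i w)%N = (count_mem i w).+1 by [].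
  have -> : cval i * (count_mem i w).+1%:R = cval i * (count_mem i w)%:R + cval i.
    by rewrite -natr1 mulrDr mulr1.
  apply: (etrans (scalerDl _ _ _)); apply: (congr1 (fun z => z + cval i *: Yw w)).
  (* In the sorted word i :: w all copies of i come first, so i :: rem i w is w itself and not
     merely a rearrangement of it. *)
  have [iw|iw] := boolP (i \in w); last by have -> := count_memPn iw; rewrite mulr0 !scale0r.
  congr (_ *: _); case: w js iw {IHw ws br lead} => // l w /=; rewrite -ij => /andP[il lw].
  rewrite inE eq_sym; case: eqP => [-> //|ne_li] /= iw.
  case: ne_li; apply: leL_anti; rewrite il andbT.
  by move: lw; rewrite path_sortedE; [move=> /andP[/allP/(_ _ iw)] | exact: leL_trans].
by rewrite opprD addrACA rpredD.
Qed.
End Filtration.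

(** * The pairing of words *)

Section Shapovalov.
Variables (k : fieldType) (g : lieAlgType k) (T : triangular g).
Variables (P : nondegenerate_pairing T) (N : nat).
Variable Lambda : dual (subLie (cur N (tri_h T))).
Local Notation wt := (dual (subLie (tri_h0 T))).
Local Notation gp := (tri_gp T).
Local Notation ghat := (current N g).
Local Notation letter := (letter P N).
Local Notation M := (verma Lambda).
Local Notation gen := (verma_gen Lambda).
Local Notation lam := (lam Lambda).
Local Notation leL := (@leL _ _ _ P N).
Local Notation Yw w := (wact (@ly _ _ _ P N) w gen).
Local Notation zact := (wact (@lz _ _ _ P N)).
Local Notation F f := (lspan (@filt _ _ _ P N Lambda f)).
Local Notation top := (@top _ _ _ P N Lambda).
Local Notation vpi := (@vpi _ _ _ P N Lambda).
Local Notation cval := (@cval _ _ _ P N Lambda).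

(** Only the empty word is seen by [top], and it has degree 0. *)
Lemma top_filt f v : f < 0 -> v \in F f -> top v = 0.
Proof.
move=> f0; apply: (lspan_ker (f := top)) => _ [w wf ->].
apply: top_Yw; apply/eqP => w0; move: wf; rewrite w0 /Psi big_nil; lia.
Qed.

Lemma filt_zact t f v : v \in F f -> zact t v \in F (f - Psi t).
Proof.
move=> vF; elim: t => [|i t IHt] /=; first by rewrite /Psi big_nil subr0.
by apply: filtW (filt_lz i IHt); rewrite Psi_cons; lia.
Qed.

Lemma zact_linear (E : letter -> ghat) t : linear (@wact _ _ _ _ _ Lambda E t).
Proof.
elim: t => [|i t IHt] c u v //=.
by rewrite IHt linearP.
Qed.
HB.instance Definition _ E t := GRing.isLinear.Build k M M *:%R
  (@wact _ _ _ _ _ Lambda E t) (zact_linear E t).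

Lemma wact_rcons (E : letter -> ghat) t i (v : M) : wact E (rcons t i) v = wact E t (lact (E i) v).
Proof. by rewrite /wact foldr_rcons. Qed.

Lemma Psi_perm s t : perm_eq s t -> Psi (P := P) (N := N) s = Psi t.
Proof. exact: perm_big. Qed.

(** The error term of [lz_lead] ends in negative degree, where [top] vanishes, so the letters of t
    act as derivations. When t is a rearrangement of w, n is the product of the factorials of the
    multiplicities; keeping it a natural number defers the use of the characteristic. *)
Lemma top_zact t w : (0 < N)%N -> sorted leL w -> Psi w = Psi t ->
  exists2 n : nat, top (zact t (Yw w)) = (\prod_(i <- t) cval i) * n%:R
    & (n != 0%N) = perm_eq t w.
Proof.
move=> N_gt0; elim/last_ind: t w => [|t i IHt] w ws wt_.
  exists (w == [::]); last first.
    by case: w {ws wt_} => [|j w] //=; rewrite perm_sym; apply/esym/negP => /perm_nilP.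
  rewrite big_nil mul1r; have [->|w0] := eqVneq w [::]; first exact: top_gen.
  exact: top_Yw.
have Pt : Psi (rcons t i) = psi i + Psi t.
  by rewrite -cats1 /Psi big_cat big_seq1 addrC.
have vF := filt_zact t (lz_lead Lambda N_gt0 i ws).
have lt0 : Psi w - psi i - 1 - Psi t < 0 by rewrite wt_ Pt; lia.
have /eqP := top_filt lt0 vF; rewrite raddfB raddfB /= subr_eq0 => /eqP top_eq.
rewrite wact_rcons top_eq linearZ_LR linearZ_LR /=.
have prodE : \prod_(j <- rcons t i) cval j = (\prod_(j <- t) cval j) * cval i.
  by rewrite -cats1 big_cat big_seq1.
have [iw|iw] := boolP (i \in w); last first.
  exists 0%N; first by rewrite (count_memPn iw) mulr0 scale0r mulr0.
  apply/esym/negP => /perm_mem/(_ i); rewrite mem_rcons mem_head => /esym.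
  by rewrite (negPf iw).
have pw := perm_to_rem iw.
have [||n nE np] := IHt (rem i w).
- by apply: subseq_sorted ws; [exact: leL_trans | exact: rem_subseq].
- by move: wt_; rewrite (Psi_perm pw) Psi_cons Pt => /addrI.
exists (count_mem i w * n)%N.
  have mE (a b p q : k) : a * b * (p * q) = p * a * (b * q).
    by rewrite mulrACA [a * p]mulrC.
  by rewrite nE prodE natrM; exact: mE.
rewrite muln_eq0 negb_or -lt0n -has_count has_pred1 iw np.
rewrite (permPr pw) -cats1 perm_catC perm_cons //.
Qed.

Definition h0t (t : subLie (tri_h0 T)) : ghat := tp N 0 (val t).
Definition hweight (eta : wt) (v : M) : Prop :=
  forall t, lact (h0t t) v = (eta t : k) *: v.

Lemma gen_weight : hweight (restrict_h0 Lambda) gen.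
Proof.
move=> t; rewrite borel_gen; last exact/h_bhat/tp_cur/sub_h0.
apply: (congr1 (fun c : k => c *: gen)).
exact: (lam_h Lambda (sub_tpow ord0 (inclusion (@tri_h0_sub _ _ T) t))).
Qed.

Lemma lact_weight x v (beta eta : wt) : (forall t, [Lie h0t t, x] = (beta t : k) *: x) ->
  hweight eta v -> hweight (eta + beta) (lact x v).
Proof.
move=> xw vw t; rewrite lact_comm vw xw lactZl linearZ_LR -scalerDl.
by [].
Qed.

Lemma ly_weight (i : letter) t : [Lie h0t t, ly i] = ((- lroot i) t : k) *: ly i.
Proof.
rewrite /h0t bracket_tp add0n (omega_weight (gY_ws i).2); exact: linearZ_LR.
Qed.
Lemma lz_weight (i : letter) t : [Lie h0t t, lz i] = (lroot i t : k) *: lz i.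
Proof. rewrite /h0t bracket_tp add0n (gX_ws i).2; exact: linearZ_LR. Qed.

Lemma Yw_weight w : hweight (restrict_h0 Lambda - wwt w) (Yw w).
Proof.
elim: w => [|i w IHw]; first by rewrite /wwt big_nil subr0; exact: gen_weight.
by rewrite wwt_cons opprD addrCA addrC; apply: lact_weight IHw => t; exact: ly_weight.
Qed.

Lemma zact_weight eta v t : hweight eta v -> hweight (eta + wwt t) (zact t v).
Proof.
move=> vw; elim: t => [|i t IHt]; first by rewrite /wwt big_nil addr0.
by rewrite wwt_cons addrCA addrC; apply: lact_weight IHt => x; exact: lz_weight.
Qed.

Lemma mcoef_lact s t v : mcoef s (vpi (lact (h0t t) v)) =
  (restrict_h0 Lambda - wwt s) t * mcoef s (vpi v).
Proof.
apply: (lspan_ext (f := mcoef s \o vpi \o lact (h0t t))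
  (h := ((restrict_h0 Lambda - wwt s) t : k) \*: (mcoef s \o vpi)))
  (verma_sorted_words P v) => _ [w ws ->] /=.
rewrite Yw_weight linearZ_LR linearZ_LR /= vpi_Yw //.
have [->//|ne_sw] := eqVneq w s.
by rewrite /mcoef mcoeffU (negPf ne_sw) !scaler0.
Qed.

Lemma weight_support eta v s : hweight eta v -> s \in msupp (vpi v) ->
  restrict_h0 Lambda - wwt s = eta.
Proof.
move=> vw; rewrite -mcoeff_neq0 => s0; apply: weight_inj => t.
have := mcoef_lact s t v; rewrite vw linearZ_LR linearZ_LR /=.
by move=> /esym /(mulIf s0).
Qed.

Lemma weight_wwt chi v s : hweight (restrict_h0 Lambda - chi) v ->
  s \in msupp (vpi v) -> wwt s = chi.
Proof. by move=> vw /(weight_support vw)/addrI/oppr_inj. Qed.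

Lemma top_support v : top v != 0 -> [::] \in msupp (vpi v).
Proof. by rewrite -mcoeff_neq0. Qed.

(** The radical of the pairing. Letting t range over unsorted words makes stability under the
    letters z immediate. *)
Definition radical : set M := [set v | forall t, top (zact t v) = 0].

Lemma cur_gp_lspan (c : ghat) : c \in cur N gp -> c \in lspan (range (@lz _ _ _ P N)).
Proof.
move=> /curP cp; rewrite [c]tp_sum rpred_sum // => d _.
apply: lspan_ind (gp_span P N d (cp d)) => _ [i _ ->].
by apply: lspan_incl; exists i.
Qed.

Lemma radical_lz (i : letter) v : radical v -> radical (lact (lz i) v).
Proof. by move=> vK t; rewrite -wact_rcons; exact: vK. Qed.

(** The z-letter that acts first is moved past x, which leaves x on z_i v and a bracket on v, both
    covered by induction on the z-word. For the empty word, [top] kills the g_- part of x, sees the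
    Cartan part as a scalar, and the g_+ part is a combination of letters z. *)
Lemma radical_lact x v : radical v -> radical (lact x v).
Proof.
move=> vK t; elim/last_ind: t v vK x => [|t i IHt] v vK x; last first.
  rewrite wact_rcons lact_comm raddfD raddfD /= !IHt ?addr0 //.
  exact: radical_lz.
have [a [b [c [am bh cp ->]]]] := ghat_split T x.
rewrite /= !lactDl !raddfD /= top_gm // top_h // (vK [::]) mulr0 !add0r.
rewrite -[lact c v]/(lactr v c).
apply: (lspan_ker (f := top \o lactr v)) (cur_gp_lspan cp) => _ [i _ <-].
exact: (vK [:: i]).
Qed.

Lemma radical_submodule : is_submodule radical.
Proof.
apply: is_submodule_act => [t|c v w vK wK t|x v vK].
- by rewrite !raddf0.
- by rewrite !linearP /= vK wK scaler0 addr0.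
- exact: radical_lact.
Qed.

Lemma radical_gen : ~ radical gen.
Proof. by move=> /(_ [::]) /= /eqP; rewrite top_gen oner_eq0. Qed.

Lemma submodule_gen_is (v : M) : is_submodule (submodule_gen v).
Proof.
apply: is_submodule_act => [|c u w [a ->] [b ->]|x u [a ->]].
- exists (-1 *: 1 + 1); rewrite verma_actD verma_act1.
  by rewrite scaleN1r addNr.
- by exists (c *: a + b); rewrite verma_actD.
- by exists (env_in x * a); rewrite verma_actM.
Qed.

Lemma submodule_gen_self (v : M) : submodule_gen v v.
Proof. by exists 1; rewrite verma_act1. Qed.

Lemma submodule_gen_full (S : set M) : is_submodule S -> S gen -> forall v, S v.
Proof. by move=> [_ _ SA] Sg v; have [u ->] := verma_cyclic v; exact: SA. Qed.

End Shapovalov.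

(** * Primitive vectors *)

Fixpoint words_upto (E : Type) (l : seq E) (n : nat) : seq (seq E) :=
  if n is n'.+1 then [::] :: [seq i :: w | i <- l, w <- words_upto l n'] else [:: [::]].

Lemma mem_words_upto (E : eqType) (l : seq E) n w :
  (size w <= n)%N -> {subset w <= l} -> w \in words_upto l n.
Proof.
elim: n w => [|n IHn] [|i w] //= wn wl; rewrite inE /=.
apply: allpairs_f; first by apply: wl; rewrite mem_head.
by apply: IHn => // j jw; apply: wl; rewrite inE jw orbT.
Qed.

Lemma seq_argmax (E : eqType) (f : E -> int) (s : seq E) :
  s != [::] -> exists2 x, x \in s & forall y, y \in s -> f y <= f x.
Proof.
elim: s => // a [|b s] IHs _.
  by exists a; rewrite ?mem_head // => y; rewrite mem_seq1 => /eqP ->.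
have [//|x xs xmax] := IHs; have [xa|ax] := leP (f x) (f a).
  exists a; rewrite ?mem_head // => y; rewrite inE => /predU1P[-> //|/xmax yx].
  exact: le_trans xa.
exists x; first by rewrite inE xs orbT.
by move=> y; rewrite inE => /predU1P[->|/xmax //]; exact: ltW.
Qed.

Lemma scale_solve (k : fieldType) (V : lmodType k) (c : k) (x y : V) :
  c != 0 -> x = c *: y -> y = c^-1 *: x.
Proof. by move=> c0 ->; rewrite scalerA mulVf // scale1r. Qed.

Section Main.
Variables (k : fieldType) (g : lieAlgType k) (T : triangular g).
Variables (P : nondegenerate_pairing T) (N : nat).
Variable Lambda : dual (subLie (cur N (tri_h T))).
Local Notation letter := (letter P N).
Local Notation M := (verma Lambda).
Local Notation gen := (verma_gen Lambda).
Local Notation lam := (lam Lambda).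
Local Notation leL := (@leL _ _ _ P N).
Local Notation Yw w := (wact (@ly _ _ _ P N) w gen).
Local Notation zact := (wact (@lz _ _ _ P N)).
Local Notation top := (@top _ _ _ P N Lambda).
Local Notation vpi := (@vpi _ _ _ P N Lambda).
Local Notation cval := (@cval _ _ _ P N Lambda).

Lemma letter_of_root a : Delta_plus T a -> exists i : letter, lroot i = a.
Proof.
move=> aD; have [x xw x0] := aD; have [_ /(_ x xw) xE _] := root_basisP P aD.
have dim_gt0 : (0 < rdim P a)%N.
  by rewrite lt0n; apply: contra_neq x0 => d0; move: xE; rewrite d0 big_ord0.
by have [i [ri _ _]] := letter_exists (ord0 : 'I_N.+1) aD dim_gt0; exists i.
Qed.

Lemma word_of_Qplus chi : Qplus T chi -> exists w : seq letter, wwt w = chi.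
Proof.
move=> [s [sD ->]]; elim: s sD => [|a s IHs] sD; first by exists [::]; rewrite /wwt !big_nil.
have [|w wE] := IHs; first by move=> b bs; apply: sD; rewrite inE bs orbT.
have [i iE] := letter_of_root (sD a (mem_head _ _)).
by exists (i :: w); rewrite wwt_cons big_cons iE wE.
Qed.

Lemma wwt_Qplus (w : seq letter) : Qplus T (wwt w).
Proof. exact: Qplus_sum_roots (@lrootP _ _ _ P N). Qed.

Lemma wwt_perm (s t : seq letter) : perm_eq s t -> wwt s = wwt t.
Proof. exact: perm_big. Qed.

Lemma wwt_sub_letter (w : seq letter) i : i \in w -> Qplus T (wwt w - lroot i).
Proof.
move=> /perm_to_rem/wwt_perm ->; rewrite wwt_cons [_ + _ - _]addrAC subrr add0r.
exact: wwt_Qplus.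
Qed.

Lemma letters_finite chi : Qplus T chi ->
  exists l : seq letter, forall i, Qplus T (chi - lroot i) -> i \in l.
Proof.
move=> chiQ; have [n [a [mu [muE muD _]]]] := Qplus_coords T.
(* If chi minus a root is in Q_+, the coordinates of the root are at most the height B of chi, so
   the root lies in the finite box R. Triples over R that are not letters are dropped by [insub]. *)
pose B := (\sum_i mu chi i)%N.
pose R := [seq \sum_j a j *+ (f j : 'I_B.+1) | f : {ffun 'I_n -> 'I_B.+1}].
pose C := flatten [seq [seq (b, r, d) | r <- iota 0 (rdim P b), d <- enum 'I_N.+1] | b <- R].
exists (pmap insub C) => i iQ; rewrite mem_pmap_sub; apply/flatten_mapP.
have iD := lrootP i; have i_chi j : (mu (lroot i) j <= B)%N.
  have := muD _ _ iQ (Qplus_root iD) j; rewrite subrK => E.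
  by rewrite /B (bigD1 j) //= E; lia.
exists (lroot i).
  apply/mapP; exists [ffun j => inord (mu (lroot i) j)]; first by rewrite mem_enum.
  rewrite {1}(muE _ (Qplus_root iD)); apply: eq_bigr => j _.
  by rewrite ffunE inordK // ltnS.
apply/allpairsP; exists (lnum i, ldeg i); split=> /=.
- by rewrite mem_iota add0n lnumP.
- by rewrite mem_enum.
- by rewrite /lroot /lnum /ldeg -!surjective_pairing.
Qed.

(** Each letter adds at least 1 to the height. *)
Lemma size_bound chi : Qplus T chi ->
  exists n, forall w : seq letter, wwt w = chi -> (size w <= n)%N.
Proof.
move=> chiQ; have [n [a [mu [_ muD mu_gt0]]]] := Qplus_coords T.
exists (\sum_i mu chi i)%N => w <-; elim: w => //= i w IHw.
rewrite wwt_cons; have iD := lrootP i.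
under eq_bigr do rewrite (muD _ _ (Qplus_root iD) (wwt_Qplus w)).
by rewrite big_split /= -add1n leq_add // mu_gt0.
Qed.

Lemma words_finite chi : Qplus T chi -> exists L : seq (seq letter), uniq L /\
  forall w, w \in L <-> sorted leL w /\ wwt w = chi.
Proof.
move=> chiQ; have [l lP] := letters_finite chiQ; have [n nP] := size_bound chiQ.
exists (undup [seq w <- words_upto l n | sorted leL w && (wwt w == chi)]).
split=> [|w]; first exact: undup_uniq.
rewrite mem_undup mem_filter; split=> [/andP[/andP[-> /eqP //]]|[-> wE]].
rewrite wE eqxx mem_words_upto ?nP // => i iw; apply: lP.
by rewrite -wE; exact: wwt_sub_letter.
Qed.

Lemma top_zact_lt t w : Psi w < Psi t -> top (zact t (Yw w)) = 0.
Proof.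
move=> wt_; apply: (top_filt _ (filt_zact t (filt_Yw Lambda (lexx (Psi w))))).
by rewrite subr_lt0.
Qed.

Hypothesis N_gt0 : (0 < N)%N.

Lemma radical_exists chi alpha : Qplus T chi -> Delta_plus T alpha ->
  Qplus T (chi - alpha) -> top_part Lambda (hvec P alpha) = 0 ->
  exists v : M, [/\ v != 0, hweight (restrict_h0 Lambda - chi) v & radical P v].
Proof.
move=> chiQ aD chiaQ ha0; have [i iE] := letter_of_root aD.
have [w wE] := word_of_Qplus chiaQ; pose t := sort leL (i :: w).
have pt : perm_eq t (i :: w) by rewrite /t perm_sort.
have tE : wwt t = chi by rewrite (wwt_perm pt) wwt_cons wE iE subrKC.
have ts : sorted leL t := sort_sorted (@leL_total _ _ _ P N) _.
have c0 : \prod_(j <- t) cval j = 0.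
  have ci : cval i = 0 by rewrite -ha0 -iE.
  rewrite (perm_big _ pt) big_cons ci; exact: mul0r.
have [L [uL LP]] := words_finite chiQ.
(* Cutting off at the degree of t keeps the matrix square, while z-words of larger degree annihilate
   the chosen y-words under [top] in any case. *)
pose L' := [seq w <- L | Psi w <= Psi t]; pose m := size L'.
have L'P j : (j < m)%N -> [/\ sorted leL (nth [::] L' j), wwt (nth [::] L' j) = chi
    & Psi (nth [::] L' j) <= Psi t].
  by move=> /(mem_nth [::]); rewrite mem_filter => /andP[-> /LP[]].
have tL' : t \in L' by rewrite mem_filter lexx; apply/LP.
have uL' : uniq L' by rewrite filter_uniq.
pose A := \matrix_(j < m, l < m) (top (zact (nth [::] L' l) (Yw (nth [::] L' j))) : k).
have tm : (index t L' < m)%N by rewrite index_mem.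
have detA : \det A = 0.
  (* The column of t is zero: y-words of smaller degree pair to 0 with it, and those of equal degree
     pair to a multiple of the vanishing product of the [cval j]. *)
  rewrite (expand_det_col _ (Ordinal tm)) big1 // => j _; rewrite mxE /= nth_index //.
  have [js jw jP] := L'P j (ltn_ord j).
  have [jt|tj] := eqVneq (Psi (nth [::] L' j)) (Psi t); last first.
    by rewrite top_zact_lt ?mul0r // lt_neqAle tj.
  by have [n -> _] := top_zact Lambda N_gt0 js jt; rewrite c0 !mul0r.
have /det0P[u u0 uA] : \det A == 0 by rewrite detA.
pose v := \sum_(j < m) u ord0 j *: Yw (nth [::] L' j).
have vw : hweight (restrict_h0 Lambda - chi) v.
  move=> x; have [f fE] : exists f : {linear M -> M}, forall y : M, f y = lact (h0t N x) y.
    by exists (lact (h0t N x)).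
  rewrite -fE /v linear_sum scaler_sumr; apply: eq_bigr => j _.
  rewrite linearZ_LR fE; have [_ jw _] := L'P j (ltn_ord j).
  by rewrite Yw_weight jw !scalerA mulrC.
(* Rewriting with vpi itself would make unification unfold its definition, hence
   the abstract f here and below. *)
have coefv (j : 'I_m) : mcoef (nth [::] L' j) (vpi v) = u ord0 j.
  have [f fE] : exists f : {linear M -> k^o}, forall x, f x = mcoef (nth [::] L' j) (vpi x).
    by exists (mcoef (nth [::] L' j) \o vpi).
  rewrite -fE /v linear_sum (bigD1 j) //= big1 => [|l ne_l].
    have [js _ _] := L'P j (ltn_ord j).
    by rewrite addr0 linearZ_LR fE vpi_Yw // /mcoef mcoeffUU -[LHS]/(_ * _) mulr1.
  have [ls _ _] := L'P l (ltn_ord l).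
  rewrite linearZ_LR fE vpi_Yw // /mcoef mcoeffU.
  by rewrite nth_uniq // (negPf ne_l : (val l == val j) = false) scaler0.
exists v; split=> //.
  apply: contra_neq u0 => v0; apply/rowP => j; rewrite mxE -coefv v0.
  by rewrite !raddf0.
have vtop s : top (zact s v) = \sum_(j < m) u ord0 j * top (zact s (Yw (nth [::] L' j))).
  have [f fE] : exists f : {linear M -> k^o}, forall x, f x = top (zact s x).
    by exists (top \o zact s).
  by rewrite -fE /v linear_sum; apply: eq_bigr => j _; rewrite linearZ_LR fE.
(* It suffices to test v against sorted z-words r, and a non-zero value forces r to have weight
   chi. *)
move=> s; have zS := straighten v (@lz_bracket _ _ _ P N) s.
have [f fE] : exists f : {linear M -> k^o}, forall x, f x = top x by exists top.
rewrite -fE; apply: (lspan_ker (f := f) _ zS) => _ [r [rs _ _ ->]].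
rewrite fE; apply/eqP/negPn/negP => rtop.
have rw : wwt r = chi.
  have := weight_wwt (chi := chi - wwt r) _ (top_support rtop); rewrite /wwt big_nil.
  rewrite opprB addrCA addrC; move=> /(_ (zact_weight r vw))/esym/eqP.
  by rewrite subr_eq0 => /eqP.
case/negP: rtop; have [rL|rL] := boolP (r \in L').
  have rm : (index r L' < m)%N by rewrite index_mem.
  have /rowP/(_ (Ordinal rm)) := uA; rewrite !mxE => E; rewrite vtop -[X in _ == X]E.
  by apply/eqP/eq_bigr => j _; rewrite mxE /= nth_index.
(* Outside [L'] the degree of r exceeds that of t, hence that of every y-word in v. *)
rewrite vtop big1 // => j _; have [_ _ jP] := L'P j (ltn_ord j).
rewrite top_zact_lt ?mulr0 //; apply: le_lt_trans jP _.
rewrite ltNge; apply: contra rL => rt; rewrite mem_filter rt; exact/LP.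
Qed.

Lemma weight0_gen (w : M) : hweight (restrict_h0 Lambda) w -> w = (top w : k) *: gen.
Proof.
move=> ww; apply/eqP; rewrite -subr_eq0; apply/eqP/(vpi_inj (P := P)).
have [f fE] : exists f : {linear M -> {malg k[seq letter]}}, forall x, f x = vpi x.
  by exists vpi.
rewrite -fE linearB linearZ_LR !fE vpi_gen; apply/malgP => s.
rewrite mcoeffB mcoeffZ mcoeffU mcoeff0.
have [<-|s0] := eqVneq [::] s; first by rewrite mulr1 subrr.
rewrite mulr0 subr0; apply: mcoeff_outdom; apply: contra_neqN s0 => sw.
apply/esym/wwt_eq0; apply: (weight_wwt _ sw); by rewrite subr0.
Qed.

(** Scalars act through the enveloping algebra; c is written as (c - 1) 1 + 1 to fit
    [verma_actD]. *)
Lemma submodule_scale (S : set M) c x : is_submodule S -> S x -> S (c *: x).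
Proof.
move=> [_ _ SA] Sx; have := SA ((c - 1) *: 1 + 1) x Sx.
by rewrite verma_actD verma_act1 -[X in _ + X]scale1r -scalerDl subrK.
Qed.

Lemma submodule_wact (S : set M) E (t : seq letter) x : is_submodule S -> S x -> S (wact E t x).
Proof. by move=> [_ _ SA] Sx; elim: t => //= i t IHt; exact: SA. Qed.

Hypothesis k_char0 : [pchar k] =i pred0.

Lemma generates_gen chi (v : M) : v != 0 -> hweight (restrict_h0 Lambda - chi) v ->
  (forall alpha, Delta_plus T alpha -> Qplus T (chi - alpha) ->
     top_part Lambda (hvec P alpha) != 0) ->
  submodule_gen v gen.
Proof.
move=> v0 vw c_neq0; have supp0 : (msupp (vpi v) : seq _) != [::].
  apply: contra_neq v0 => s0; apply: (vpi_inj (P := P)); apply/malgP => s.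
  rewrite mcoeff0 mcoeff_outdom // -[s \in _]/(s \in (msupp (vpi v) : seq _)).
  by rewrite s0.
have [t tv tmax] := seq_argmax (@Psi _ _ _ P N) supp0.
have tw := weight_wwt vw tv; have ts := vpi_sorted tv.
have top_t : top (zact t v) = mcoeff t (vpi v) * top (zact t (Yw t)).
  have [f fE] : exists f : {linear M -> k^o}, forall x, f x = top (zact t x).
    by exists (top \o zact t).
  rewrite -!fE {1}(vpiK P v) /mlin linear_sum (bigD1_seq t) ?fset_uniq //=.
  rewrite [\sum_(i <- _ | _) _]big1_seq; first by rewrite addr0; exact: linearZ_LR.
  (* Another word of the support contributes nothing: it has smaller degree than t, or the same
     degree without being a rearrangement of t, both being sorted. *)
  move=> s /andP[ne_s sv].
  rewrite linearZ_LR fE; have [E|ne] := eqVneq (Psi s) (Psi t); last first.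
    by rewrite top_zact_lt ?scaler0 // lt_neqAle ne tmax.
  have ss := vpi_sorted sv; have [n -> np] := top_zact Lambda N_gt0 ss E.
  have : (n != 0)%N = false.
    rewrite np; apply: contraNF ne_s => ps; apply/eqP/esym.
    exact: (sorted_eq (@leL_trans _ _ _ P N) (@leL_anti _ _ _ P N) ts ss ps).
  by move=> /negbFE/eqP ->; rewrite mulr0 scaler0.
have top_neq0 : top (zact t v) != 0.
  rewrite top_t; apply: mulf_neq0; first by rewrite mcoeff_neq0.
  have [n -> np] := top_zact Lambda N_gt0 ts (erefl (Psi t)).
  rewrite mulf_neq0 //; last by rewrite ((pcharf0P _).1 k_char0 n) np perm_refl.
  rewrite prodf_seq_neq0; apply/allP => i it /=; apply: c_neq0; first exact: lrootP.
  by rewrite -tw; exact: wwt_sub_letter.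
have zE : zact t v = (top (zact t v) : k) *: gen.
  apply: weight0_gen; have := zact_weight t vw.
  by rewrite tw subrK.
have sub := submodule_gen_is v.
have S1 := submodule_wact (@lz _ _ _ P N) t sub (submodule_gen_self v).
have S2 := submodule_scale (top (zact t v) : k)^-1 sub S1.
have E := @scale_solve k M (top (zact t v)) (zact t v) gen top_neq0 zE.
exact: (eq_ind_r (submodule_gen v) S2 E).
Qed.

End Main.

(** The bracket [x, omega y] is, up to sign, also the pairing bracket of omega y and omega x in the
    opposite root space. Choosing x, y with non-zero pairing compares the two elements of h. *)
Lemma hvec_opp (k : fieldType) (g : lieAlgType k) (T : triangular g)
    (P : nondegenerate_pairing T) (b : dual (subLie (tri_h0 T))) :
  Delta_plus T b -> exists c : k, hvec P b = c *: hvec P (- b).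
Proof.
move=> bD; have [x xw x0] := bD.
have [y yw xy0] : exists2 y, weight_space (tri_gp T) b y & form P b x y != 0.
  apply: contrapT => noy; case/eqP: x0.
  apply: (form_nondegl (n := P) (or_introl bD)); first exact/root_spaceP.
  move=> y /root_spaceP yw; apply/eqP/negPn/negP => xy0.
  by apply: noy; exists y => //; exact: yw.
have nD : Delta T (- b) by right; rewrite opprK.
have om z : weight_space (tri_gp T) b z -> root_space T (- b) (tri_omega T z).
  by move=> zw; right; rewrite opprK; split=> //; exists z.
have E1 := pairing_bracket P (or_introl bD) (or_introl (conj bD xw)) (or_introl (conj bD yw)).
have E2 := pairing_bracket P nD (om y yw) (om x xw).
rewrite tri_omegaK bracketC in E2.
exists (- (form P b x y)^-1 * form P (- b) (tri_omega T y) (tri_omega T x)).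
apply: val_inj => /=; rewrite -scalerA -E2 E1 scalerN scaleNr opprK scalerA mulVf //.
by rewrite scale1r.
Qed.

(** * Weight vectors in submodules, primitive vectors and reducibility *)

Section Reducibility.
Variables (k : fieldType) (g : lieAlgType k) (T : triangular g).
Variables (P : nondegenerate_pairing T) (N : nat) (N_gt0 : (0 < N)%N).
Hypothesis k_char0 : [pchar k] =i pred0.
Variable Lambda : dual (subLie (cur N (tri_h T))).
Local Notation wt := (dual (subLie (tri_h0 T))).
Local Notation letter := (letter P N).
Local Notation M := (verma Lambda).
Local Notation gen := (verma_gen Lambda).
Local Notation Yw w := (wact (@ly _ _ _ P N) w gen).
Local Notation vpi := (@vpi _ _ _ P N Lambda).

Lemma top_part_hvec_pos alpha : Delta T alpha -> top_part Lambda (hvec P alpha) = 0 ->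
  exists2 b, Delta_plus T b & top_part Lambda (hvec P b) = 0.
Proof.
move=> [aD|aD] a0; first by exists alpha.
exists (- alpha) => //; have [c ->] := hvec_opp P aD.
rewrite opprK; have := dualP (top_part Lambda) c (hvec P alpha) 0.
by rewrite !addr0 dual0 addr0 a0 scaler0.
Qed.

Lemma submodule_lspan (S : set M) v : is_submodule S -> v \in lspan S -> S v.
Proof.
move=> sub /asboolP[s [sS ->]]; have [S0 SD _] := sub.
elim: s sS => [|p s IHs] sS; first by rewrite big_nil.
rewrite big_cons; apply: SD; first by apply: submodule_scale => //; apply: sS; rewrite mem_head.
by apply: IHs => q qs; apply: sS; rewrite inE qs orbT.
Qed.

Lemma submodule_weight (S : set M) (v : M) : is_submodule S -> S v -> v != 0 ->
  exists chi w, [/\ Qplus T chi, S w, w != 0 & hweight (restrict_h0 Lambda - chi) w].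
Proof.
move=> sub Sv v0.
have supp0 : (msupp (vpi v) : seq _) != [::].
  apply: contra_neq v0 => s0; apply: (vpi_inj (P := P)); apply/malgP => s.
  rewrite mcoeff0 mcoeff_outdom // -[s \in _]/(s \in (msupp (vpi v) : seq _)).
  by rewrite s0.
have [s0 s0v] : exists s0, s0 \in msupp (vpi v).
  case E: (msupp (vpi v) : seq _) supp0 => [//|s0 r] _; exists s0.
  by rewrite -[_ \in _]/(s0 \in (msupp (vpi v) : seq _)) E mem_head.
pose F s : M := mcoeff s (vpi v) *: Yw s.
pose r := undup [seq wwt s | s <- msupp (vpi v)].
pose c a : M := \sum_(s <- msupp (vpi v) | wwt s == a) F s.
have vE : v = \sum_(a <- r) c a.
  rewrite {1}(vpiK P v) /mlin /c (exchange_big_dep xpredT) //= !big_seq.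
  apply: eq_bigr => s sv; rewrite big_mkcond (bigD1_seq (wwt s)) ?undup_uniq ?mem_undup ?map_f //=.
  by rewrite eqxx [X in _ + X]big1 ?addr0 // => a; rewrite eq_sym; case: eqP.
have cw a : hweight (restrict_h0 Lambda - a) (c a).
  move=> t; have [f fE] : exists f : {linear M -> M}, forall y : M, f y = lact (h0t N t) y.
    by exists (lact (h0t N t)).
  rewrite -fE /c linear_sum scaler_sumr; apply: eq_bigr => s /eqP sa.
  by rewrite linearZ_LR fE Yw_weight sa !scalerA mulrC.
have cS a : a \in r -> S (c a).
  move=> ar; apply: (submodule_lspan sub).
  (* As [S] is a bare set, its span is used as the closed subspace; [submodule_lspan] leads back to
     [S]. *)
  apply: (@weight_component k M (subLie (tri_h0 T)) (fun t => lact (h0t N t) : {linear M -> M})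
     wt (fun a t => (restrict_h0 Lambda - a) t : k) (lspan S) _ _ r c _ _ _ a) => //.
  - by move=> a1 a2 E; apply: oppr_inj; apply: (addrI (restrict_h0 Lambda)); exact: weight_inj.
  - move=> t x; apply: lspan_map => y Sy; apply: lspan_incl.
    by have [_ _ SA] := sub; exact: SA.
  - exact: undup_uniq.
  - by move=> a1 t _; exact: cw.
  - by rewrite -vE; exact: lspan_incl.
have s0r : wwt s0 \in r by rewrite mem_undup map_f.
exists (wwt s0), (c (wwt s0)); split; [exact: wwt_Qplus|exact: cS| |exact: cw].
have [f fE] : exists f : {linear M -> k^o}, forall y : M, f y = mcoef s0 (vpi y).
  by exists (mcoef s0 \o vpi).
apply: contraTneq (s0v) => c0; rewrite -mcoeff_eq0.
have : f (c (wwt s0)) = 0 by rewrite c0 linear0.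
rewrite /c linear_sum big_mkcond (bigD1_seq s0) ?fset_uniq //= ?eqxx.
rewrite [\sum_(i <- _ | _) _]big1_seq.
  rewrite addr0 linearZ_LR fE (vpi_Yw Lambda (vpi_sorted s0v)) /mcoef mcoeffUU.
  by move=> E; apply/eqP; rewrite -[LHS]mulr1.
move=> s /andP[ne_s sv]; case: ifP => // _.
rewrite linearZ_LR fE (vpi_Yw Lambda (vpi_sorted sv)) /mcoef mcoeffU (negPf ne_s).
by rewrite scaler0.
Qed.

Lemma primitive_root chi (v : M) : v != 0 -> primitive (restrict_h0 Lambda - chi) v ->
  exists alpha, [/\ Delta_plus T alpha, Qplus T (chi - alpha)
                  & top_part Lambda (hvec P alpha) = 0].
Proof.
move=> v0 [vw [w vNw]]; apply: contrapT => noa; apply: vNw.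
apply: (submodule_gen_full (submodule_gen_is v)).
apply: (generates_gen (P := P) N_gt0 k_char0 v0 vw) => alpha aD aQ.
by apply/eqP => a0; apply: noa; exists alpha.
Qed.

Lemma root_primitive chi alpha : Qplus T chi -> Delta_plus T alpha ->
  Qplus T (chi - alpha) -> top_part Lambda (hvec P alpha) = 0 ->
  exists v : M, v != 0 /\ primitive (restrict_h0 Lambda - chi) v.
Proof.
move=> chiQ aD aQ a0; have [v [v0 vw vR]] := radical_exists N_gt0 chiQ aD aQ a0.
exists v; split=> //; split=> //; exists gen => -[u genE].
have [_ _ RA] := radical_submodule P Lambda.
by apply: (@radical_gen _ _ _ P N Lambda); rewrite genE; exact: RA.
Qed.
End Reducibility.

Theorem theorem7p1 (k : fieldType) (k_char0 : [pchar k] =i pred0)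
    (g : lieAlgType k) (T : triangular g) (P : nondegenerate_pairing T)
    (N : nat) (N_gt0 : (0 < N)%N)
    (Lambda : dual (subLie (cur N (tri_h T))))
    (chi : dual (subLie (tri_h0 T))) (chi_Qplus : Qplus T chi) :
  ((exists v : verma Lambda, v != 0 /\ primitive (restrict_h0 Lambda - chi) v)
   <->
   (exists alpha, [/\ Delta_plus T alpha, Qplus T (chi - alpha)
                     & top_part Lambda (hvec P alpha) = 0]))
  /\
  (reducible Lambda <->
   (exists alpha, Delta T alpha /\ top_part Lambda (hvec P alpha) = 0)).
Proof.
split; split.
- by move=> [v [v0 vp]]; exact: primitive_root vp.
- by move=> [alpha [aD aQ a0]]; exact: root_primitive a0.
- move=> [S [sub [v [Sv v0]] [x nSx]]].
  (* A non-zero weight vector of a proper submodule is primitive, since everything it generates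
     stays inside. *)
  have [eta [w [_ Sw w0 ww]]] := submodule_weight P sub Sv v0.
  have wp : primitive (restrict_h0 Lambda - eta) w.
    split=> //; exists x => -[u xE]; apply: nSx; rewrite xE.
    by have [_ _ SA] := sub; exact: SA.
  have [alpha [aD _ a0]] := primitive_root P N_gt0 k_char0 w0 wp.
  by exists alpha; split=> //; left.
- move=> [alpha [aD a0]]; have [b bD b0] := top_part_hvec_pos aD a0.
  (* Part 1 is applied with chi equal to the root b itself. *)
  have bQ : Qplus T (b - b) by rewrite subrr; exact: Qplus0.
  have [v [v0 [_ [x nx]]]] := root_primitive N_gt0 (Qplus_root bD) bD bQ b0.
  exists (submodule_gen v); split; [exact: submodule_gen_is| |by exists x].
  by exists v; split=> //; exact: submodule_gen_self.
Qed.
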